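(* Let $p$ be a prime, $A,T$ countable $p$-groups, and $\alpha<\omega_1$. Then $$s_\alpha(\mathrm{Ext}(T,A))=s_\alpha(\mathrm{PExt}(T,A))=\mathrm{PExt}(T,A)^\alpha=\mathrm{Ext}(T,A)^{1+\alpha}.$$ In particular, the Solecki rank and the Ulm rank of $\mathrm{PExt}(T,A)$ are equal.
   Context: All groups are abelian. A group with a Polish cover is $G=\hat G/N$ with $\hat G$ a Polish group and $N$ a Polishable subgroup (image of a continuous homomorphism from a Polish group). Polishable subgroups of $G$ are $\hat H/N$ with $\hat H\le\hat G$ Polishable; such a subgroup is itself a group with a Polish cover, and it is $\boldsymbol\Pi^0_3$ in $G$ if $\hat H$ is $\boldsymbol\Pi^0_3$ in $\hat G$. Solecki subgroups: $s_0(G)$ is the closure of $\{0\}$ in $G$ (i.e. $\overline N/N$); $s_1(G)$ is the smallest Polishable subgroup of $G$ that is $\boldsymbol\Pi^0_3$ in $G$; $s_{\alpha+1}(G)=s_1(s_\alpha(G))$; $s_\lambda(G)=\bigcap_{\beta<\lambda}s_\beta(G)$ for limit $\lambda$. The Solecki rank is the least $\alpha$ with $s_\alpha(G)=\{0\}$. Ulm subgroups: $G^0=G$, $G^{\alpha+1}=\bigcap_{n\ge1}nG^\alpha$, $G^\lambda=\bigcap_{\beta<\lambda}G^\beta$; the Ulm rank is the least $\alpha$ such that $G^\alpha$ is the largest divisible subgroup of $G$. For countable $T,A$: $\mathsf Z(T,A)$ is the Polish group (closed in $A^{T\times T}$) of normalized symmetric 2-cocycles $c:T\times T\to A$ ($c(x,0)=0$,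 $c(x,y)=c(y,x)$, $c(y,z)-c(x+y,z)+c(x,y+z)-c(x,y)=0$); $\mathsf B(T,A)$ is the subgroup of coboundaries $c(x,y)=\phi(y)-\phi(x+y)+\phi(x)$ ($\phi(0)=0$); $\mathsf B_{\mathrm w}(T,A)$ is the subgroup of cocycles whose restriction to $S\times S$ is a coboundary on $S$ for every finite subgroup $S\le T$. $\mathrm{Ext}(T,A)=\mathsf Z(T,A)/\mathsf B(T,A)$ and $\mathrm{PExt}(T,A)=\mathsf B_{\mathrm w}(T,A)/\mathsf B(T,A)$ (a Polishable subgroup of $\mathrm{Ext}(T,A)$, equal to $\mathrm{Ext}(T,A)^1$). *)

(* Defs.v *)
From Stdlib Require Import Rdefinitions Raxioms.
From HB Require Import structures.
From mathcomp Require Import all_boot all_algebra.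

Set Implicit Arguments.
Unset Strict Implicit.
Unset Printing Implicit Defensive.

Import GRing.Theory.
Local Open Scope ring_scope.

(* Point-set topology, given explicitly as a family of open sets, so   *)
(* that one carrier may carry several topologies.                      *)
Section PointSet.
Variable X : Type.

Definition topology := (X -> Prop) -> Prop.

Definition metric (d : X -> X -> R) : Prop :=
  (forall x y, Rle R0 (d x y)) /\
  (forall x y, d x y = R0 <-> x = y) /\
  (forall x y, d x y = d y x) /\
  (forall x y z, Rle (d x z) (Rplus (d x y) (d y z))).

Definition metric_open (d : X -> X -> R) (U : X -> Prop) : Prop :=
  forall x, U x -> exists e, Rlt R0 e /\ forall y, Rlt (d x y) e -> U y.

Definition cauchy_seq (d : X -> X -> R) (s : nat -> X) : Prop :=
  forall e, Rlt R0 e -> exists N : nat, forall m n : nat,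
    (N <= m)%N -> (N <= n)%N -> Rlt (d (s m) (s n)) e.

Definition converges_to (d : X -> X -> R) (s : nat -> X) (x : X) : Prop :=
  forall e, Rlt R0 e -> exists N : nat, forall n : nat,
    (N <= n)%N -> Rlt (d (s n) x) e.

Definition polish (tau : topology) : Prop :=
  exists d : X -> X -> R,
    metric d /\
    (forall U, tau U <-> metric_open d U) /\
    (forall s, cauchy_seq d s -> exists x, converges_to d s x) /\
    (exists s : nat -> X, forall x e, Rlt R0 e -> exists n, Rlt (d x (s n)) e).

Definition closed_in (tau : topology) (S : X -> Prop) : Prop :=
  tau (fun x => ~ S x).

Definition closure_in (tau : topology) (S : X -> Prop) (x : X) : Prop :=
  forall U, tau U -> U x -> exists y, U y /\ S y.

Definition Sigma02 (tau : topology) (S : X -> Prop) : Prop :=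
  exists F : nat -> X -> Prop,
    (forall n, closed_in tau (F n)) /\ (forall x, S x <-> exists n, F n x).
Definition Pi02 (tau : topology) (S : X -> Prop) : Prop :=
  Sigma02 tau (fun x => ~ S x).
Definition Sigma03 (tau : topology) (S : X -> Prop) : Prop :=
  exists F : nat -> X -> Prop,
    (forall n, Pi02 tau (F n)) /\ (forall x, S x <-> exists n, F n x).
Definition Pi03 (tau : topology) (S : X -> Prop) : Prop :=
  Sigma03 tau (fun x => ~ S x).

End PointSet.

Definition seteq (X : Type) (P Q : X -> Prop) : Prop := forall x, P x <-> Q x.

(* Countable well-orders: an element a of a countable well-ordered     *)
(* type (O, lt) codes the countable ordinal (order type of {b | b<a}). *)
Definition countable_type (O : Type) : Prop :=
  exists f : O -> nat, forall a b, f a = f b -> a = b.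

Definition strict_well_order (O : Type) (lt : O -> O -> Prop) : Prop :=
  (forall a, ~ lt a a) /\
  (forall a b c, lt a b -> lt b c -> lt a c) /\
  (forall a b, lt a b \/ a = b \/ lt b a) /\
  well_founded lt.

Definition transfinite_seq (O : Type) (lt : O -> O -> Prop) (V : Type)
  (start : V -> Prop) (step : (V -> Prop) -> (V -> Prop))
  (S : O -> V -> Prop) : Prop :=
  (forall a, (forall b, ~ lt b a) -> seteq (S a) start) /\
  (forall a b, lt b a -> (forall c, ~ (lt b c /\ lt c a)) ->
     seteq (S a) (step (S b))) /\
  (forall a, (exists b, lt b a) ->
     (forall b, lt b a -> exists c, lt b c /\ lt c a) ->
     seteq (S a) (fun x => forall b, lt b a -> S b x)).

(* Groups with a Polish cover living inside the ambient Polish group   *)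
(* V = A^(T x T) (product of discrete topologies).                     *)
Section Ambient.
Variables (T A : countZmodType).

Definition amb := T -> T -> A.
Definition v0 : amb := fun _ _ => 0.
Definition vsub (c c' : amb) : amb := fun x y => c x y - c' x y.
Definition vmuln (n : nat) (c : amb) : amb := fun x y => c x y *+ n.

Definition amb_top : topology amb := fun U =>
  forall c, U c -> exists l : seq (T * T),
    forall c', (forall q, q \in l -> c' q.1 q.2 = c q.1 q.2) -> U c'.

Definition subgroup (H : amb -> Prop) : Prop :=
  H v0 /\ forall x y, H x -> H y -> H (vsub x y).

Definition sigH (H : amb -> Prop) := {x : amb | H x}.

(* tau is a Polish group topology on the subgroup H whose inclusion into
   the ambient group is continuous (this topology is unique when it exists) *)
Definition cover_top (H : amb -> Prop) (tau : topology (sigH H)) : Prop :=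
  polish tau /\
  (forall U, tau U -> forall x y z : sigH H,
     proj1_sig z = vsub (proj1_sig x) (proj1_sig y) -> U z ->
     exists U1 U2, tau U1 /\ tau U2 /\ U1 x /\ U2 y /\
       forall x' y' z' : sigH H,
         proj1_sig z' = vsub (proj1_sig x') (proj1_sig y') ->
         U1 x' -> U2 y' -> U z') /\
  (forall U, amb_top U -> tau (fun h => U (proj1_sig h))).

Definition polishable_in (Hh K : amb -> Prop) : Prop :=
  subgroup K /\ (forall x, K x -> Hh x) /\
  exists (tauH : topology (sigH Hh)) (tauK : topology (sigH K)),
    cover_top tauH /\ cover_top tauK /\
    forall U, tauH U ->
      tauK (fun k => exists h : sigH Hh, proj1_sig h = proj1_sig k /\ U h).

Definition Pi03_in (Hh K : amb -> Prop) : Prop :=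
  exists tau : topology (sigH Hh),
    cover_top tau /\ Pi03 tau (fun h => K (proj1_sig h)).

(* Solecki subgroups of G = Gh / N, represented by their preimages in Gh. *)
Definition solecki0 (Gh N : amb -> Prop) : amb -> Prop := fun x =>
  exists tau : topology (sigH Gh), cover_top tau /\
    exists g : sigH Gh, proj1_sig g = x /\
      closure_in tau (fun h => N (proj1_sig h)) g.

(* s_1(Hh/N) = the smallest Polishable Pi^0_3 subgroup of Hh/N *)
Definition solecki1 (N : amb -> Prop) (Hh : amb -> Prop) : amb -> Prop :=
  fun x => forall K : amb -> Prop,
    (forall y, N y -> K y) -> polishable_in Hh K -> Pi03_in Hh K -> K x.

Definition ulm_step (N : amb -> Prop) (H : amb -> Prop) : amb -> Prop :=
  fun x => forall n : nat, (0 < n)%N ->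
    exists y, H y /\ N (vsub x (vmuln n y)).

Definition divisible_part (Gh N : amb -> Prop) : amb -> Prop := fun x =>
  exists D : amb -> Prop, subgroup D /\ (forall y, N y -> D y) /\
    (forall y, D y -> Gh y) /\
    (forall y (n : nat), D y -> (0 < n)%N ->
       exists z, D z /\ N (vsub y (vmuln n z))) /\
    D x.

Definition solecki_seq (O : Type) (lt : O -> O -> Prop)
  (Gh N : amb -> Prop) (S : O -> amb -> Prop) : Prop :=
  transfinite_seq lt (solecki0 Gh N) (solecki1 N) S.

Definition ulm_seq_from (O : Type) (lt : O -> O -> Prop)
  (St N : amb -> Prop) (U : O -> amb -> Prop) : Prop :=
  transfinite_seq lt St (ulm_step N) U.

Definition Zcoc : amb -> Prop := fun c =>
  (forall x, c x 0 = 0) /\ (forall x y, c x y = c y x) /\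
  (forall x y z, c y z - c (x + y) z + c x (y + z) - c x y = 0).

Definition Bcob : amb -> Prop := fun c =>
  exists phi : T -> A, phi 0 = 0 /\
    forall x y, c x y = phi y - phi (x + y) + phi x.

Definition finite_subgroup (l : seq T) : Prop :=
  0 \in l /\ forall x y, x \in l -> y \in l -> x - y \in l.

Definition Bweak : amb -> Prop := fun c =>
  Zcoc c /\
  forall l : seq T, finite_subgroup l ->
    exists phi : T -> A, phi 0 = 0 /\
      forall x y, x \in l -> y \in l -> c x y = phi y - phi (x + y) + phi x.

End Ambient.

Definition p_group (p : nat) (G : zmodType) : Prop :=
  forall a : G, exists n : nat, a *+ (p ^ n)%N = 0.

(* Main.v *)
(* Write T as the union of a chain of finite subgroups T_n.  A cocycle c in B_w is
   a coboundary of some phi_n on each T_n, and the class of c in PExt(T, A) is the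
   class of (phi_(n+1) - phi_n) in lim^1 Hom(T_n, A).  Let Hom_l(T_n, A) be the
   homomorphisms T_n -> A that do not decrease heights below omega l.  The groups
   lim^1 Hom_l(T_n, A) form a decreasing chain; let U_l be the intersection of the
   ones of level < l.  By transfinite induction all four groups of the theorem
   are U_(1 + a), because for each l both the Solecki derivative and the first Ulm
   subgroup of U_l / B are equal to lim^1 Hom_l(T_n, A).

   For the Solecki derivative: U_l has a non-archimedean Polish topology, in which
   c is near 0 when its phi_n can be chosen to vanish for n <= m.  A homomorphism
   in Hom_l(T_n, A) extends to every T_m at any level below l, which identifies
   lim^1 Hom_l(T_n, A) with the c such that for every n a coboundary correction of
   c lies in the closure of the coboundaries of the functions vanishing on T_n;
   this set is Pi^0_3.  Conversely a Pi^0_3 subgroup containing B contains a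
   comeager subset of lim^1 Hom_l(T_n, A) by the Baire category theorem.

   For the Ulm subgroup: p^k kills Hom(T_n, A) for large k, so the elements that
   are divisible by all integers satisfy the description above.  Conversely the
   difference sequence of c in lim^1 Hom_l(T_n, A) can be corrected step by step
   to be p^k times a sequence of lower level, since homomorphisms on the
   p^k-torsion extend without loss of height and every other loss can be absorbed
   in p^k Hom(T_n, A). *)

Require Import Defs.
From Stdlib Require Import Reals Lra.
From HB Require Import structures.
From mathcomp Require Import all_boot all_algebra boolp zify.

Set Implicit Arguments.
Unset Strict Implicit.
Unset Printing Implicit Defensive.

Import GRing.Theory.
Local Open Scope ring_scope.

(** * Identities in abelian groups *)

(** The definitions range over all Polish group topologies refining the ambient one, while the
    argument works with one explicit filtration. By the closed graph theorem every admissible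
    topology is coarser than the one given by the filtration, so closed sets can be moved to the
    explicit topology.

    Extending a homomorphism to a p-th root of a known element loses one step of height. Heights are
    therefore indexed by pairs (d, j), and a finite reserve of steps at one index d < l pays for the
    extension to a finite group. In the division by p^k no reserve is left for the deepest elements;
    hence the modified filtration [deep], which keeps only p^k-torsion beyond the reserve.

    Ext(T, A) is not itself described by lim^1 of the Hom(T_n, A), so its first Ulm subgroup is
    identified with PExt(T, A) directly: a locally split extension splits modulo n, and a cocycle
    with values in nA is divided by n along a chain of cyclic extensions. The statement on ranks
    rests moreover on the fact that PExt(T, A) has no nonzero divisible subgroup, so that both ranks
    record when the common group becomes B. *)

Inductive zexpr :=
  | ZVar of nat | ZZero | ZAdd of zexpr & zexpr | ZOpp of zexpr
  | ZMuln of zexpr & nat.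

Fixpoint zeval (V : zmodType) (env : seq V) (e : zexpr) : V :=
  match e with
  | ZVar i => env`_i
  | ZZero => 0
  | ZAdd a b => zeval env a + zeval env b
  | ZOpp a => - zeval env a
  | ZMuln a n => zeval env a *+ n
  end.

Fixpoint zcoef (e : zexpr) (i : nat) : int :=
  match e with
  | ZVar j => ((i == j) : nat)%:Z
  | ZZero => 0
  | ZAdd a b => zcoef a i + zcoef b i
  | ZOpp a => - zcoef a i
  | ZMuln a n => zcoef a i *+ n
  end.

Lemma zeval_coef (V : zmodType) (env : seq V) e :
  zeval env e = \sum_(i < size env) env`_i *~ zcoef e i.
Proof.
elim: e => [j||a IHa b IHb|a IHa|a IHa n] /=.
- case: (ltnP j (size env)) => [ltj|lej].
    rewrite (bigD1 (Ordinal ltj)) //= eqxx mulr1z big1 ?addr0 // => i.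
    by rewrite -val_eqE /= => /negbTE->.
  rewrite nth_default // big1 // => i _; case: eqP => // ij.
  by have := ltn_ord i; rewrite ij ltnNge lej.
- by rewrite big1 // => i _; rewrite mulr0z.
- by rewrite IHa IHb -big_split; apply: eq_bigr => i _; rewrite mulrzDr.
- by rewrite IHa -sumrN; apply: eq_bigr => i _; rewrite mulrNz.
- rewrite IHa -sumrMnl; apply: eq_bigr => i _.
  by rewrite -mulr_natr natz mulrzA pmulrn.
Qed.

(** Both sides are integer combinations of the atoms, so it suffices to compare coefficients, and
    that comparison is a computation. *)
Lemma zeval_eq (V : zmodType) (env : seq V) e1 e2 :
  all (fun i => zcoef e1 i == zcoef e2 i) (iota 0 (size env)) ->
  zeval env e1 = zeval env e2.
Proof.
move=> /allP H; rewrite !zeval_coef; apply: eq_bigr => i _.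
by rewrite (eqP (H i _)) // mem_iota /= add0n.
Qed.

Ltac zmem a l :=
  match l with
  | nil => constr:(false)
  | ?b :: _ => let _ := match goal with _ => unify a b end in constr:(true)
  | _ :: ?l => zmem a l
  end.
Ltac zatoms t l :=
  match t with
  | (?a + ?b)%R => let l := zatoms a l in zatoms b l
  | (- ?a)%R => zatoms a l
  (* If the factor is not a numeral, this branch fails and the match falls through to the last one:
     the whole multiple becomes an atom. *)
  | (?a *+ ?n)%R =>
      match isnat n with true => zatoms a l end
  | 0%R => l
  | _ => match zmem t l with true => l | false => constr:(t :: l) end
  end
with isnat n :=
  match n with O => constr:(true) | S ?m => isnat m end.
Ltac zindex a l :=
  match l with
  | ?b :: _ => let _ := match goal with _ => unify a b end in constr:(O)
  | _ :: ?l => let i := zindex a l in constr:(S i)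
  end.
Ltac zquote t l :=
  match t with
  | (?a + ?b)%R => let a := zquote a l in let b := zquote b l in constr:(ZAdd a b)
  | (- ?a)%R => let a := zquote a l in constr:(ZOpp a)
  | (?a *+ ?n)%R =>
      match isnat n with true => let a := zquote a l in constr:(ZMuln a n) end
  | 0%R => constr:(ZZero)
  | _ => let i := zindex t l in constr:(ZVar i)
  end.
Ltac zmodule :=
  match goal with
  | |- @eq ?V ?x ?y =>
      let l := zatoms x (@nil V) in
      let l := zatoms y l in
      let ex := zquote x l in
      let ey := zquote y l in
      exact: (@zeval_eq _ l ex ey isT)
  end.

(** * The Baire category theorem *)

Lemma dependent_choice_from (X : Type) (P : nat -> X -> Prop)
    (Q : nat -> X -> X -> Prop) (x0 : X) :
  P 0%N x0 -> (forall n x, P n x -> exists y, P n.+1 y /\ Q n x y) ->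
  exists f : nat -> X,
    f 0%N = x0 /\ forall n, P n (f n) /\ Q n (f n) (f n.+1).
Proof.
move=> P0 PS.
pose step n x := if pselect (exists y, P n.+1 y /\ Q n x y) is left h
                 then projT1 (cid h) else x.
have stepP n x : P n x -> P n.+1 (step n x) /\ Q n x (step n x).
  move=> Px; rewrite /step; case: pselect => [h|]; first exact: (projT2 (cid h)).
  by case; exact: PS.
pose f := nat_rect (fun=> X) x0 step.
exists f; split=> // n.
have Pf : P n (f n) by elim: n => // n /stepP[].
by split=> //; have [] := stepP n _ Pf.
Qed.

Lemma Rinv_nat_gt0 n : Rlt R0 (Rinv (INR n.+1)).
Proof. by apply: Rinv_0_lt_compat; apply: lt_0_INR; apply/ltP. Qed.

Lemma Rinv_nat_small e : Rlt R0 e -> exists n : nat, Rlt (Rinv (INR n.+1)) e.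
Proof.
move=> e0; have [n [ne n0]] := archimed_cor1 e e0.
by exists n.-1; rewrite prednK //; apply/ltP.
Qed.

Lemma Rinv_nat_le m n : (m <= n)%N -> Rle (Rinv (INR n.+1)) (Rinv (INR m.+1)).
Proof.
move=> mn; apply: Rinv_le_contravar; first by apply: lt_0_INR; apply/ltP.
by apply: le_INR; apply/leP.
Qed.

Section Baire.
Variables (X : Type) (d : X -> X -> R).
Hypothesis d_metric : metric d.
Hypothesis d_complete :
  forall s, cauchy_seq d s -> exists x, converges_to d s x.

Let d0 x : d x x = R0. Proof. by case: d_metric => _ [] /(_ x x) [] _ ->. Qed.
Let dC x y : d x y = d y x. Proof. by case: d_metric => _ [_ []]. Qed.
Let dT x y z : Rle (d x z) (Rplus (d x y) (d y z)).
Proof. by case: d_metric => _ [_ []]. Qed.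

Lemma limit_ball (s : nat -> X) (x y : X) (r : R) (N : nat) :
  converges_to d s x -> (forall n, (N <= n)%N -> Rle (d y (s n)) r) ->
  Rle (d y x) r.
Proof.
move=> sx H; case: (Rle_lt_dec (d y x) r) => // lt_r.
have [M HM] := sx (Rminus (d y x) r) ltac:(lra).
have := HM _ (leq_maxr N M); have := H _ (leq_maxl N M).
by have := dT y (s (maxn N M)) x; lra.
Qed.

Lemma baire_category (D : nat -> X -> Prop) :
  (forall k, metric_open d (D k)) ->
  (forall k x e, Rlt R0 e -> exists y, Rlt (d x y) e /\ D k y) ->
  forall x e, Rlt R0 e -> exists y, Rlt (d x y) e /\ forall k, D k y.
Proof.
move=> Dopen Ddense x e e0.
(* The states are balls, given by centre and radius. In [Q] the closed next ball lies in the open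
   current one and in [D n]; the bound on the radii makes the centres a Cauchy sequence. *)
pose P n (u : X * R) := Rlt R0 u.2 /\ Rle u.2 (Rinv (INR n.+1)).
pose Q n (u v : X * R) :=
  forall z, Rle (d v.1 z) v.2 -> Rlt (d u.1 z) u.2 /\ D n z.
have P0 : P 0%N (x, Rmin e 1).
  split => /=; first by apply: Rmin_pos; lra.
  by rewrite Rinv_1; apply: Rmin_r.
have PS n u : P n u -> exists v, P n.+1 v /\ Q n u v.
  case: u => a r [/= r0 rn]; have [b [ab Db]] := Ddense n a (Rdiv r 2) ltac:(lra).
  have [t [t0 Ht]] := Dopen n b Db.
  pose s := Rmin (Rdiv r 2) (Rmin (Rdiv t 2) (Rinv (INR n.+2))).
  have s1 : Rle s (Rdiv r 2) by apply: Rmin_l.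
  have s23 : Rle s (Rmin (Rdiv t 2) (Rinv (INR n.+2))) by apply: Rmin_r.
  have s2 := Rle_trans _ _ _ s23 (Rmin_l _ _).
  have s3 := Rle_trans _ _ _ s23 (Rmin_r _ _).
  exists (b, s); split.
    split=> //=; apply: Rmin_pos; [lra|apply: Rmin_pos; [lra|exact: Rinv_nat_gt0]].
  move=> z /= bz; split; first by have := dT a b z; lra.
  by apply: Ht; lra.
have [f [f0 Hf]] := dependent_choice_from P0 PS.
have fP n : P n (f n) by have [] := Hf n.
have fQ n : Q n (f n) (f n.+1) by have [] := Hf n.
have nest m k z : Rle (d (f (m + k)%N).1 z) (f (m + k)%N).2 ->
    Rle (d (f m).1 z) (f m).2.
  elim: k => [|k IH]; rewrite ?addn0 // addnS => /fQ[lt_z _].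
  by apply: IH; lra.
have inball m n : (m <= n)%N -> Rle (d (f m).1 (f n).1) (f m).2.
  move=> mn; apply: (@nest m (n - m)%N); rewrite subnKC // d0.
  by have [] := fP n; lra.
have [z fz] : exists z, converges_to d (fun n => (f n).1) z.
  apply: d_complete => t t0.
  have [N HN] := @Rinv_nat_small (Rdiv t 2) ltac:(lra).
  exists N => m n Nm Nn; have [_ rN] := fP N.
  have := inball _ _ Nm; have := inball _ _ Nn.
  by have := dT (f m).1 (f N).1 (f n).1; rewrite (dC (f m).1 (f N).1); lra.
have zb m : Rle (d (f m).1 z) (f m).2.
  by apply: (@limit_ball _ _ _ _ m fz) => n; exact: inball.
exists z; split; last by move=> k; have [] := fQ k _ (zb k.+1).
have [] := fQ 0%N _ (zb 1%N); rewrite f0 /= => lt_z _.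
by have := Rmin_l e 1; lra.
Qed.

(** Otherwise the points with a neighbourhood missing [F n], together with the points far from x,
    form a dense open set for every n, and Baire gives a point near x in no [F n]. As the [F n] are
    arbitrary sets, the conclusion is density in a ball. *)
Lemma baire_cover (F : nat -> X -> Prop) : (forall x, exists n, F n x) ->
  forall x e, Rlt R0 e -> exists n y r, [/\ Rlt R0 r,
    forall z, Rlt (d y z) r -> Rlt (d x z) e
    & forall z t, Rlt (d y z) r -> Rlt R0 t -> exists w, Rlt (d z w) t /\ F n w].
Proof.
move=> cover x e e0; apply: contrapT => none.
pose D n y := Rlt (Rdiv e 2) (d x y) \/
  exists t, Rlt R0 t /\ forall w, Rlt (d y w) t -> ~ F n w.
have Dopen n : metric_open d (D n).
  move=> y [lt_y|[t [t0 Ht]]].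
    exists (Rminus (d x y) (Rdiv e 2)); split; first lra.
    by move=> z yz; left; have := dT x z y; rewrite (dC z); lra.
  exists (Rdiv t 2); split; first lra.
  move=> z yz; right; exists (Rdiv t 2); split; first lra.
  by move=> w zw; apply: Ht; have := dT y z w; lra.
have Ddense n y r : Rlt R0 r -> exists z, Rlt (d y z) r /\ D n z.
  move=> r0; apply: contrapT => noz; apply: none.
  have ND z : Rlt (d y z) r -> ~ D n z by move=> yz Dz; apply: noz; exists z.
  exists n, y, r; split=> // z.
    move=> /ND ND'; case: (Rle_lt_dec e (d x z)); last by [].
    by move=> ez; case: ND'; left; lra.
  move=> t /ND ND' t0; apply: contrapT => now; apply: ND'; right.
  by exists t; split=> // w zw Fw; apply: now; exists w.
have [y [xy Dy]] := baire_category Dopen Ddense x (e := Rdiv e 2) ltac:(lra).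
have [n Fn] := cover y.
case: (Dy n) => [|[t [t0 Ht]]]; first lra.
by apply: (Ht y) => //; rewrite d0.
Qed.

End Baire.

(** * Polish groups *)

Definition group_topology (G : zmodType) (tau : topology G) : Prop :=
  forall U, tau U -> forall x y, U (x - y) ->
    exists U1 U2, tau U1 /\ tau U2 /\ U1 x /\ U2 y /\
      forall x' y', U1 x' -> U2 y' -> U (x' - y').

Lemma metric_open_ball (X : Type) (d : X -> X -> R) (x : X) e :
  metric d -> metric_open d (fun y => Rlt (d x y) e).
Proof.
move=> [_ [_ [_ dT]]] y xy; exists (Rminus e (d x y)); split; first lra.
by move=> z yz; have := dT x y z; lra.
Qed.

Section PolishGroup.
Variables (G : zmodType) (d : G -> G -> R).
Hypothesis d_metric : metric d.
Hypothesis d_complete :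
  forall s, cauchy_seq d s -> exists x, converges_to d s x.
Hypothesis d_group : group_topology (metric_open d).

Let d0 x : d x x = R0. Proof. by case: d_metric => _ [] /(_ x x) [] _ ->. Qed.
Let dC x y : d x y = d y x. Proof. by case: d_metric => _ [_ []]. Qed.
Let dT x y z : Rle (d x z) (Rplus (d x y) (d y z)).
Proof. by case: d_metric => _ [_ []]. Qed.

Lemma sub_continuous x y e : Rlt R0 e -> exists t, Rlt R0 t /\
  forall x' y', Rlt (d x x') t -> Rlt (d y y') t -> Rlt (d (x - y) (x' - y')) e.
Proof.
move=> e0.
have [|U1 [U2 [o1 [o2 [U1x [U2y H]]]]]] :=
  d_group (metric_open_ball (x := x - y) (e := e) d_metric) (x := x) (y := y).
  by rewrite d0.
have [t1 [t10 H1]] := o1 _ U1x; have [t2 [t20 H2]] := o2 _ U2y.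
exists (Rmin t1 t2); split; first exact: Rmin_pos.
move=> x' y' xx' yy'; have := Rmin_l t1 t2; have := Rmin_r t1 t2.
by move=> ? ?; apply: H; [apply: H1|apply: H2]; lra.
Qed.

Lemma add_continuous x y e : Rlt R0 e -> exists t, Rlt R0 t /\
  forall x' y', Rlt (d x x') t -> Rlt (d y y') t -> Rlt (d (x + y) (x' + y')) e.
Proof.
move=> e0; have [t1 [t10 H1]] := sub_continuous x (- y) e0.
have [t2 [t20 H2]] := sub_continuous 0 y t10.
exists (Rmin t1 t2); split; first exact: Rmin_pos.
move=> x' y' xx' yy'.
have m1 := Rmin_l t1 t2; have m2 := Rmin_r t1 t2.
have := H1 x' (- y'); rewrite !opprK; apply; first lra.
by have := H2 0 y'; rewrite !sub0r d0; apply; lra.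
Qed.

(* The metric need not be invariant, so a sequence that is Cauchy for the
   group uniformity need not be Cauchy for d; by Baire, some translate of its
   opposite is. *)
Lemma group_cauchy_converges (x : nat -> G) :
  (forall e, Rlt R0 e -> exists N, forall n m, (N <= n)%N -> (n <= m)%N ->
     Rlt (d 0 (x m - x n)) e) ->
  exists y, converges_to d x y.
Proof.
move=> xC.
pose D k h := exists N g t, Rlt R0 t /\ forall h' n, Rlt (d h h') t ->
  (N <= n)%N -> Rlt (d g (h' - x n)) (Rinv (INR k.+1)).
have Dopen k : metric_open d (D k).
  move=> h [N [g [t [t0 H]]]]; exists (Rdiv t 2); split; first lra.
  move=> h1 hh1; exists N, g, (Rdiv t 2); split; first lra.
  by move=> h' n h1h'; apply: H; have := dT h h1 h'; lra.
have Ddense k h0 e : Rlt R0 e -> exists h, Rlt (d h0 h) e /\ D k h.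
  move=> e0; have [t1 [t10 H1]] := add_continuous h0 0 e0.
  have [N HN] := xC _ t10; pose g := h0 - x N.
  have [t3 [t30 H3]] := add_continuous g 0 (Rinv_nat_gt0 k).
  have [t2 [t20 H2]] := sub_continuous 0 0 t30.
  have [M HM] := xC _ t20; pose M' := maxn N M.
  exists (h0 + (x M' - x N)); split.
    have := H1 h0 (x M' - x N); rewrite addr0 d0; apply => //.
    by apply: HN; rewrite ?leq_maxl.
  set h := h0 + _; have [t [t0 Ht]] := sub_continuous h h t20.
  exists M', g, t; split=> // h' n hh' Mn.
  have -> : h' - x n = g + ((h' - h) - (x n - x M')) by rewrite /g /h; zmodule.
  have := H3 g ((h' - h) - (x n - x M')); rewrite addr0 d0; apply => //.
  have := H2 (h' - h) (x n - x M'); rewrite subr0; apply.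
    by have := Ht h' h hh'; rewrite subrr d0 => /(_ t0).
  by apply: HM => //; rewrite leq_maxr.
have [h [_ Dh]] := baire_category d_metric d_complete Dopen Ddense 0 Rlt_0_1.
have [z hz] : exists z, converges_to d (fun n => h - x n) z.
  apply: d_complete => e e0.
  have [k Hk] := @Rinv_nat_small (Rdiv e 2) ltac:(lra).
  have [N [g [t [t0 H]]]] := Dh k; exists N => m n Nm Nn.
  have := H h m; have := H h n; rewrite d0 => /(_ t0 Nn) ? /(_ t0 Nm) ?.
  by have := dT (h - x m) g (h - x n); rewrite (dC _ g); lra.
exists (h - z) => e e0; have [t [t0 H]] := sub_continuous h z e0.
have [N HN] := hz _ t0; exists N => n Nn.
rewrite dC; have := H h (h - x n); rewrite d0 subKr; apply => //.
by rewrite dC; apply: HN.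
Qed.

End PolishGroup.

(** * Non-archimedean Polish groups *)

Section FilteredGroup.
Variables (G : zmodType) (W : nat -> G -> Prop).

(** What makes a decreasing sequence of subgroups a basis at 0 of a Polish group topology: the last
    three conditions say that the topology is Hausdorff, separable and complete. *)
Definition filtration : Prop :=
  [/\ forall m, W m 0 /\ forall x y, W m x -> W m y -> W m (x - y),
      forall m x, W m.+1 x -> W m x,
      forall x, (forall m, W m x) -> x = 0,
      exists s : nat -> G, forall x m, exists n, W m (x - s n)
    & forall x : nat -> G, (forall m, W m (x m.+1 - x m)) ->
        exists y, forall m, W m (y - x m)].

Definition filtration_topology : topology G :=
  fun U => forall x, U x -> exists m, forall y, W m (y - x) -> U y.

Hypothesis WP : filtration.

Let W0 m : W m 0. Proof. by case: WP => /(_ m) []. Qed.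
Let WB m x y : W m x -> W m y -> W m (x - y).
Proof. by case: WP => /(_ m) [_ +] _ _ _ _; apply. Qed.
Let WN m x : W m x -> W m (- x). Proof. by rewrite -sub0r; apply: WB. Qed.
Let WD m x y : W m x -> W m y -> W m (x + y).
Proof. by move=> ? ?; rewrite -[y]opprK; apply/WB/WN. Qed.

Lemma filtration_le m n x : (m <= n)%N -> W n x -> W m x.
Proof.
move=> /subnK <-; elim: (n - m)%N => // k IH; rewrite addSn.
by case: WP => _ WS _ _ _ /WS.
Qed.

Lemma filtration_group_topology : group_topology filtration_topology.
Proof.
move=> U oU x y /oU [m Hm].
have oW a : filtration_topology (fun z => W m (z - a)).
  move=> z za; exists m => t tz.
  have -> : t - a = (t - z) + (z - a) by zmodule.
  by apply: WD.
exists (fun z => W m (z - x)), (fun z => W m (z - y)).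
split; [exact: oW|split; [exact: oW|rewrite !subrr; do 2!split => //]].
move=> x' y' xx' yy'; apply: Hm.
have -> : x' - y' - (x - y) = (x' - x) - (y' - y) by zmodule.
exact: WB.
Qed.

Let nexit x : x <> 0 -> exists m, `[< ~ W m x >].
Proof.
move=> x0; apply: contrapT => none; case: WP => _ _ sep _ _.
by apply/x0/sep => m; apply: contrapT => nW; apply: none; exists m; apply/asboolP.
Qed.

(** The value is 1/(n+1) for the first level n that does not contain x, so the norm is below 1/(m+1)
    exactly on [W m]. *)
Definition filtration_norm (x : G) : R :=
  if pselect (x <> 0) is left x0 then Rinv (INR (ex_minn (nexit x0)).+1) else R0.

Let norm0 : filtration_norm 0 = R0.
Proof. by rewrite /filtration_norm; case: pselect. Qed.

Lemma filtration_normP x m : Rlt (filtration_norm x) (Rinv (INR m.+1)) <-> W m x.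
Proof.
rewrite /filtration_norm; case: pselect => [x0|/contrapT ->]; last first.
  by split=> // _; apply: Rinv_nat_gt0.
case: ex_minnP => n /asboolP nW minn; split=> [lt|Wx].
  apply: contrapT => nWm; have /minn nm : `[< ~ W m x >] by apply/asboolP.
  by have := Rinv_nat_le nm; lra.
apply: Rinv_lt_contravar.
  by apply: Rmult_lt_0_compat; apply: lt_0_INR; apply/ltP.
apply: lt_INR; apply/ltP; rewrite ltnS ltnNge; apply/negP => nm.
exact/nW/(filtration_le nm).
Qed.

Let norm_ge0 x : Rle R0 (filtration_norm x).
Proof.
rewrite /filtration_norm; case: pselect => *; last exact: Rle_refl.
exact/Rlt_le/Rinv_nat_gt0.
Qed.

Let norm_sub x y : Rle (filtration_norm (x - y))
  (Rmax (filtration_norm x) (filtration_norm y)).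
Proof.
case: (pselect (x - y <> 0)) => [xy0|/contrapT ->]; last first.
  by rewrite norm0; apply: Rle_trans (Rmax_l _ _).
rewrite {1}/filtration_norm; case: pselect => // xy0'.
case: ex_minnP => n /asboolP nW _.
case: (Rle_lt_dec (Rinv (INR n.+1))
  (Rmax (filtration_norm x) (filtration_norm y))) => // lt.
by case: nW; apply: WB; apply/filtration_normP;
  apply: Rle_lt_trans lt; [apply: Rmax_l|apply: Rmax_r].
Qed.

Let dist x y := filtration_norm (y - x).

Let normN x : filtration_norm (- x) = filtration_norm x.
Proof.
have le z : Rle (filtration_norm (- z)) (filtration_norm z).
  by have := norm_sub 0 z; rewrite sub0r norm0 Rmax_right.
by apply: Rle_antisym; have := le x; have := le (- x); rewrite opprK.
Qed.

Lemma filtration_polish : polish filtration_topology.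
Proof.
exists dist; split; [split; [|split; [|split]]|split; [|split]].
- by move=> x y; apply: norm_ge0.
- move=> x y; split=> [xy|->]; last by rewrite /dist subrr norm0.
  case: WP => _ _ sep _ _; apply/esym/subr0_eq/sep => m.
  by apply/filtration_normP; rewrite -/(dist x y) xy; apply: Rinv_nat_gt0.
- by move=> x y; rewrite /dist -normN opprB.
- move=> x y z; rewrite /dist.
  have -> : z - x = (y - x) - (y - z) by zmodule.
  apply: Rle_trans (norm_sub _ _) _; rewrite -(normN (y - z)) opprB.
  have max_le a b : Rle R0 a -> Rle R0 b -> Rle (Rmax a b) (Rplus a b).
    by move=> *; apply: Rmax_lub; lra.
  exact: max_le.
- move=> U; split=> oU x /oU.
    move=> [m Hm]; exists (Rinv (INR m.+1)); split; first exact: Rinv_nat_gt0.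
    by move=> y /filtration_normP; apply: Hm.
  move=> [e [/Rinv_nat_small [m me] He]]; exists m => y /filtration_normP ?.
  by apply: He; rewrite /dist; lra.
- move=> s sC.
  have small m : exists N : nat, forall i j : nat, (N <= i)%N -> (N <= j)%N ->
      W m (s j - s i).
    have [N HN] := sC _ (Rinv_nat_gt0 m).
    by exists N => i j Ni Nj; apply/filtration_normP; apply: HN.
  (* A running maximum makes the thresholds monotone, so that consecutive terms of the subsequence
     differ by elements of [W m]. *)
  pose N m := (\max_(i < m.+1) projT1 (cid (small i)))%N.
  have NP m i j : (N m <= i)%N -> (N m <= j)%N -> W m (s j - s i).
    have le : (projT1 (cid (small m)) <= N m)%N.
      exact: (leq_bigmax (F := fun i : 'I_m.+1 => projT1 (cid (small i))) ord_max).
    by move=> /(leq_trans le) ? /(leq_trans le) ?; apply: (projT2 (cid (small m))).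
  have NS m : (N m <= N m.+1)%N by rewrite /N [leqRHS]big_ord_recr /= leq_maxl.
  have [|y Hy] := (let: And5 _ _ _ _ c := WP in c) (fun m => s (N m)).
    by move=> m; apply: NP.
  exists y => e /Rinv_nat_small [m me]; exists (N m) => n Nn.
  apply: Rlt_trans me; apply/filtration_normP.
  have -> : y - s n = (y - s (N m)) - (s n - s (N m)) by zmodule.
  by apply: WB => //; apply: NP.
- case: WP => _ _ _ [s Hs] _; exists s => x e /Rinv_nat_small [m me].
  have [n Hn] := Hs x m; exists n; rewrite /dist -normN opprB.
  by apply: Rlt_trans me; apply/filtration_normP.
Qed.

Lemma baire_filtration (D : nat -> G -> Prop) :
  (forall k x, D k x -> exists m, forall y, W m (y - x) -> D k y) ->
  (forall k x m, exists y, W m (y - x) /\ D k y) ->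
  exists y, forall k, D k y.
Proof.
have [d [dm [dtau [dc _]]]] := filtration_polish.
move=> Dopen Ddense.
have [||y [_ Dy]] := @baire_category _ _ dm dc D _ _ 0 1 Rlt_0_1; last by exists y.
  by move=> k; apply/dtau => x /Dopen.
move=> k x e e0.
have /dtau/(_ x)[|m Hm] := metric_open_ball (x := x) (e := e) dm.
  by case: dm => _ [] /(_ x x) [_ ->].
by have [y [/Hm yx Dy]] := Ddense k x m; exists y.
Qed.

Lemma baire_filtration_cover (F : nat -> G -> Prop) (x : G) (m : nat) :
  (forall x, exists n, F n x) ->
  exists n y l, W m (y - x) /\
    forall z k, W l (z - y) -> exists w, W k (w - z) /\ F n w.
Proof.
have [d [dm [dtau [dc _]]]] := filtration_polish.
have d0 z : d z z = R0 by case: dm => _ [] /(_ z z) [_ ->].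
have oW k a : metric_open d (fun z => W k (z - a)).
  apply/dtau => z za; exists k => t tz.
  have -> : t - a = (t - z) + (z - a) by zmodule.
  by apply: WD.
have oB a e : Rlt R0 e -> exists k, forall y, W k (y - a) -> Rlt (d a y) e.
  move=> e0; have /dtau/(_ a) := metric_open_ball (x := a) (e := e) dm.
  by apply; rewrite d0.
move=> cover; have [|e [e0 He]] := oW m x x; first by rewrite subrr.
have [n [y [r [r0 yx Hr]]]] := baire_cover dm dc cover x e0.
have [l Hl] := oB y r r0.
exists n, y, l; split; first by apply/He/yx; rewrite d0.
move=> z k /Hl yz; have [|t [t0 Ht]] := oW k z z; first by rewrite subrr.
by have [w [zw Fw]] := Hr z t yz t0; exists w; split=> //; apply: Ht.
Qed.

(** A comeager set and its translate by x meet, so every x is a difference of two elements of the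
    comeager set. *)
Lemma comeager_subgroup (K : G -> Prop) (D : nat -> G -> Prop) :
  (forall x y, K x -> K y -> K (x - y)) ->
  (forall k x, D k x -> exists m, forall y, W m (y - x) -> D k y) ->
  (forall k x m, exists y, W m (y - x) /\ D k y) ->
  (forall x, (forall k, D k x) -> K x) -> forall x, K x.
Proof.
move=> KB Dopen Ddense DK x.
(* Even indices carry the family [D], odd ones its translate by x. *)
pose E k y := if odd k then D k./2 (y - x) else D k./2 y.
have [||y Ey] := @baire_filtration E.
- move=> k y; rewrite /E; case: ifP => _ /Dopen [m Hm]; exists m => z zy;
  apply: Hm => //.
  by have -> : z - x - (y - x) = z - y by zmodule.
- move=> k y m; rewrite /E; case: (odd k); last exact: Ddense.
  have [z [zy Dz]] := Ddense k./2 (y - x) m; exists (z + x); split.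
    by have -> : z + x - y = z - (y - x) by zmodule.
  by rewrite addrK.
have -> : x = y - (y - x) by zmodule.
apply: KB; apply: DK => k.
  by have := Ey (false + k.*2)%N; rewrite /E oddD odd_double half_bit_double.
by have := Ey (true + k.*2)%N; rewrite /E oddD odd_double half_bit_double.
Qed.

End FilteredGroup.

(** * The closed graph theorem *)

Section ClosedGraph.
Variables (G : zmodType) (W : nat -> G -> Prop) (tau : topology G).
Hypothesis WP : filtration W.
Hypothesis tau_polish : polish tau.
Hypothesis tau_group : group_topology tau.
Hypothesis limits_agree : forall (s : nat -> G) y z,
  (forall m, exists N, forall n, (N <= n)%N -> W m (s n - y)) ->
  (forall U, tau U -> U z -> exists N, forall n, (N <= n)%N -> U (s n)) -> y = z.

Let W0 m : W m 0. Proof. by case: WP => /(_ m) []. Qed.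
Let WB m x y : W m x -> W m y -> W m (x - y).
Proof. by case: WP => /(_ m) [_ +] _ _ _ _; apply. Qed.
Let WN m x : W m x -> W m (- x). Proof. by rewrite -sub0r; apply: WB. Qed.
Let WD m x y : W m x -> W m y -> W m (x + y).
Proof. by move=> ? ?; rewrite -[y]opprK; apply/WB/WN. Qed.

(** Banach's argument for the identity map. By Baire each tau-ball about 0 is W-dense in some [W m].
    Successive approximation then puts some [W m] inside a tau-ball: the partial sums converge for
    tau, and [limits_agree] identifies the limit. *)
Lemma closed_graph U : tau U -> filtration_topology W U.
Proof.
have [d [dm [dtau [dc [s sd]]]]] := tau_polish.
have dg : group_topology (metric_open d).
  move=> V /dtau oV x y /(tau_group oV) [U1 [U2 [/dtau ? [/dtau ? ?]]]].
  by exists U1, U2.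
have d0 x : d x x = R0 by case: dm => _ [] /(_ x x) [_ ->].
have dC x y : d x y = d y x by case: dm => _ [_ []].
have dT x y z : Rle (d x z) (Rplus (d x y) (d y z)) by case: dm => _ [_ []].
have dense t : Rlt R0 t -> exists m, forall x k, W m x ->
    exists y, Rlt (d 0 y) t /\ W k (y - x).
  move=> t0; have [t' [t'0 Ht]] := sub_continuous dm dg 0 0 t0.
  pose F n x := Rlt (d 0 (x - s n)) t'.
  have cover x : exists n, F n x.
    have [r [r0 Hr]] := sub_continuous dm dg x x t'0.
    have [n Hn] := sd x r r0; exists n; rewrite /F.
    by have := Hr x (s n); rewrite subrr d0; apply.
  have [n [y [l [_ H]]]] := baire_filtration_cover WP 0 0 cover.
  exists l => x k Wx.
  have [|y1 [Wy1 F1]] := H y (maxn l k); first by rewrite subrr.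
  have [|y2 [Wy2 F2]] := H (y1 + x) k.
    have -> : y1 + x - y = (y1 - y) + x by zmodule.
    by apply: WD => //; apply: filtration_le Wy1; rewrite ?leq_maxl.
  exists (y2 - y1); split.
    have := Ht _ _ F2 F1; rewrite subr0.
    by have -> : y2 - s n - (y1 - s n) = y2 - y1 by zmodule.
  by have -> : y2 - y1 - x = y2 - (y1 + x) by zmodule.
have small t : Rlt R0 t -> exists m, forall x, W m x -> Rlt (d 0 x) t.
  move=> t0.
  have halve e : Rlt R0 e -> exists r, Rlt R0 r /\
      forall u v, Rlt (d 0 u) r -> Rlt (d 0 v) r -> Rlt (d 0 (u + v)) e.
    move=> e0; have [r [r0 Hr]] := add_continuous dm dg 0 0 e0.
    by exists r; split=> // u v u0 v0; have := Hr _ _ u0 v0; rewrite addr0.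
  have [r0 [r00 Hr0]] := halve t t0.
  (* Two elements of ball n + 1 add up to an element of ball n, so the tails of the approximating
     series from n on stay in ball n. *)
  have [||r [rE rP]] := @dependent_choice_from R (fun _ r => Rlt R0 r)
      (fun n r r' => (forall u v, Rlt (d 0 u) r' -> Rlt (d 0 v) r' ->
         Rlt (d 0 (u + v)) r) /\ Rle r' (Rinv (INR n.+1))) r0.
  - by [].
  - move=> n e /halve [e' [e'0 He']]; exists (Rmin e' (Rinv (INR n.+1))).
    have m1 := Rmin_l e' (Rinv (INR n.+1)); have m2 := Rmin_r e' (Rinv (INR n.+1)).
    split; first by apply: Rmin_pos => //; apply: Rinv_nat_gt0.
    by split=> // u v u0 v0; apply: He'; lra.
  have rgt0 n : Rlt R0 (r n) by have [] := rP n.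
  have radd n u v : Rlt (d 0 u) (r n.+1) -> Rlt (d 0 v) (r n.+1) ->
    Rlt (d 0 (u + v)) (r n) by have [_ [+ _]] := rP n; apply.
  have rle n : Rle (r n.+1) (Rinv (INR n.+1)) by have [_ []] := rP n.
  (* Since [mm n] is at least n, the errors of the approximation tend to 0 for W. *)
  pose mm n := maxn n (projT1 (cid (dense _ (rgt0 n)))).
  have mmP n x k : W (mm n) x -> exists y, Rlt (d 0 y) (r n) /\ W k (y - x).
    move=> Wx; apply: (projT2 (cid (dense _ (rgt0 n)))).
    by apply: filtration_le Wx; rewrite ?leq_maxr.
  exists (mm 1%N) => x Wx.
  have [||sg [sg0 sgP]] := @dependent_choice_from G
    (fun n g => W (mm n.+1) (x - g))
    (fun n g g' => Rlt (d 0 (g' - g)) (r n.+1)) 0.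
  - by rewrite subr0.
  - move=> n g /(mmP _ _ (mm n.+2)) [y [y0 Wy]]; exists (g + y); split.
      have -> : x - (g + y) = - (y - (x - g)) by zmodule.
      exact: WN.
    by rewrite addrC addKr.
  have tail k n : Rlt (d 0 (sg (n + k)%N - sg n)) (r n).
    elim: k n => [|k IH] n; first by rewrite addn0 subrr d0.
    have -> : sg (n + k.+1)%N - sg n =
      (sg (n.+1 + k)%N - sg n.+1) + (sg n.+1 - sg n) by rewrite addSnnS; zmodule.
    by apply: radd => //; have [] := sgP n.
  have [z sgz] : exists z, converges_to d sg z.
    apply: (group_cauchy_converges dm dc dg) => e /Rinv_nat_small [N HN].
    exists N.+1 => -[//|n] m Nn nm; have := tail (m - n.+1)%N n.+1.
    by rewrite subnKC //; have := rle n; have := Rinv_nat_le (Nn : (N <= n)%N); lra.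
  have xz : x = z.
    apply: (limits_agree (s := sg)) => [m|V /dtau oV /oV [e [e0 He]]].
      exists m => n mn; rewrite -opprB; apply/WN.
      have [/(filtration_le WP) + _] := sgP n; apply.
      by rewrite leq_max (leq_trans mn).
    by have [N HN] := sgz e e0; exists N => n /HN Hn; apply: He; rewrite dC.
  have [e [e0 He]] := sub_continuous dm dg x x (rgt0 0%N).
  have [N HN] := sgz e e0.
  have -> : x = (x - sg N) + sg N by zmodule.
  apply: Hr0; rewrite -rE.
    have := He x (sg N); rewrite subrr d0; apply => //.
    by rewrite dC xz; apply: HN.
  by have := tail N 0%N; rewrite add0n sg0 subr0.
move=> /dtau oU x /oU [e [e0 He]].
have [t [t0 Ht]] := add_continuous dm dg x 0 e0.
have [m Hm] := small t t0; exists m => y /Hm yx; apply: He.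
have := Ht x (y - x); rewrite addr0 d0 => /(_ t0 yx).
by rewrite addrC addrNK.
Qed.

End ClosedGraph.

(** * Extension of homomorphisms *)

Definition subgroup_of (G : zmodType) (S : G -> Prop) : Prop :=
  S 0 /\ forall x y, S x -> S y -> S (x - y).

Definition additive_on (T A : zmodType) (S : T -> Prop) (f : T -> A) : Prop :=
  forall x y, S x -> S y -> f (x + y) = f x + f y.

Definition finite_pred (T : eqType) (S : T -> Prop) : Prop :=
  exists l : seq T, forall x, S x -> x \in l.

Section SubgroupOf.
Variables (G : zmodType) (S : G -> Prop).
Hypothesis SP : subgroup_of S.

Lemma subgroup0 : S 0. Proof. by case: SP. Qed.
Lemma subgroupB x y : S x -> S y -> S (x - y). Proof. by case: SP => _; apply. Qed.
Lemma subgroupN x : S x -> S (- x).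
Proof. by rewrite -sub0r; apply/subgroupB/subgroup0. Qed.
Lemma subgroupD x y : S x -> S y -> S (x + y).
Proof. by move=> ? ?; rewrite -[y]opprK; apply/subgroupB/subgroupN. Qed.
Lemma subgroupMn x n : S x -> S (x *+ n).
Proof.
move=> Sx; elim: n => [|n IH]; first exact: subgroup0.
by rewrite mulrS; apply: subgroupD.
Qed.

Variables (A : zmodType) (f : G -> A).
Hypothesis fD : additive_on S f.

Lemma additive_on0 : f 0 = 0.
Proof.
by apply: (addrI (f 0)); rewrite -fD ?addr0 //; apply: subgroup0.
Qed.
Lemma additive_onN x : S x -> f (- x) = - f x.
Proof.
move=> Sx; apply/eqP; rewrite -addr_eq0; apply/eqP.
by rewrite -fD ?addNr ?additive_on0 //; apply: subgroupN.
Qed.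
Lemma additive_onB x y : S x -> S y -> f (x - y) = f x - f y.
Proof. by move=> Sx Sy; rewrite fD ?additive_onN //; apply: subgroupN. Qed.
Lemma additive_onMn x n : S x -> f (x *+ n) = f x *+ n.
Proof.
move=> Sx; elim: n => [|n IH]; first by rewrite !mulr0n additive_on0.
by rewrite !mulrS fD ?IH //; apply: subgroupMn.
Qed.
End SubgroupOf.

Lemma subgroup_Mn_of_B (G : zmodType) (S : G -> Prop) x n :
  (forall x y, S x -> S y -> S (x - y)) -> S x -> S (x *+ n).
Proof.
move=> SB Sx; apply: subgroupMn => //; split=> //.
by rewrite -(subrr x); apply: SB.
Qed.

Lemma subgroup_D_of_B (G : zmodType) (S : G -> Prop) x y :
  (forall x y, S x -> S y -> S (x - y)) -> S x -> S y -> S (x + y).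
Proof.
move=> SB Sx Sy; apply: subgroupD => //; split=> //.
by rewrite -(subrr x); apply: SB.
Qed.

Lemma list_minimum (X : eqType) (P : X -> Prop) (R : X -> X -> Prop) (l : seq X) :
  (forall x, P x -> R x x) ->
  (forall x y, P x -> P y -> R x y \/ R y x) ->
  (forall y x z, R x y -> R y z -> R x z) ->
  (exists2 x, x \in l & P x) ->
  exists x, [/\ x \in l, P x & forall y, y \in l -> P y -> R x y].
Proof.
move=> Rr Rt Rtr; elim: l => [[]//|a l IH].
case: (pselect (exists2 x, x \in l & P x)) => [/IH [z [zl Pz zmin]] _|none [x]].
  case: (pselect (P a /\ R a z)) => [[Pa az]|naz].
    exists a; split; rewrite ?mem_head // => y; rewrite inE => /orP[/eqP->|yl] Py.
      exact: Rr.
    by apply: Rtr az _; apply: zmin.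
  exists z; split; rewrite ?inE ?zl ?orbT // => y.
  rewrite inE => /orP[/eqP->|yl] Py; last exact: zmin.
  by case: (Rt z a) => // az; case: naz.
rewrite inE => /orP[/eqP->|xl] Px; last by case: none; exists x.
exists a; split; rewrite ?mem_head // => y; rewrite inE => /orP[/eqP->|yl] Py.
  exact: Rr.
by case: none; exists y.
Qed.

(** Multiplication by k is thus invertible, with inverse u, on the elements killed by p^N. *)
Lemma coprime_inverse p k N : prime p -> ~~ (p %| k)%N ->
  exists u q, (k * u = 1 + q * p ^ N)%N.
Proof.
move=> pr nk; have k0 : (0 < k)%N by case: k nk; rewrite ?dvdn0.
have /coprimeP : coprime k (p ^ N).
  by rewrite coprime_sym coprimeXl // prime_coprime.
move=> /(_ k0) [[u q] /= E]; exists u, q; rewrite mulnC -E subnK //.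
by apply/ltnW; rewrite -subn_gt0 E.
Qed.

Definition adjoin (T : zmodType) (S : T -> Prop) (x : T) : T -> Prop :=
  fun w => exists s i, S s /\ w = s + x *+ i.

Section Extension.
Variables (p : nat) (T A : zmodType).
Hypothesis p_prime : prime p.
Hypothesis pT : p_group p T.
Hypothesis pA : p_group p A.

Lemma adjoin_sub (S : T -> Prop) x s : S s -> adjoin S x s.
Proof. by move=> Ss; exists s, 0%N; rewrite mulr0n addr0. Qed.

Lemma adjoin_gen (S : T -> Prop) x : subgroup_of S -> adjoin S x x.
Proof. by case=> S0 _; exists 0, 1%N; rewrite mulr1n add0r. Qed.

Lemma adjoin_subgroup (S : T -> Prop) x : subgroup_of S -> subgroup_of (adjoin S x).
Proof.
move=> SP; split; first by apply: adjoin_sub; apply: subgroup0.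
move=> _ _ [s [i [Ss ->]]] [t [j [St ->]]].
(* Coefficients of x are natural numbers, so -x is written as p^n - 1 times x. *)
have [n xn] := pT x; exists (s - t), (i + j * (p ^ n - 1))%N.
split; first exact: subgroupB.
rewrite mulrnDr [(j * _)%N]mulnC mulrnA mulrnBr ?expn_gt0 ?prime_gt0 // xn.
rewrite mulr1n sub0r mulNrn; zmodule.
Qed.

Lemma adjoin_finite (S : T -> Prop) x : finite_pred S -> finite_pred (adjoin S x).
Proof.
case=> l Sl; have [n xn] := pT x.
exists [seq s + x *+ i | s <- l, i <- iota 0 (p ^ n)] => _ [s [i [/Sl sl ->]]].
apply/allpairsP; exists (s, (i %% p ^ n)%N); split=> //=.
  by rewrite mem_iota /= add0n ltn_mod expn_gt0 prime_gt0.
by rewrite {1}(divn_eq i (p ^ n)) mulrnDr [(_ %/ _ * _)%N]mulnC mulrnA xn mul0rn add0r.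
Qed.

Lemma subgroup_Mn_dvd (S : T -> Prop) z k :
  subgroup_of S -> ~ S z -> S (z *+ k) -> (p %| k)%N.
Proof.
move=> SP nSz Sk; apply/negPn/negP => nk; apply: nSz.
have [N zN] := pT z; have [u [q E]] := coprime_inverse N p_prime nk.
have -> : z = z *+ (k * u)%N.
  by rewrite E mulrnDr mulr1n [(q * _)%N]mulnC mulrnA zN mul0rn addr0.
by rewrite mulrnA; apply: subgroupMn.
Qed.

Variables (I : Type) (X : I -> T -> Prop) (Y : I -> A -> Prop).
Hypothesis XB : forall i x y, X i x -> X i y -> X i (x - y).
Hypothesis YB : forall i x y, Y i x -> Y i y -> Y i (x - y).
Hypothesis chain : forall i j x y, X i x -> X j y ->
  ((forall z, X i z -> X j z) /\ (forall a, Y i a -> Y j a)) \/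
  ((forall z, X j z -> X i z) /\ (forall a, Y j a -> Y i a)).
Hypothesis best : forall z, z <> 0 ->
  exists i, X i z /\ forall j, X j z -> forall a, Y i a -> Y j a.

(* Among the elements of the coset x + S choose z as deep as possible in the
   filtration X; an image a of z with p a = f (p z) that lies equally deep in
   Y then works for all multiples of z at once. *)
Lemma extend_to_adjoin (S : T -> Prop) (f : T -> A) (x : T) :
  subgroup_of S -> finite_pred S -> additive_on S f ->
  (forall i s, S s -> X i s -> Y i (f s)) ->
  (forall i z, X i z -> S (z *+ p) -> exists a, Y i a /\ f (z *+ p) = a *+ p) ->
  S (x *+ p) ->
  exists f', [/\ forall s, S s -> f' s = f s, additive_on (adjoin S x) f'
    & forall i w, adjoin S x w -> X i w -> Y i (f' w)].
Proof.
move=> SP [l Sl] fD fXY fdiv Sxp.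
case: (pselect (S x)) => [Sx|nSx].
  have adjS w : adjoin S x w -> S w.
    by move=> [s [i [Ss ->]]]; apply: subgroupD => //; apply: subgroupMn.
  exists f; split=> // [u v /adjS Su /adjS Sv|i w /adjS Sw]; last exact: fXY.
  exact: fD.
pose P w := S (w - x).
have Pn0 w : P w -> w <> 0.
  move=> Pw w0; apply/nSx; have -> : x = - (w - x) by rewrite w0; zmodule.
  exact: subgroupN.
(* [ii w] is a deepest index of w; it exists on the coset of x because 0 is not in that coset. *)
pose ii w := if pselect (w <> 0) is left h then Some (projT1 (cid (best h))) else None.
have iiP w : P w -> exists i, ii w = Some i /\ X i w /\
    forall j, X j w -> forall a, Y i a -> Y j a.
  move=> /Pn0 w0; rewrite /ii; case: pselect => // h.
  by exists (projT1 (cid (best h))); split=> //; apply: (projT2 (cid (best h))).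
pose YY w a := if ii w is Some i then Y i a else True.
have [||||z [zl Pz zmin]] := @list_minimum _ P (fun u v => forall a, YY u a -> YY v a)
    [seq x + s | s <- l].
- by [].
- move=> u v /iiP [i [Ei [Xi _]]] /iiP [j [Ej [Xj _]]].
  by rewrite /YY Ei Ej; case: (chain Xi Xj) => [[_ ?]|[_ ?]]; [left|right].
- by move=> v u w uv vw a /uv/vw.
- exists x; last by rewrite /P subrr; apply: subgroup0.
  by apply/mapP; exists 0; rewrite ?addr0 //; apply: Sl; apply: subgroup0.
have [i0 [Ei0 [Xz zbest]]] := iiP z Pz.
have Szp : S (z *+ p).
  have -> : z = (z - x) + x by zmodule.
  by rewrite mulrnDl; apply: subgroupD => //; apply: subgroupMn.
have [a [Ya Ea]] := fdiv i0 z Xz Szp.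
have nSz : ~ S z.
  move=> Sz; apply: nSx; have -> : x = z - (z - x) by zmodule.
  exact: subgroupB.
have Szk k : S (z *+ k) -> (p %| k)%N by apply: subgroup_Mn_dvd.
(* p divides every k for which k z lies in S, so all relations come from p z, where a was chosen to
   match f. *)
have wd s t i j : S s -> S t -> s + z *+ i = t + z *+ j ->
    f s + a *+ i = f t + a *+ j.
  wlog ij : s t i j / (i <= j)%N.
    move=> H Ss St E; case: (leqP i j) => [le|/ltnW le]; first exact: H.
    by apply/esym/(H t s j i).
  move=> Ss St; rewrite -(subnKC ij) !mulrnDr => E.
  have E' : s = t + z *+ (j - i).
    by apply: (addIr (z *+ i)); rewrite E; zmodule.
  have Sk : S (z *+ (j - i)).
    have -> : z *+ (j - i) = s - t by rewrite E'; zmodule.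
    exact: subgroupB.
  have /dvdnP [q Eq] := Szk _ Sk.
  move: Sk E'; rewrite Eq [(q * p)%N]mulnC !mulrnA => Sk ->.
  rewrite fD // (additive_onMn SP fD _ Szp) Ea; zmodule.
pose f' w := if pselect (exists u : T * nat, S u.1 /\ w = u.1 + z *+ u.2) is left h
  then f (projT1 (cid h)).1 + a *+ (projT1 (cid h)).2 else 0.
have f'E s i : S s -> f' (s + z *+ i) = f s + a *+ i.
  move=> Ss; rewrite /f'; case: pselect => [h|[]]; last by exists (s, i).
  by case: cid => -[t j] /= [St E]; apply: wd.
have zform w : adjoin S x w -> exists s i, S s /\ w = s + z *+ i.
  move=> [s [i [Ss ->]]]; exists (s + (x - z) *+ i), i; split.
    apply: subgroupD => //; apply: subgroupMn => //.
    by rewrite -opprB; apply: subgroupN.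
  by rewrite mulrnBl; zmodule.
exists f'; split.
- move=> s Ss; by have := f'E s 0%N Ss; rewrite !mulr0n !addr0.
- move=> _ _ /zform [s [i [Ss ->]]] /zform [t [j [St ->]]].
  have -> : s + z *+ i + (t + z *+ j) = (s + t) + z *+ (i + j).
    by rewrite mulrnDr; zmodule.
  rewrite !f'E ?fD ?mulrnDr //; first zmodule.
  exact: subgroupD.
move=> j _ /zform [s [i [Ss ->]]] Xw.
have [N zN] := pT z; have [M wM] := pA (f' (s + z *+ i)); have [M' aM'] := pA a.
case: (boolP (p %| i)%N) => [/dvdnP [q Eq]|ni].
  have Sw : S (s + z *+ i).
    rewrite Eq [(q * p)%N]mulnC mulrnA; apply: subgroupD => //.
    exact: subgroupMn.
  have := f'E (s + z *+ i) 0%N Sw; rewrite !mulr0n !addr0 => ->.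
  exact: fXY.
(* If p does not divide i, an inverse u of i modulo a large power of p brings the element into the
   coset of z, where z is deepest; multiplying back by i preserves the level. *)
pose K := (N + M + M')%N.
have [u [q E]] := coprime_inverse K p_prime ni.
have kill (V : zmodType) (v : V) n : v *+ p ^ n = 0 -> (n <= K)%N ->
    v *+ (i * u) = v.
  move=> v0 nK; rewrite E mulrnDr mulr1n -(subnK nK) expnD mulnA mulnC mulrnA v0.
  by rewrite mul0rn addr0.
have fw : f' (s + z *+ i) = f' ((s + z *+ i) *+ u) *+ i.
  rewrite mulrnDl -mulrnA (kill _ z N) ?leq_addr //; last first.
    by rewrite /K -addnA leq_addr.
  rewrite -[z in RHS]mulr1n !f'E //; last exact: subgroupMn.
  rewrite mulr1n (additive_onMn SP fD) // -[in LHS](kill _ (f s + a *+ i) M); last 2 first.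
  - by rewrite -f'E.
  - by rewrite /K addnAC leq_addl.
  rewrite mulnC mulrnA mulrnDl; congr ((_ + _) *+ _).
  by rewrite -mulrnA (kill _ a M') // leq_addl.
have Xwu : X j ((s + z *+ i) *+ u) by apply: subgroup_Mn_of_B (@XB j) _.
rewrite fw; apply: subgroup_Mn_of_B (@YB j) _.
move: Xwu; rewrite mulrnDl -mulrnA (kill _ z N) //; last first.
  by rewrite /K -addnA leq_addr.
rewrite -[z]mulr1n f'E ?mulr1n; last exact: subgroupMn.
set w := s *+ u + z => Xw'.
have Ssu : S (s *+ u) by apply: subgroupMn.
have Pw : P w.
  rewrite /P; have -> : w - x = s *+ u + (z - x) by rewrite /w; zmodule.
  exact: subgroupD.
have Y0j b : Y i0 b -> Y j b.
  move=> Yb.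
  have wl : w \in [seq x + s | s <- l].
    apply/mapP; exists (w - x); first exact: Sl.
    by zmodule.
  have [k [Ek [_ kbest]]] := iiP w Pw.
  apply: (kbest j) => //.
  by have := zmin w wl Pw b; rewrite /YY Ei0 Ek; apply.
apply: subgroup_D_of_B (@YB j) _ _; last exact: Y0j.
(* Both z and w, hence their difference, lie at the shallower of the levels i0 and j, whichever way
   these compare. *)
have Es : s *+ u = w - z by rewrite /w; zmodule.
case: (chain Xz Xw') => [[Xsub _]|[Xsub Ysub]].
  by apply: fXY => //; rewrite Es; apply: XB => //; apply: Xsub.
by apply: Y0j; apply: fXY => //; rewrite Es; apply: XB => //; apply: Xsub.
Qed.
End Extension.

(** * Ulm filtrations *)

Section ExtendList.
Variables (p : nat) (T : zmodType) (X : Type).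
Hypothesis p_prime : prime p.
Hypothesis pT : p_group p T.
Variables (P : nat -> (T -> Prop) -> X -> Prop) (agree : (T -> Prop) -> X -> X -> Prop).
Hypothesis agree_refl : forall S f, agree S f f.
Hypothesis agree_trans : forall (S S' : T -> Prop) f g h, (forall s, S s -> S' s) ->
  agree S f g -> agree S' g h -> agree S f h.
Hypothesis P_step : forall m S f x, subgroup_of S -> finite_pred S ->
  P m.+1 S f -> S (x *+ p) -> exists f', agree S f f' /\ P m (adjoin S x) f'.

Let ext m (S : T -> Prop) f (Q : (T -> Prop) -> Prop) :=
  exists S' f', [/\ subgroup_of S' /\ finite_pred S', forall s, S s -> S' s,
    Q S', agree S f f' & P m S' f'].

Lemma extend_element e x m S f : subgroup_of S -> finite_pred S ->
  P (m + e)%N S f -> S (x *+ p ^ e) -> ext m S f (fun S' => S' x).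
Proof.
elim: e x m S f => [|e IH] x m S f SP Sf PS Sx.
  by exists S, f; split=> //; move: PS; rewrite addn0.
have [||||S1 [f1 [[S1P S1f] sub1 S1x f1E P1]]] := IH (x *+ p) m.+1 S f => //.
- by rewrite addSnnS.
- by rewrite -mulrnA -expnS.
have [f2 [f2E P2]] := P_step S1P S1f P1 S1x.
exists (adjoin S1 x), f2; split=> //.
- by split; [apply: adjoin_subgroup p_prime pT _ _ _|
             apply: adjoin_finite p_prime pT _ _ _].
- by move=> s /sub1; apply: adjoin_sub.
- exact: adjoin_gen.
- exact: agree_trans sub1 f1E f2E.
Qed.

(** If p^e x = 0, then x is reached by adjoining p^(e-1) x, ..., p x, x, each at the price of one
    unit of the first argument of [P]. So L is a sum of exponents: it depends on l alone and can be
    fixed before S and f. *)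
Lemma extend_list (l : seq T) : exists L, forall m S f,
  subgroup_of S -> finite_pred S -> P (m + L)%N S f ->
  ext m S f (fun S' => forall x, x \in l -> S' x).
Proof.
elim: l => [|x l [L IH]].
  exists 0%N => m S f SP Sf PS; exists S, f; split=> //.
  by move: PS; rewrite addn0.
have [e xe] := pT x; exists (e + L)%N => m S f SP Sf PS.
have [|S1 [f1 [[S1P S1f] sub1 S1l f1E P1]]] := IH (m + e)%N S f SP Sf.
  by rewrite -addnA.
have [|S2 [f2 [S2P sub2 S2x f2E P2]]] := extend_element S1P S1f P1 (x := x).
  by rewrite xe; apply: subgroup0.
exists S2, f2; split=> //.
- by move=> s /sub1/sub2.
- by move=> y; rewrite inE => /orP[/eqP->|/S1l/sub2].
- exact: agree_trans sub1 f1E f2E.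
Qed.
End ExtendList.

Definition eq_on (T B : Type) (S : T -> Prop) (f g : T -> B) : Prop :=
  forall s, S s -> g s = f s.

Lemma eq_on_refl (T B : Type) (S : T -> Prop) (f : T -> B) : eq_on S f f.
Proof. by []. Qed.

Lemma eq_on_trans (T B : Type) (S S' : T -> Prop) (f g h : T -> B) :
  (forall s, S s -> S' s) -> eq_on S f g -> eq_on S' g h -> eq_on S f h.
Proof. by move=> sub fg gh s Ss; rewrite gh ?fg //; apply: sub. Qed.


Section UlmFiltration.
Variables (p : nat) (I : Type) (lt : I -> I -> Prop).

(* The group p^(omega c) G. *)
Inductive ulm (G : zmodType) (c : I) (x : G) : Prop :=
  Ulm of (forall d, lt d c -> forall j, exists z, ulm d z /\ x = z *+ p ^ j).

Definition ulm_pow (G : zmodType) c j (x : G) := exists z, ulm c z /\ x = z *+ p ^ j.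

Lemma ulmP (G : zmodType) c (x : G) :
  ulm c x <-> forall d, lt d c -> forall j, ulm_pow d j x.
Proof. by split=> [[]|]. Qed.

Lemma ulm_pow0 (G : zmodType) c (x : G) : ulm_pow c 0 x <-> ulm c x.
Proof.
split=> [[z [? ->]]|]; first by rewrite expn0 mulr1n.
by exists x; rewrite expn0 mulr1n.
Qed.

Hypothesis lt_wo : strict_well_order lt.

Let ltxx a : ~ lt a a. Proof. by case: lt_wo => + _; apply. Qed.
Let lt_trans b a c : lt a b -> lt b c -> lt a c.
Proof. by case: lt_wo => _ [+ _]; apply. Qed.
Let lt_total a b : lt a b \/ a = b \/ lt b a.
Proof. by case: lt_wo => _ [_ [+ _]]; apply. Qed.

Lemma ulm_subgroup (G : zmodType) c : subgroup_of (@ulm G c).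
Proof.
have [_ [_ [_ wf]]] := lt_wo.
elim/(well_founded_ind wf): c => c IH; split.
  constructor=> d dc j; exists 0; rewrite mul0rn; split=> //.
  exact: subgroup0 (IH d dc).
move=> x y [Hx] [Hy]; constructor=> d dc j.
have [u [Su ->]] := Hx d dc j; have [v [Sv ->]] := Hy d dc j.
exists (u - v); rewrite mulrnBl; split=> //; exact: subgroupB (IH d dc) _ _ Su Sv.
Qed.

Lemma ulm_pow_subgroup (G : zmodType) c j : subgroup_of (@ulm_pow G c j).
Proof.
split; first by exists 0; rewrite mul0rn; split=> //; apply: (subgroup0 (ulm_subgroup G c)).
move=> _ _ [u [Su ->]] [v [Sv ->]]; exists (u - v); rewrite mulrnBl.
by split=> //; apply: (subgroupB (ulm_subgroup G c)).
Qed.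

Definition idx_le c j d i := lt c d \/ c = d /\ (j <= i)%N.

Lemma idx_le_total c j d i : idx_le c j d i \/ idx_le d i c j.
Proof.
case: (lt_total c d) => [?|[->|?]]; [by left; left| |by right; left].
by case: (leqP j i) => [?|/ltnW ?]; [left|right]; right.
Qed.

Lemma idx_le_trans d i c j e k : idx_le c j d i -> idx_le d i e k -> idx_le c j e k.
Proof.
move=> [cd|[-> ji]] [de|[<- ik]].
- by left; apply: lt_trans de.
- by left.
- by left.
- by right; split=> //; apply: leq_trans ik.
Qed.

Lemma ulm_pow_le (G : zmodType) c j d i (x : G) :
  idx_le c j d i -> ulm_pow d i x -> ulm_pow c j x.
Proof.
move=> [cd|[-> ji]] [z [uz ->]].
  apply: (subgroupMn (ulm_pow_subgroup G c j)).
  by case: uz => /(_ c cd j).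
exists (z *+ p ^ (i - j)); rewrite -mulrnA -expnD subnK //; split=> //.
exact: (subgroupMn (ulm_subgroup G d)).
Qed.

Lemma ulm_pow_ulm (G : zmodType) c j (x : G) : ulm_pow c j x -> ulm c x.
Proof. by move=> [z [uz ->]]; apply: (subgroupMn (ulm_subgroup G c)). Qed.

Lemma ulm_pow_mulp (G : zmodType) c j (x : G) :
  ulm_pow c j x -> ulm_pow c j.+1 (x *+ p).
Proof. by move=> [z [uz ->]]; exists z; rewrite -mulrnA -expnSr. Qed.

Lemma ulm_pow_divp (G : zmodType) c j (x : G) :
  ulm_pow c j.+1 x -> exists y, ulm_pow c j y /\ x = y *+ p.
Proof.
move=> [z [uz ->]]; exists (z *+ p ^ j); rewrite -mulrnA -expnSr.
by split=> //; exists z.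
Qed.

Section Deep.
Variables (T A : zmodType) (k : nat) (l : I).

(* The index (c, j) stands for p^(omega c + j).  Up to (b, K) this is the usual
   filtration of T; beyond (b, K) it is cut down to the p^k-torsion, and at the
   top index l it is the filtration of the bounded group (p^(omega l) T)[p^k]
   by its own multiples.  Only the cut at (b, K) loses a step when homomorphisms
   are extended. *)
Definition deep b K c j (x : T) : Prop :=
  (idx_le c j b K /\ ulm_pow c j x) \/
  (~ idx_le c j b K /\ lt c l /\ ulm_pow c j x /\ x *+ p ^ k = 0) \/
  (c = l /\ exists z, ulm l z /\ z *+ p ^ k = 0 /\ x = z *+ p ^ j).

Definition deep_hom b K (S : T -> Prop) (f : T -> A) : Prop :=
  additive_on S f /\ forall c j x, S x -> deep b K c j x -> ulm_pow c j (f x).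

Variable b : I.
Hypothesis bl : lt b l.

Lemma deep_ulm_pow K c j x : deep b K c j x -> ulm_pow c j x.
Proof. by move=> [[]//|[[_ [_ []]]//|[-> [z [? [_ ->]]]]]]; exists z. Qed.

Lemma deepB K c j x y : deep b K c j x -> deep b K c j y -> deep b K c j (x - y).
Proof.
have nl i : ~ idx_le l i b K.
  by move=> [/(lt_trans bl)|[E _]]; [exact: ltxx|move: bl; rewrite E; apply: ltxx].
have uB := subgroupB (ulm_pow_subgroup T c j).
move=> [[lo ux]|[[hi [cl [ux x0]]]|[cl [z [uz [z0 xE]]]]]].
- move=> [[_ uy]|[[//]|[cl]]]; first by left; split=> //; apply: uB.
  by case: (nl j); rewrite -cl.
- move=> [[//]|[[_ [_ [uy y0]]]|[cl']]].
    right; left; do 2![split=> //]; split; first exact: uB.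
    by rewrite mulrnBl x0 y0 subr0.
  by move: cl; rewrite cl' => /ltxx.
- move=> [[]|[[_ []]|[_ [t [ut [t0 yE]]]]]]; first by rewrite cl => /nl.
    by rewrite cl => /ltxx.
  right; right; split=> //; exists (z - t); rewrite !mulrnBl z0 t0 xE yE subr0.
  by split=> //; apply: (subgroupB (ulm_subgroup T l)).
Qed.

Lemma deep_le K c j d i x : idx_le c j d i -> deep b K d i x -> deep b K c j x.
Proof.
move=> le dx; have ux := ulm_pow_le le (deep_ulm_pow dx).
case: (pselect (idx_le c j b K)) => [lo|hi]; first by left.
move: dx => [[lo]|[[_ [dl [_ x0]]]|[E [z [uz [z0 xE]]]]]].
- by case: hi; apply: idx_le_trans lo.
- right; left; split=> //; split=> //.
  by case: le => [cd|[->]//]; apply: lt_trans dl.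
- move: le; rewrite E => -[cl|[-> ji]]; right; [left|right].
    do 3![split=> //]; by rewrite xE -mulrnA mulnC mulrnA z0 mul0rn.
  split=> //; exists (z *+ p ^ (i - j)); split.
    exact: (subgroupMn (ulm_subgroup T l)).
  by rewrite xE -mulrnA mulnC mulrnA z0 mul0rn -mulrnA -expnD subnK.
Qed.

(** Multiplication by p moves the cut from (b, K) to (b, K + 1); this is the unit of K spent at each
    extension step. *)
Lemma deep_mulp K c j x : deep b K c j x -> deep b K.+1 c j.+1 (x *+ p).
Proof.
move=> [[lo ux]|[[hi [cl [ux x0]]]|[cl [z [uz [z0 xE]]]]]].
- left; split; last exact: ulm_pow_mulp.
  by case: lo => [?|[-> ?]]; [left|right].
- right; left; split.
    by move=> [?|[? ?]]; apply: hi; [left|right].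
  split=> //; split; first exact: ulm_pow_mulp.
  by rewrite -mulrnA mulnC mulrnA x0 mul0rn.
- by right; right; split=> //; exists z; rewrite xE -mulrnA -expnSr.
Qed.

(** On elements killed by p^k the filtrations for all cuts below l agree, which lets a homomorphism
    pass from one cut to another. *)
Lemma deep_torsion b' K K' c j x : lt b' l -> x *+ p ^ k = 0 ->
  deep b' K' c j x -> deep b K c j x.
Proof.
move=> b'l x0 [[lo ux]|[[hi [cl [ux _]]]|top]].
- have cl : lt c l by case: lo => [cb|[->]//]; apply: lt_trans b'l.
  by case: (pselect (idx_le c j b K)) => ?; [left|right; left].
- by case: (pselect (idx_le c j b K)) => ?; [left|right; left].
- by right; right.
Qed.

Lemma deep_hom_le K K' S f : (K <= K')%N -> deep_hom b K' S f -> deep_hom b K S f.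
Proof.
move=> KK [fD fd]; split=> // c j x Sx dx; apply: fd => //.
move: dx => [[lo ux]|[[hi [cl [ux x0]]]|top]]; [left| |by right; right].
  split=> //; case: lo => [|[-> jK]]; first by left.
  by right; split=> //; apply: leq_trans KK.
by case: (pselect (idx_le c j b K')) => ?; [left|right; left].
Qed.

(** The depth is attained because a nonzero x fails at (l, k), where p^k kills the witness: take the
    least failing c, then the least failing j at c, and step back by one. *)
Lemma deep_best K x : x <> 0 -> exists c j, deep b K c j x /\
  forall d i, deep b K d i x -> forall a : A, ulm_pow c j a -> ulm_pow d i a.
Proof.
move=> x0; have [_ [_ [_ wf]]] := lt_wo.
pose bad c := exists j, (lt c l \/ c = l) /\ ~ deep b K c j x.
have bad_l : bad l.
  exists k; split; [by right|move=> [[lo _]|[[_ [/ltxx]]//|[_ [z [_ [z0 xE]]]]]]].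
    by case: lo => [/(lt_trans bl)/ltxx|[E]] //; move: bl; rewrite E => /ltxx.
  by case: x0; rewrite xE z0.
have [c [[j [cl nd]] cmin]] : exists c, bad c /\ forall d, lt d c -> ~ bad d.
  apply: contrapT => none; suff : forall c, ~ bad c by move/(_ l).
  by elim/(well_founded_ind wf) => c IH bc; apply: none; exists c.
have dlow d i : lt d c -> deep b K d i x.
  move=> dc; apply: contrapT => nd'; apply: (cmin d dc); exists i; split=> //.
  by left; case: cl => [|<-//]; apply: lt_trans.
have nj : exists j, `[< ~ deep b K c j x >] by exists j; apply/asboolP.
case: (ex_minnP nj) => -[|m] /asboolP ndm mmin.
  (* The first failure at c is not at j = 0: x lies in all levels below c, hence in p^(omega c) T,
     and beyond the cut the torsion condition is inherited from (b, K + 1). *)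
  case: ndm; have ux : ulm c x.
    by apply/ulmP => d dc i; apply/deep_ulm_pow/(dlow d i dc).
  case: (pselect (idx_le c 0%N b K)) => [lo|hi].
    by left; split=> //; apply/ulm_pow0.
  have bc : lt b c.
    by case: (lt_total b c) => [|[E|cb]] //; case: hi; [right|left].
  have xk : x *+ p ^ k = 0.
    have [[lo _]|[[_ [_ []]]//|[E]]] := dlow b K.+1 bc.
      by case: lo => [/ltxx//|[_]]; rewrite ltnn.
    by move: bl; rewrite E => /ltxx.
  right; case: cl => [cl|E]; [left|right].
    by do 2![split=> //]; split=> //; apply/ulm_pow0.
  by split=> //; exists x; rewrite -E expn0 mulr1n.
have dm : deep b K c m x.
  apply: contrapT => nd'; have /mmin : `[< ~ deep b K c m x >] by apply/asboolP.
  by rewrite ltnn.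
exists c, m; split=> // d i dx a; apply: ulm_pow_le.
case: (lt_total d c) => [dc|[E|cd]]; first by left.
  right; split=> //; rewrite leqNgt; apply/negP => mi; apply: ndm.
  by apply: deep_le dx; right.
by case: ndm; apply: deep_le dx; left.
Qed.

Hypothesis p_prime : prime p.
Hypothesis pT : p_group p T.
Hypothesis pA : p_group p A.

Lemma deep_hom_step K S f x : subgroup_of S -> finite_pred S ->
  deep_hom b K.+1 S f -> S (x *+ p) ->
  exists f', (forall s, S s -> f' s = f s) /\ deep_hom b K (adjoin S x) f'.
Proof.
move=> SP Sf fd Sx; have [fD fK] := deep_hom_le (leqnSn K) fd.
have [||||||f' [f'E f'D f'X]] := @extend_to_adjoin p T A p_prime pT pA (I * nat)%type
  (fun i => deep b K i.1 i.2) (fun i => ulm_pow i.1 i.2) _ _ _ _ S f x SP Sf fD _ _ Sx.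
- by move=> [c j] y z; apply: deepB.
- by move=> [c j] y z; apply: (subgroupB (ulm_pow_subgroup A c j)).
- move=> [c j] [d i] _ _ _ _ /=.
  by case: (idx_le_total c j d i) => le; [right|left]; split=> z;
    [apply: deep_le|apply: ulm_pow_le|apply: deep_le|apply: ulm_pow_le].
- by move=> z /(deep_best K) [c [j [dz H]]]; exists (c, j); split=> // -[d i] /H.
- by move=> [c j] s; apply: fK.
- move=> [c j] z /= /deep_mulp dz Sz; case: fd => _ /(_ _ _ _ Sz dz).
  by move=> /ulm_pow_divp [y [? ?]]; exists y.
by exists f'; split=> //; split=> // c j y; apply: (f'X (c, j)).
Qed.
End Deep.
End UlmFiltration.

(** * Deepening a homomorphism by multiples of p^k *)

Section Refresh.
Variables (p : nat) (I : Type) (lt : I -> I -> Prop).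
Hypothesis lt_wo : strict_well_order lt.
Variables (T A : zmodType).
Hypothesis p_prime : prime p.
Hypothesis pT : p_group p T.
Hypothesis pA : p_group p A.

Notation ulm := (ulm p lt).
Notation ulm_pow := (ulm_pow p lt).
Notation deep := (deep p lt).
Notation deep_hom := (deep_hom p lt).

Lemma deep_hom_sub k l b K (S S' : T -> Prop) (f : T -> A) :
  (forall s, S s -> S' s) -> deep_hom k l b K S' f -> deep_hom k l b K S f.
Proof.
move=> sub [fD fd]; split=> [x y /sub Sx /sub Sy|c j x /sub]; last exact: fd.
exact: fD.
Qed.

Lemma deep_hom_extend k l b (S' : T -> Prop) : lt b l -> finite_pred S' ->
  exists L, forall K S (f : T -> A), subgroup_of S -> finite_pred S ->
    deep_hom k l b (K + L) S f ->
    exists f', (forall s, S s -> f' s = f s) /\ deep_hom k l b K S' f'.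
Proof.
move=> bl [s S's].
have [L HL] := @extend_list p T (T -> A) p_prime pT (deep_hom k l b) _ (@eq_on_refl T A) (@eq_on_trans T A)
  (fun K S f x SP Sf => @deep_hom_step p I lt lt_wo T A k l b bl p_prime pT pA K S f x SP Sf) s.
exists L => K S f SP Sf /(HL _ _ _ SP Sf) [S1 [f1 [_ _ sS1 f1E f1d]]].
exists f1; split=> //; apply: deep_hom_sub f1d => x /S's; exact: sS1.
Qed.

(** Meant for correction terms, whose values must be deep whatever the heights of the arguments. *)
Definition ulm_hom c m (S : T -> Prop) (f : T -> A) :=
  additive_on S f /\ forall s, S s -> ulm_pow c m (f s).

Lemma ulm_hom_step c m S f x : subgroup_of S -> finite_pred S ->
  ulm_hom c m.+1 S f -> S (x *+ p) ->
  exists f', (forall s, S s -> f' s = f s) /\ ulm_hom c m (adjoin S x) f'.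
Proof.
move=> SP Sf [fD fc] Sx.
have [||||||f' [f'E f'D f'X]] := @extend_to_adjoin p T A p_prime pT pA unit
  (fun _ _ => True) (fun _ => ulm_pow c m) _ _ _ _ S f x SP Sf fD _ _ Sx.
- by [].
- by move=> _ y z; apply: (subgroupB (ulm_pow_subgroup p lt_wo A c m)).
- by left.
- by move=> z _; exists tt; split=> // -[].
- move=> _ s Ss _; apply: (ulm_pow_le lt_wo (i := m.+1) (d := c)) (fc s Ss).
  by right.
- by move=> _ z _ Sz; have [y [? ?]] := ulm_pow_divp (fc _ Sz); exists y.
by exists f'; split=> //; split=> // s ads; apply: (f'X tt).
Qed.

Lemma ulm_hom_extend c (S' : T -> Prop) : finite_pred S' ->
  exists L, forall m S (f : T -> A), subgroup_of S -> finite_pred S ->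
    ulm_hom c (m + L) S f ->
    exists f', (forall s, S s -> f' s = f s) /\ ulm_hom c m S' f'.
Proof.
move=> [s S's].
have [L HL] := @extend_list p T (T -> A) p_prime pT (ulm_hom c) _
  (@eq_on_refl T A) (@eq_on_trans T A) (@ulm_hom_step c) s.
exists L => m S f SP Sf /(HL _ _ _ SP Sf) [S1 [f1 [_ _ sS1 f1E [f1D f1c]]]].
by exists f1; split=> //; split=> [x y /S's/sS1 ? /S's/sS1 ?|x /S's/sS1]; auto.
Qed.

(** As S is finite, the finite heights above omega c are bounded on it; past the bound only elements
    of p^(omega (c + 1)) T remain. *)
Lemma ulm_pow_stable c (S : T -> Prop) : finite_pred S ->
  exists K, forall x, S x -> ulm_pow c K x -> forall j, ulm_pow c j x.
Proof.
move=> [s Ss]; suff [K HK] : exists K, forall x, x \in s -> ulm_pow c K x ->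
    forall j, ulm_pow c j x by exists K => x /Ss/HK.
elim: s {S Ss} => [|x s [K HK]]; first by exists 0%N.
case: (pselect (forall j, ulm_pow c j x)) => [xj|/existsNP [j xj]].
  by exists K => y; rewrite inE => /orP[/eqP->|/HK].
exists (maxn j K) => y; rewrite inE => /orP[/eqP-> xm|ys ym].
  by case: xj; apply: ulm_pow_le xm => //; right; rewrite leq_maxl.
by apply: HK => //; apply: ulm_pow_le ym => //; right; rewrite leq_maxr.
Qed.

Lemma finite_sub (S S' : T -> Prop) : (forall s, S s -> S' s) ->
  finite_pred S' -> finite_pred S.
Proof. by move=> sub [s S's]; exists s => x /sub/S's. Qed.

(* With Q the part of S in p^(omega (b + 1)) T, extend the restriction of y to
   Q[p^k] to a deep homomorphism r on Q; then r - y factors through p^k : Q -> S,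
   and the correction e is an extension to S of the resulting map on p^k Q. *)
Lemma deepen k l b b' (S : T -> Prop) : subgroup_of S -> finite_pred S ->
  lt b l -> lt b' l -> (lt b b' \/ b = b') ->
  exists K, forall K' (y : T -> A), deep_hom k l b K S y ->
  exists e : T -> A, [/\ additive_on S e, forall x, S x -> ulm b (e x)
    & deep_hom k l b' K' S (fun x => y x + e x *+ p ^ k)].
Proof.
move=> SP Sf bl b'l bb'.
have [K0 HK0] := ulm_pow_stable b Sf.
have [L2 HL2] := ulm_hom_extend b Sf.
have [L1 HL1] := deep_hom_extend k b'l Sf.
(* [L2] pays for extending the correction to S with values still in p^(omega b + K0) A. An element
   of S outside [Q] only has to be respected up to index (b, K0), and so tolerates such values. *)
pose K := (K0 + L2)%N; exists K => K' y yd; pose K2 := maxn K K'.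
have [yD yK] := yd.
pose Q x := S x /\ forall j, ulm_pow b j x.
have QP : subgroup_of Q.
  split; first by split; [case: SP|move=> j; apply: (subgroup0 (ulm_pow_subgroup p lt_wo T b j))].
  move=> u v [Su Hu] [Sv Hv]; split; first exact: (subgroupB SP).
  by move=> j; apply: (subgroupB (ulm_pow_subgroup p lt_wo T b j)).
pose Qk x := Q x /\ x *+ p ^ k = 0.
have QkP : subgroup_of Qk.
  split; first by split; [case: QP|rewrite mul0rn].
  move=> u v [Qu u0] [Qv v0]; split; first exact: (subgroupB QP).
  by rewrite mulrnBl u0 v0 subr0.
have QS x : Q x -> S x by case.
have QkS x : Qk x -> S x by case=> /QS.
have [|r [rE rd]] := HL1 K2 Qk y QkP (finite_sub QkS Sf).
  split=> [u v /QkS Su /QkS Sv|c j x [/QS Sx x0] dx]; first exact: yD.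
  by apply: yK => //; apply: deep_torsion x0 dx.
have [rD rK] := rd.
pose D x := r x - y x.
have DD u v : S u -> S v -> D (u - v) = D u - D v.
  move=> Su Sv; rewrite /D (additive_onB SP rD) // (additive_onB SP yD) //.
  by zmodule.
have Dk u v : Q u -> Q v -> u *+ p ^ k = v *+ p ^ k -> D u = D v.
  move=> Qu Qv E; apply: subr0_eq; rewrite -DD; [|exact: QS..].
  rewrite /D rE ?subrr //; split; first exact: (subgroupB QP).
  by rewrite mulrnBl E subrr.
have Dp x : Q x -> ulm_pow b K (D x).
  move=> [Sx Hx]; apply: (subgroupB (ulm_pow_subgroup p lt_wo A b K)).
    apply: rK => //; left; split=> //.
    by case: bb' => [|->]; [left|right; rewrite leq_maxl].
  by apply: yK => //; left; split=> //; right.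
pose pQ u := exists x, Q x /\ u = x *+ p ^ k.
have pQP : subgroup_of pQ.
  split; first by exists 0; rewrite mul0rn; split=> //; case: QP.
  move=> _ _ [u [Qu ->]] [v [Qv ->]]; exists (u - v); rewrite mulrnBl.
  by split=> //; apply: (subgroupB QP).
have pQf : finite_pred pQ.
  case: (Sf) => s Ss; exists [seq x *+ p ^ k | x <- s] => _ [x [/QS/Ss sx ->]].
  exact: map_f.
pose e0 u := if pselect (pQ u) is left h then D (projT1 (cid h)) else 0.
have e0E x : Q x -> e0 (x *+ p ^ k) = D x.
  move=> Qx; rewrite /e0; case: pselect => [h|[]]; last by exists x.
  by case: cid => z /= [Qz Ez]; apply: Dk.
have [|e [eE [eD eK]]] := HL2 K0 pQ e0 pQP pQf.
  split=> [_ _ [u [Qu ->]] [v [Qv ->]]|_ [u [Qu ->]]]; last by rewrite e0E //; apply: Dp.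
  rewrite -mulrnDl !e0E //; last exact: (subgroupD QP).
  by rewrite /D rD ?yD; [zmodule|exact: QS..].
exists e; split=> //; first by move=> x Sx; apply: (ulm_pow_ulm lt_wo (eK x Sx)).
have epk x : S x -> e x *+ p ^ k = e (x *+ p ^ k).
  by move=> Sx; rewrite (additive_onMn SP eD).
split=> [u v Su Sv|c j x Sx dx].
  by rewrite eD // yD // mulrnDl; zmodule.
case: (pselect (Q x)) => [Qx|nQ].
  have -> : y x + e x *+ p ^ k = r x.
    rewrite epk // eE; last by exists x.
    by rewrite e0E // /D; zmodule.
  have [_ rK'] : deep_hom k l b' K' S r.
    by apply: deep_hom_le rd => //; apply: leq_maxr.
  exact: rK'.
have nK0 : ~ ulm_pow b K0 x by move=> /HK0 H; apply: nQ; split=> //; apply: H.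
case: (pselect (x *+ p ^ k = 0)) => [x0|nx0].
  rewrite epk // x0 (additive_on0 SP eD) addr0; apply: yK => //.
  exact: deep_torsion x0 dx.
case: dx => [[_ ux]|[[_ [_ [_ x0]]]|[_ [z [_ [z0 xE]]]]]]; first 1 last.
- by [].
- by case: nx0; rewrite xE -mulrnA mulnC mulrnA z0 mul0rn.
have le0 : idx_le lt c j b K0.
  case: (idx_le_total lt_wo c j b K0) => // le.
  by case: nK0; apply: ulm_pow_le le ux.
have le1 : idx_le lt c j b K.
  apply: (idx_le_trans lt_wo le0); right; split=> //; exact: leq_addr.
apply: (subgroupD (ulm_pow_subgroup p lt_wo A c j)).
  by apply: yK => //; left.
apply: (subgroupMn (ulm_pow_subgroup p lt_wo A c j)).
by apply: ulm_pow_le le0 _ => //; apply: eK.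
Qed.
End Refresh.

(** * Cocycles and inverse limits *)

Section SubOf.
Variables (T A : countZmodType) (H : amb T A -> Prop) (HP : subgroup H).

(** The proof is an argument of the type so that the group structure can be declared on it, while
    the carrier remains [sigH H], on which the topologies of [cover_top] live. *)
Definition sub_of of subgroup H : Type := sigH H.
Local Notation G := (sub_of HP).

HB.instance Definition _ := gen_eqMixin G.
HB.instance Definition _ := gen_choiceMixin G.

Definition cval (c : G) : amb T A := proj1_sig c.

Lemma cval_inj : injective cval.
Proof.
move=> [c Hc] [c' Hc'] /= E; rewrite /cval /= in E; move: Hc Hc'; rewrite E => Hc Hc'.
by rewrite (Prop_irrelevance Hc Hc').
Qed.

Lemma amb_ext (c c' : amb T A) : (forall x y, c x y = c' x y) -> c = c'.
Proof. by move=> E; apply/funext => x; apply/funext => y. Qed.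

Lemma sub_of_addP (c c' : G) : H (fun x y => cval c x y + cval c' x y).
Proof.
have [H0 HB] := HP.
have -> : (fun x y => cval c x y + cval c' x y) =
    vsub (cval c) (vsub (@v0 T A) (cval c')).
  by apply: amb_ext => x y; rewrite /vsub /v0 sub0r opprK.
by apply: HB (proj2_sig c) (HB _ _ H0 (proj2_sig c')).
Qed.

Lemma sub_of_oppP (c : G) : H (fun x y => - cval c x y).
Proof.
have [H0 HB] := HP.
have -> : (fun x y => - cval c x y) = vsub (@v0 T A) (cval c).
  by apply: amb_ext => x y; rewrite /vsub /v0 sub0r.
by apply: HB H0 (proj2_sig c).
Qed.

Let addG (c c' : G) : G := exist _ _ (sub_of_addP c c').
Let oppG (c : G) : G := exist _ _ (sub_of_oppP c).
Let zeroG : G := exist _ _ (proj1 HP).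

Let addA : associative addG.
Proof. by move=> a b c; apply/cval_inj/amb_ext => x y; apply: addrA. Qed.
Let addC : commutative addG.
Proof. by move=> a b; apply/cval_inj/amb_ext => x y; apply: addrC. Qed.
Let add0 : left_id zeroG addG.
Proof. by move=> a; apply/cval_inj/amb_ext => x y; apply: add0r. Qed.
Let addN : left_inverse zeroG oppG addG.
Proof. by move=> a; apply/cval_inj/amb_ext => x y; apply: addNr. Qed.

HB.instance Definition _ := GRing.isZmodule.Build G addA addC add0 addN.

Lemma cvalB (c c' : G) : cval (c - c') = vsub (cval c) (cval c').
Proof. by []. Qed.

Lemma cval0 : cval 0 = @v0 T A. Proof. by []. Qed.

Lemma cover_top_group (tau : topology (sigH H)) :
  cover_top tau -> @group_topology G tau.
Proof.
move=> [_ [tg _]] U oU x y Uxy.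
have [U1 [U2 [o1 [o2 [U1x [U2y HU]]]]]] := tg U oU x y (x - y : G) erefl Uxy.
exists U1, U2; do 4![split=> //]; by move=> x' y' U1x' U2y'; apply: HU U1x' U2y'.
Qed.

Lemma cover_top_filtration (W : nat -> G -> Prop) : filtration W ->
  (forall x y, exists m, forall c, W m c -> cval c x y = 0) ->
  @cover_top T A H (filtration_topology W).
Proof.
move=> WP Wv; split; [exact: (@filtration_polish G W WP)|split].
  move=> U oU x y z E Uz.
  have zE : z = (x : G) - (y : G) :> G by apply: cval_inj; rewrite cvalB.
  have [|U1 [U2 [o1 [o2 [U1x [U2y HU]]]]]] :=
    filtration_group_topology WP oU (x := x) (y := y); first by rewrite -zE.
  exists U1, U2; do 4![split=> //]; move=> x' y' z' E' U1x' U2y'.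
  have -> : z' = (x' : G) - (y' : G) :> G by apply: cval_inj; rewrite cvalB.
  exact: HU.
move=> U oU c Uc; have [l Hl] := oU _ Uc.
have [m Hm] : exists m, forall (e : G), W m e -> forall q, q \in l -> cval e q.1 q.2 = 0.
  elim: l {Hl} => [|[x y] l [m Hm]]; first by exists 0%N.
  have [m' Hm'] := Wv x y; exists (maxn m m') => e We q.
  rewrite inE => /orP[/eqP->|ql] /=; [apply: Hm'|apply: Hm] => //;
    by apply: (filtration_le WP) We; rewrite ?leq_maxl ?leq_maxr.
exists m => e We; apply: Hl => q ql.
by have := Hm _ We q ql; rewrite cvalB => /subr0_eq.
Qed.

End SubOf.

Section Chain.
Variables (p : nat) (T A : countZmodType).
Hypothesis p_prime : prime p.
Hypothesis pT : p_group p T.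

(** Stage m + 1 adjoins the element with code m; a number that codes nothing adjoins 0, hence
    nothing. *)
Fixpoint fin_chain (n : nat) : T -> Prop :=
  if n is m.+1 then adjoin (fin_chain m) (odflt 0 (unpickle m)) else fun x => x = 0.
Local Notation Tn := fin_chain.

Lemma fin_chain_subgroup n : subgroup_of (Tn n).
Proof.
elim: n => [|n IH] /=; last exact: (adjoin_subgroup p_prime pT).
by split=> // x y -> ->; rewrite subrr.
Qed.

Lemma fin_chain_finite n : finite_pred (Tn n).
Proof.
elim: n => [|n IH] /=; last exact: (adjoin_finite p_prime pT).
by exists [:: 0] => x ->; rewrite mem_head.
Qed.

Lemma fin_chain_le m n x : (m <= n)%N -> Tn m x -> Tn n x.
Proof.
by move=> /subnK <-; elim: (n - m)%N => // k IH /IH; rewrite addSn; apply: adjoin_sub.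
Qed.

Lemma fin_chain_cover x : exists n, Tn n x.
Proof.
exists (pickle x).+1 => /=; rewrite pickleK /=.
exact/adjoin_gen/fin_chain_subgroup.
Qed.

Lemma fin_chain_cover_seq (s : seq T) : exists n, forall x, x \in s -> Tn n x.
Proof.
elim: s => [|x s [n Hn]]; first by exists 0%N.
have [m Hm] := fin_chain_cover x; exists (maxn m n) => y.
rewrite inE => /orP[/eqP->|/Hn].
  by apply: fin_chain_le Hm; rewrite leq_maxl.
by apply: fin_chain_le; rewrite leq_maxr.
Qed.

Lemma fin_chain_cover2 x y : exists n, Tn n x /\ Tn n y.
Proof.
have [n Hn] := fin_chain_cover_seq [:: x; y].
by exists n; split; apply: Hn; rewrite !inE eqxx ?orbT.
Qed.

Lemma fin_chain0 n : Tn n 0. Proof. exact: subgroup0 (fin_chain_subgroup n). Qed.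
Lemma fin_chainD n x y : Tn n x -> Tn n y -> Tn n (x + y).
Proof. exact: (subgroupD (fin_chain_subgroup n)). Qed.

Definition cobound (f : T -> A) : amb T A := fun x y => f y - f (x + y) + f x.

Definition cobound_on n (c : amb T A) (f : T -> A) : Prop :=
  forall x y, Tn n x -> Tn n y -> c x y = cobound f x y.

Lemma cobound_on_le m n c f : (m <= n)%N -> cobound_on n c f -> cobound_on m c f.
Proof. by move=> mn H x y xm ym; apply: H; apply: fin_chain_le mn _. Qed.

Lemma Zcoc_cobound f : f 0 = 0 -> Zcoc (cobound f).
Proof.
move=> f0; rewrite /cobound; split; [|split].
- by move=> x; rewrite addr0 f0; zmodule.
- by move=> x y; rewrite [y + x]addrC; zmodule.
- by move=> x y z; rewrite [x + (y + z)]addrA; zmodule.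
Qed.

Lemma Bcob_Zcoc (c : amb T A) : Bcob c -> Zcoc c.
Proof.
move=> [f [f0 cE]]; have -> : c = cobound f by apply: amb_ext.
exact: Zcoc_cobound.
Qed.

Lemma Zcoc_subgroup : subgroup (@Zcoc T A).
Proof.
split; first by split; [|split] => *; rewrite /v0 ?subr0 ?addr0.
move=> c c' [c0 [cC cc]] [c0' [cC' cc']]; rewrite /vsub; split; [|split].
- by move=> x; rewrite c0 c0' subrr.
- by move=> x y; rewrite cC cC'.
- move=> x y z; rewrite -[RHS](subrr 0) -[in X in _ = X - _](cc x y z).
  by rewrite -[in X in _ = _ - X](cc' x y z); zmodule.
Qed.

Lemma Bcob_subgroup : subgroup (@Bcob T A).
Proof.
split; first by exists (fun=> 0); split=> // *; rewrite /v0; zmodule.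
move=> c c' [f [f0 cE]] [f' [f'0 cE']]; exists (fun x => f x - f' x).
by rewrite f0 f'0 subrr; split=> // x y; rewrite /vsub cE cE'; zmodule.
Qed.

Lemma glue_functions (B : Type) (f : nat -> T -> B) :
  (forall n x, Tn n x -> f n.+1 x = f n x) ->
  exists g : T -> B, forall n x, Tn n x -> g x = f n x.
Proof.
move=> fS; exists (fun x => f (projT1 (cid (fin_chain_cover x))) x) => n x xn.
case: cid => m /= xm.
have le i j : (i <= j)%N -> Tn i x -> f j x = f i x.
  move=> /subnK <- xi; elim: (j - i)%N => // k <-; rewrite addSn fS //.
  by apply: fin_chain_le xi; rewrite leq_addl.
by case: (leqP m n) => [/le->|/ltnW/le ->].
Qed.

Lemma cobound_on_all n (c : amb T A) f g :
  cobound_on n c f -> additive_on (Tn n) (fun x => g x - f x) -> cobound_on n c g.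
Proof.
move=> cf gfD x y xn yn; rewrite cf // /cobound.
have := gfD _ _ xn yn => /= E.
have -> : g (x + y) = g x - f x + (g y - f y) + f (x + y) by rewrite -E; zmodule.
by zmodule.
Qed.

Lemma cobound_on_additive n (c : amb T A) f g :
  cobound_on n c f -> cobound_on n c g -> additive_on (Tn n) (fun x => g x - f x).
Proof.
move=> cf cg x y xn yn; have := cf x y xn yn; rewrite cg // /cobound => E.
have -> : g (x + y) = g y + g x - (g y - g (x + y) + g x) by zmodule.
by rewrite E; zmodule.
Qed.

(** Consecutive [f n] differ by a homomorphism on T_n, so their coboundaries agree there. This is
    how a cocycle is built from a sequence of homomorphisms. *)
Lemma glue_cocycle (f : nat -> T -> A) : (forall n, f n 0 = 0) ->
  (forall n, additive_on (Tn n) (fun x => f n.+1 x - f n x)) ->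
  exists c, Zcoc c /\ forall n, cobound_on n c (f n).
Proof.
move=> f0 fD.
pose c : amb T A := fun x y => cobound (f (projT1 (cid (fin_chain_cover2 x y)))) x y.
have le i j : (i <= j)%N -> cobound_on i (cobound (f j)) (f i).
  move=> /subnK <-; elim: (j - i)%N => [//|k IH] x y xi yi.
  rewrite addSn -(IH x y xi yi); apply/esym.
  apply: (@cobound_on_all (k + i)%N _ (f (k + i)%N)) => //.
    by apply: fin_chain_le xi; rewrite leq_addl.
  by apply: fin_chain_le yi; rewrite leq_addl.
have cP n : cobound_on n c (f n).
  move=> x y xn yn; rewrite /c; case: cid => m /= [xm ym].
  by case: (leqP m n) => [/le->|/ltnW/le ->].
exists c; split=> //; split; [|split].
- move=> x; have [n [xn _]] := fin_chain_cover2 x x.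
  by rewrite (cP n) //; [rewrite /cobound addr0 f0; zmodule|exact: fin_chain0].
- move=> x y; have [n [xn yn]] := fin_chain_cover2 x y.
  by rewrite !(cP n) // /cobound [y + x]addrC; zmodule.
- move=> x y z; have [n Hn] := fin_chain_cover_seq [:: x; y; z].
  have [xn yn zn] : [/\ Tn n x, Tn n y & Tn n z].
    by split; apply: Hn; rewrite !inE eqxx ?orbT.
  rewrite !(cP n) //; try exact: fin_chainD.
  by rewrite /cobound [x + (y + z)]addrA; zmodule.
Qed.

(** An inverse system of subgroups of Hom(T_n, A) under restriction. The maps are total functions of
    which only the values on T_n count, hence [tower_ext]. *)
Record tower (H : nat -> (T -> A) -> Prop) : Prop := Tower {
  tower_additive : forall n f, H n f -> additive_on (Tn n) f;
  tower0 : forall n, H n (fun=> 0);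
  towerB : forall n f g, H n f -> H n g -> H n (fun x => f x - g x);
  tower_ext : forall n f g, (forall x, Tn n x -> f x = g x) -> H n f -> H n g;
  tower_restrict : forall n f, H n.+1 f -> H n f }.

(* The class of c in PExt(T, A) = lim^1 Hom(T_n, A) is represented by the sequence
   of the phi (n + 1) - phi n. *)
Definition lim1_rep (H : nat -> (T -> A) -> Prop) (c : amb T A) (phi : nat -> T -> A) :=
  (forall n, cobound_on n c (phi n)) /\
  (forall n, H n (fun x => phi n.+1 x - phi n x)).

Definition lim1 H (c : amb T A) := Zcoc c /\ exists phi, lim1_rep H c phi.

Section Tower.
Variable H : nat -> (T -> A) -> Prop.
Hypothesis HP : tower H.

Lemma towerD n f g : H n f -> H n g -> H n (fun x => f x + g x).
Proof.
move=> Hf Hg; have := towerB HP Hf (towerB HP (tower0 HP n) Hg).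
by apply: (tower_ext HP) => x _; zmodule.
Qed.

Lemma tower_restrict_le m n f : (m <= n)%N -> H n f -> H m f.
Proof.
by move=> /subnK <-; elim: (n - m)%N => // k IH; rewrite addSn => /(tower_restrict HP)/IH.
Qed.

Lemma lim1_rep_le c phi m n : lim1_rep H c phi -> (m <= n)%N ->
  H m (fun x => phi n x - phi m x).
Proof.
move=> [_ Hphi] /subnK <-; elim: (n - m)%N => [|k IH].
  by apply: (tower_ext HP) (tower0 HP m) => x _; rewrite add0n subrr.
have := towerD IH (tower_restrict_le (leq_addl k m) (Hphi _)).
by apply: (tower_ext HP) => x _; rewrite addSn; zmodule.
Qed.

(** Replacing the terms before m by [phi m] allows smallness to be tested on T_m alone. *)
Lemma lim1_rep_flatten c phi m : lim1_rep H c phi ->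
  lim1_rep H c (fun n => phi (maxn n m)).
Proof.
move=> [cphi Hphi]; split=> [n|n].
  by apply: cobound_on_le (cphi _); rewrite leq_maxl.
rewrite /=; case: (leqP m n) => mn; first by rewrite (maxn_idPl (leqW mn)).
rewrite (maxn_idPr mn).
by apply: (tower_ext HP) (tower0 HP n) => x _; rewrite subrr.
Qed.

Lemma lim1_repB c c' phi phi' : lim1_rep H c phi -> lim1_rep H c' phi' ->
  lim1_rep H (vsub c c') (fun n x => phi n x - phi' n x).
Proof.
move=> [cphi Hphi] [cphi' Hphi']; split=> n.
  by move=> x y xn yn; rewrite /vsub (cphi n) // (cphi' n) // /cobound; zmodule.
apply: (tower_ext HP) (towerB HP (Hphi n) (Hphi' n)) => x _; zmodule.
Qed.

Lemma lim1_rep_cobound f : lim1_rep H (cobound f) (fun=> f).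
Proof.
split=> // n; by apply: (tower_ext HP) (tower0 HP n) => x _; rewrite subrr.
Qed.

Lemma lim1_subgroup : subgroup (lim1 H).
Proof.
split.
  split; first exact: (proj1 Zcoc_subgroup).
  exists (fun _ _ => 0); have := lim1_rep_cobound (fun=> 0).
  by have -> : cobound (fun=> 0) = @v0 T A by apply: amb_ext => x y; rewrite /cobound /v0; zmodule.
move=> c c' [Zc [phi r]] [Zc' [phi' r']]; split; first exact: (proj2 Zcoc_subgroup).
by exists (fun n x => phi n x - phi' n x); apply: lim1_repB.
Qed.

Lemma Bcob_lim1 c : Bcob c -> lim1 H c.
Proof.
move=> Bc; split; first exact: Bcob_Zcoc.
case: Bc => f [f0 cE]; have -> : c = cobound f by apply: amb_ext.
by exists (fun=> f); apply: lim1_rep_cobound.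
Qed.

End Tower.

Definition zero_tower n (f : T -> A) := forall x, Tn n x -> f x = 0.

Lemma zero_towerP : tower zero_tower.
Proof.
split=> [n f f0 x y xn yn|n x _|n f g f0 g0 x xn|n f g E f0 x xn|n f f0 x xn] //.
- by rewrite !f0 ?addr0 //; apply: fin_chainD.
- by rewrite f0 // g0 // subrr.
- by rewrite -E // f0.
- by apply: f0; apply: fin_chain_le xn.
Qed.

(** If all differences vanish, the [phi n] glue to one function with coboundary c. This presents B
    as a lim^1 group and so gives it a Polish topology of the same kind. *)
Lemma lim1_zero c : lim1 zero_tower c <-> Bcob c.
Proof.
split; last exact/Bcob_lim1/zero_towerP.
move=> [[c0 _] [phi [cphi Hphi]]].
have [g gE] := glue_functions (fun n x xn => subr0_eq (Hphi n x xn)).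
have cE x y : c x y = cobound g x y.
  have [n [xn yn]] := fin_chain_cover2 x y; rewrite (cphi n) // /cobound.
  by rewrite !(gE n) //; apply: fin_chainD.
exists g; split=> //; have := c0 0; rewrite cE /cobound addr0 => <-; zmodule.
Qed.

End Chain.

(** * The topology of an intersection of lim^1 groups *)

Section Lim1Filtration.
Variables (p : nat) (T A : countZmodType).
Hypothesis p_prime : prime p.
Hypothesis pT : p_group p T.
Local Notation Tn := (@fin_chain T).
Local Notation tower := (@tower T A).

Lemma fin_chain_list n : exists l : seq T, forall x, Tn n x <-> x \in l.
Proof.
have [l Hl] := fin_chain_finite p_prime pT n.
exists [seq x <- l | `[< Tn n x >]] => x; rewrite mem_filter; split.
  by move=> xn; rewrite Hl // andbT; apply/asboolP.
by move=> /andP[/asboolP].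
Qed.

Definition lim1_small (H : nat -> (T -> A) -> Prop) m (c : amb T A) :=
  exists phi, lim1_rep H c phi /\
    forall n x, (n <= m)%N -> Tn n x -> phi n x = 0.

Lemma lim1_small_at H m c phi : tower H -> lim1_rep H c phi ->
  (forall x, Tn m x -> phi m x = 0) -> lim1_small H m c.
Proof.
move=> HP /(lim1_rep_flatten HP m) r phi0; exists (fun n => phi (maxn n m)).
split=> // n x nm xn; rewrite (maxn_idPr nm); apply: phi0.
exact: fin_chain_le xn.
Qed.

Lemma lim1_small_sub (H H' : nat -> (T -> A) -> Prop) m c :
  (forall n f, H n f -> H' n f) -> lim1_small H m c -> lim1_small H' m c.
Proof.
by move=> HH [phi [[r1 r2] phi0]]; exists phi; split=> //; split=> // n; apply: HH.
Qed.

Lemma lim1_smallB H m c c' : tower H ->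
  lim1_small H m c -> lim1_small H m c' -> lim1_small H m (vsub c c').
Proof.
move=> HP [phi [r phi0]] [phi' [r' phi0']].
exists (fun n x => phi n x - phi' n x); split; first exact: lim1_repB.
by move=> n x nm xn; rewrite phi0 // phi0' // subrr.
Qed.

Lemma lim1_small_eq0 H m c x y : lim1_small H m c -> Tn m x -> Tn m y -> c x y = 0.
Proof.
move=> [phi [[r _] phi0]] xm ym; rewrite (r m) // /cobound !(phi0 m) //.
  by rewrite subr0 addr0.
exact: (fin_chainD p_prime pT).
Qed.

Lemma tower_sum (H : nat -> (T -> A) -> Prop) n (I : Type) (r : seq I) (F : I -> T -> A) :
  tower H -> (forall i, H n (F i)) -> H n (fun x => \sum_(i <- r) F i x).
Proof.
move=> HP HF; elim: r => [|i r IH].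
  by apply: (tower_ext HP) (tower0 HP n) => x _; rewrite big_nil.
by apply: (tower_ext HP) (towerD HP (HF i) IH) => x _; rewrite big_cons.
Qed.

Variable H : nat -> nat -> (T -> A) -> Prop.
Hypothesis HP : forall i, tower (H i).
Hypothesis H_decr : forall i n f, H i.+1 n f -> H i n f.

Lemma tower_decr i j n f : (i <= j)%N -> H j n f -> H i n f.
Proof. by move=> /subnK <-; elim: (j - i)%N => // k IH /H_decr /IH. Qed.

Variable U : amb T A -> Prop.
Hypothesis UE : forall c, U c <-> forall i, lim1 (H i) c.

Lemma lim1_inter_subgroup : subgroup U.
Proof.
split; first by apply/UE => i; apply: (proj1 (lim1_subgroup (HP i))).
move=> c c' /UE Hc /UE Hc'; apply/UE => i.
exact: (proj2 (lim1_subgroup (HP i))).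
Qed.

Local Notation G := (sub_of lim1_inter_subgroup).

(** Diagonal choice: level m tests both the tower [H m] and vanishing on T_m, so a single sequence
    of subgroups describes the topology of a countable intersection. *)
Definition lim1_filtration m (c : G) := lim1_small (H m) m (cval c).
Local Notation W := lim1_filtration.

Lemma lim1_filtration_countable : exists s : nat -> G, forall c m, exists n, W m (c - s n).
Proof.
pose l n := projT1 (cid (fin_chain_list n)).
have lP n x : Tn n x -> x \in l n by move/(projT2 (cid (fin_chain_list n))).
(* A code of c consists of a level m and the values of one [phi m] on T_m; two elements with a
   common code differ by an element of [W m]. *)
pose R (q : nat * seq A) (c : G) := exists phi, lim1_rep (H q.1) (cval c) phi /\
  map (phi q.1) (l q.1) = q.2.
pose pick (q : nat * seq A) : G :=
  if pselect (exists c, R q c) is left h then projT1 (cid h) else 0.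
have pickP q c : R q c -> R q (pick q).
  move=> Rc; rewrite /pick; case: pselect => [h|[]]; last by exists c.
  exact: (projT2 (cid h)).
exists (fun n => pick (odflt (0%N, [::]) (unpickle n))) => c m.
have [_ [phi r]] := (proj1 (UE _) (proj2_sig c)) m.
have /pickP [phi' [r' E]] : R (m, map (phi m) (l m)) c by exists phi.
exists (pickle (m, map (phi m) (l m))); rewrite pickleK /=.
rewrite /W cvalB; apply: lim1_small_at (lim1_repB (HP m) r r') _ => // x /lP xl.
by have /eq_in_map/(_ x xl) := E => ->; rewrite subrr.
Qed.

Lemma lim1_filtration_complete (c : nat -> G) :
  (forall m, W m (c m.+1 - c m)) -> exists d, forall m, W m (d - c m).
Proof.
move=> Wc; pose r m := projT1 (cid (Wc m)).
have [rR r0] : (forall m, lim1_rep (H m) (vsub (cval (c m.+1)) (cval (c m))) (r m)) /\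
    (forall m n x, (n <= m)%N -> Tn n x -> r m n x = 0).
  by split=> m; have [] := projT2 (cid (Wc m)).
have stable n i x y : (n <= i)%N -> Tn n x -> Tn n y ->
    cval (c i) x y = cval (c n) x y.
  move=> /subnK <- xn yn; elim: (i - n)%N => // k <-; rewrite addSn.
  apply: subr0_eq; have [+ _] := rR (k + n)%N => /(_ n x y xn yn).
  rewrite /vsub => ->; rewrite /cobound !r0 ?leq_addl //; first by rewrite subr0 addr0.
  exact: (fin_chainD p_prime pT).
pose d : amb T A := fun x y =>
  cval (c (projT1 (cid (fin_chain_cover2 p_prime pT x y)))) x y.
have dE n i x y : (n <= i)%N -> Tn n x -> Tn n y -> d x y = cval (c i) x y.
  move=> ni xn yn; rewrite /d; case: cid => m /= [xm ym].
  rewrite (stable _ _ _ _ ni) //; case: (leqP m n) => [mn|/ltnW nm].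
    by rewrite (stable m n).
  by rewrite (stable n m).
have Zd : Zcoc d.
  split; [|split].
  - move=> x; have [n [xn _]] := fin_chain_cover2 p_prime pT x x.
    have [[z _] _] := (proj1 (UE _) (proj2_sig (c n))) 0%N.
    have n0 := fin_chain0 p_prime pT n.
    by rewrite (dE n n) //; apply: z.
  - move=> x y; have [n [xn yn]] := fin_chain_cover2 p_prime pT x y.
    have [[_ [z _]] _] := (proj1 (UE _) (proj2_sig (c n))) 0%N.
    by rewrite !(dE n n) //; apply: z.
  - move=> x y z; have [n Hn] := fin_chain_cover_seq p_prime pT [:: x; y; z].
    have [xn yn zn] : [/\ Tn n x, Tn n y & Tn n z].
      by split; apply: Hn; rewrite !inE eqxx ?orbT.
    have [[_ [_ zc]] _] := (proj1 (UE _) (proj2_sig (c n))) 0%N.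
    by rewrite !(dE n n) //; try exact: (fin_chainD p_prime pT); exact: zc.
(* This represents d - c m as the sum of the remaining differences, which is finite because [r i]
   vanishes on T_n for i >= n. *)
pose s m n x := \sum_(m <= i < n) r i n x.
have sR m : lim1_rep (H m) (vsub d (cval (c m))) (s m).
  split=> n.
    move=> x y xn yn; rewrite /vsub.
    case: (leqP m n) => [mn|/ltnW nm]; last first.
      by rewrite (dE n m) // /cobound /s !big_geq // !subrr addr0.
    rewrite (dE n n) //.
    have -> : cval (c n) x y - cval (c m) x y =
        \sum_(m <= i < n) (cval (c i.+1) x y - cval (c i) x y).
      by rewrite telescope_sumr.
    rewrite /cobound /s -sumrB -big_split /=; apply: eq_bigr => i _.
    by have [+ _] := rR i => /(_ n x y xn yn).
  case: (leqP m n) => [mn|nm]; last first.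
    apply: (tower_ext (HP m)) (tower0 (HP m) n) => x _.
    by rewrite /s !big_geq ?subrr // ltnW.
  (* The sum gains the summand [r n n.+1], which on T_n is an increment of [r n] because [r n n]
     vanishes there. *)
  have Hn : H m n (r n n.+1).
    apply: (tower_decr mn); have [_ /(_ n)] := rR n.
    apply: (tower_ext (HP n)) => x xn; by rewrite [r n n x]r0 ?subr0.
  pose F i := if (m <= i)%N then (fun x => r i n.+1 x - r i n x) else fun=> 0.
  have HF i : H m n (F i).
    rewrite /F; case: ifP => [mi|_]; last exact: tower0.
    by apply: (tower_decr mi); have [_] := rR i.
  have := towerD (HP m) (tower_sum (index_iota m n) (HP m) HF) Hn.
  apply: (tower_ext (HP m)) => x xn.
  rewrite /s [in RHS]big_nat_recr //= [RHS]addrAC -sumrB; congr (_ + _).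
  by apply: eq_big_nat => i /andP[mi _]; rewrite /F mi.
have Ud : U d.
  apply/UE => m; have [_ [phi rphi]] := (proj1 (UE _) (proj2_sig (c m))) m.
  split=> //; exists (fun n x => s m n x - (0 - phi n x)).
  have r0' := lim1_rep_cobound (HP m) (fun=> 0).
  have := lim1_repB (HP m) (sR m) (lim1_repB (HP m) r0' rphi).
  have -> // : vsub (vsub d (cval (c m))) (vsub (cobound (fun=> 0)) (cval (c m))) = d.
  by apply: amb_ext => x y; rewrite /vsub /cobound; zmodule.
exists (exist _ _ Ud : G) => m; rewrite /W cvalB.
exists (s m); split; first exact: sR.
by move=> n x nm _; rewrite /s big_geq.
Qed.

Lemma lim1_filtrationP : filtration W.
Proof.
split.
- move=> m; split=> [|c c']; last by rewrite /W cvalB; apply: lim1_smallB.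
  rewrite /W cval0; exists (fun _ _ => 0); split=> //.
  have := lim1_rep_cobound (HP m) (fun=> 0).
  have -> // : cobound (fun=> 0) = @v0 T A.
  by apply: amb_ext => x y; rewrite /v0 /cobound subrr addr0.
- move=> m c [phi [[r1 r2] phi0]]; exists phi; split=> [|n x nm]; last exact/phi0/leqW.
  by split=> // n; apply: H_decr.
- move=> c Wc; apply/cval_inj/amb_ext => x y; rewrite cval0 /v0.
  have [n [xn yn]] := fin_chain_cover2 p_prime pT x y.
  exact: lim1_small_eq0 (Wc n) xn yn.
- exact: lim1_filtration_countable.
- exact: lim1_filtration_complete.
Qed.

Definition lim1_topology : topology (sigH U) := @filtration_topology G W.

Lemma lim1_cover_top : cover_top lim1_topology.
Proof.
apply: (@cover_top_filtration T A U lim1_inter_subgroup W lim1_filtrationP) => x y.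
have [n [xn yn]] := fin_chain_cover2 p_prime pT x y.
by exists n => c Wc; apply: lim1_small_eq0 Wc xn yn.
Qed.

(** Both topologies refine pointwise convergence, so limits agree and the closed graph theorem
    applies. Closed sets of an arbitrary admissible topology become closed in the explicit one. *)
Lemma cover_top_lim1 tau V : cover_top tau -> tau V -> lim1_topology V.
Proof.
move=> ct; have [tp [_ fine]] := ct.
apply: (@closed_graph G W tau lim1_filtrationP tp (@cover_top_group _ _ _ lim1_inter_subgroup _ ct)).
move=> s c d sc sd; apply/cval_inj/amb_ext => x y.
have [n [xn yn]] := fin_chain_cover2 p_prime pT x y.
have [N1 H1] := sc n.
have [|N2 H2] := sd _ (fine (fun e => e x y = cval d x y) _) erefl.
  by move=> e exy; exists [:: (x, y)] => e' /(_ (x, y) (mem_head _ _)) /= ->.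
have := H1 _ (leq_maxl N1 N2); have := H2 _ (leq_maxr N1 N2).
rewrite -/(cval _) => <- Wn; apply/esym/subr0_eq.
by have := lim1_small_eq0 Wn xn yn; rewrite cvalB.
Qed.

End Lim1Filtration.

(** * The Solecki derivative *)

Section SoleckiStep.
Variables (p : nat) (T A : countZmodType).
Hypothesis p_prime : prime p.
Hypothesis pT : p_group p T.
Local Notation Tn := (@fin_chain T).
Local Notation tower := (@tower T A).

Variable H : nat -> nat -> (T -> A) -> Prop.
Hypothesis HP : forall i, tower (H i).
Hypothesis H_decr : forall i n f, H i.+1 n f -> H i n f.
Variable U : amb T A -> Prop.
Hypothesis UE : forall c, U c <-> forall i, lim1 (H i) c.

Variable H' : nat -> (T -> A) -> Prop.
Hypothesis HP' : tower H'.
Hypothesis H'_sub : forall i n f, H' n f -> H i n f.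
(** [H' n] consists of the homomorphisms on T_n that extend to every later T_m at every level i;
    [H'_ext] and [H'_int] are the two directions. *)
Hypothesis H'_ext : forall i n m f, (n <= m)%N -> H' n f ->
  exists g, H i m g /\ forall x, Tn n x -> g x = f x.
Hypothesis H'_int : forall n f,
  (forall m, (n < m)%N -> exists g, H m m g /\ forall x, Tn n x -> g x = f x) -> H' n f.
(** Two representatives of one cocycle at level i differ on T_n by a homomorphism [g n]; this puts
    [g n] itself, and not only its increments, into [H i n]. *)
Hypothesis H_uniq : forall i (g : nat -> T -> A), (forall n, additive_on (Tn n) (g n)) ->
  (forall n, H i n (fun x => g n.+1 x - g n x)) -> forall n, H i n (g n).

Lemma lim1_derived_sub c : lim1 H' c -> U c.
Proof.
move=> [Zc [phi [r1 r2]]]; apply/UE => i; split=> //; exists phi.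
by split=> // n; apply: H'_sub.
Qed.

(* Solecki's description of s_1: after correction by a coboundary, c lies in the
   closure of the coboundaries that vanish on any given finite subgroup. *)
Lemma lim1_derivedP c : lim1 H' c <-> U c /\ forall n, exists psi, forall m,
  (n <= m)%N -> exists phi, lim1_rep (H m) c phi /\ forall x, Tn n x -> phi m x = psi x.
Proof.
split=> [Lc|[Uc Hc]].
  split=> [|n]; first exact: lim1_derived_sub.
  case: Lc => Zc [phi r]; exists (phi n) => m nm.
  have [g [Hg gE]] := H'_ext m nm (lim1_rep_le HP' r nm).
  have [r1 r2] := r.
  (* An extension g of phi m - phi n is removed from all terms up to m, so that the m-th term
     becomes phi n on T_n; later terms are kept. *)
  exists (fun i x => if (i <= m)%N then phi i x - g x else phi i x); split.
    split=> i.
      case: (leqP i m) => // im.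
      apply: (cobound_on_all (r1 i)) => x y xi yi /=.
      have := tower_additive (HP m) Hg (fin_chain_le im xi) (fin_chain_le im yi) => ->.
      by zmodule.
    case: (ltngtP i m) => [im|mi|->].
    - by apply: (tower_ext (HP m)) (H'_sub m (r2 i)) => x _; zmodule.
    - exact: H'_sub.
    - have := towerD (HP m) (H'_sub m (r2 m)) Hg.
      by apply: (tower_ext (HP m)) => x _; zmodule.
  by move=> x xn; rewrite leqnn gE //; zmodule.
have [psi psiP] := choice Hc.
have Zc : Zcoc c by have [] := (proj1 (UE c) Uc) 0%N.
split=> //; exists psi; split=> n.
  have [phi [[r1 _] E]] := psiP n n (leqnn n) => x y xn yn.
  by rewrite (r1 n) // /cobound !E //; apply: (fin_chainD p_prime pT).
apply: H'_int => m nm.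
have [phi [r E]] := psiP n m (ltnW nm); have [phi' [r' E']] := psiP n.+1 m nm.
exists (fun x => phi' m x - phi m x); split; last first.
  by move=> x xn; rewrite E // E' //; apply: fin_chain_le xn.
apply: (H_uniq (g := fun i x => phi' i x - phi i x)) => i.
  exact: (cobound_on_additive (proj1 r i) (proj1 r' i)).
have := towerB (HP m) (proj2 r' i) (proj2 r i).
by apply: (tower_ext (HP m)) => x _; zmodule.
Qed.

Let UP := lim1_inter_subgroup HP UE.
Let H'c (i : nat) := H'.
Let H'cP i : tower (H'c i). Proof. exact: HP'. Qed.
Let H'cE c : lim1 H' c <-> forall i, lim1 (H'c i) c.
Proof. by split=> [//|/(_ 0%N)]. Qed.
Let H'_decr i n f : H'c i.+1 n f -> H'c i n f. Proof. by []. Qed.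
Let Z' (i : nat) := @zero_tower T A.
Let Z'P i : tower (Z' i). Proof. exact: (@zero_towerP p T A p_prime pT). Qed.
Let Z'E c : Bcob c <-> forall i, lim1 (Z' i) c.
Proof. by rewrite -(lim1_zero p_prime pT); split=> [//|/(_ 0%N)]. Qed.
Let Z'_decr i n f : Z' i.+1 n f -> Z' i n f. Proof. by []. Qed.

Let topU := lim1_topology HP UE.
Let topK := lim1_topology H'cP H'cE.

Lemma lim1_derived_polishable : polishable_in U (lim1 H').
Proof.
split; first exact: lim1_subgroup.
split; first exact: lim1_derived_sub.
exists topU, topK; split; [|split].
- exact: (lim1_cover_top p_prime pT).
- exact: (lim1_cover_top p_prime pT).
move=> V oV k [h [hk Vh]]; have [m Hm] := oV h Vh.
exists m => k' Wk.
pose u : sub_of UP := exist _ _ (lim1_derived_sub (proj2_sig k')).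
exists u; split=> //; apply: Hm; rewrite /lim1_filtration.
have -> : cval (u - (h : sub_of UP)) = cval (k' - k).
  by rewrite !cvalB /cval /= hk.
by apply: lim1_small_sub Wk => n f; apply: H'_sub.
Qed.

(** In [lim1_derivedP] the function psi counts only through its values on the finite group T_n, so
    there are countably many choices. For each choice the condition is closed; the union over
    choices and then the intersection over n give the complexity. *)
Lemma lim1_derived_Pi03 : Pi03_in U (lim1 H').
Proof.
exists topU; split; first exact: (lim1_cover_top p_prime pT).
pose l n := projT1 (cid (fin_chain_list p_prime pT n)).
have lP n x : Tn n x <-> x \in l n by exact: (projT2 (cid (fin_chain_list p_prime pT n))).
pose E n s (h : sigH U) := exists v : seq A, unpickle s = Some v /\
  forall m, (n <= m)%N -> exists phi, lim1_rep (H m) (proj1_sig h) phi /\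
    map (phi m) (l n) = v.
exists (fun n h => ~ exists s, E n s h); split.
  move=> n; exists (E n); split=> [s|h]; last first.
    by split=> [/contrapT//|e ne]; exact: ne.
  move=> h nE; case Es: (unpickle s : option (seq A)) => [v|]; last first.
    by exists 0%N => h' _ [v' []]; rewrite Es.
  have [m mP] : exists m, ~ ((n <= m)%N -> exists phi, lim1_rep (H m) (proj1_sig h) phi /\
      map (phi m) (l n) = v).
    by apply/existsNP => Hm; apply: nE; exists v.
  exists m => h' Wh [v' [Es' Hv']]; apply: mP => nm.
  have [phi [r phiE]] := Hv' m nm.
  case: Wh => rho [rrho rho0]; exists (fun i x => phi i x - rho i x); split.
    have := lim1_repB (HP m) r rrho.
    have -> // : vsub (proj1_sig h') (cval ((h' : sub_of UP) - (h : sub_of UP))) = proj1_sig h.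
    by apply: amb_ext => x y; rewrite cvalB /vsub /cval; zmodule.
  move: Es' phiE; rewrite Es => -[->] <-; apply/eq_in_map => x /lP xn.
  by rewrite rho0 ?subr0 //; apply: fin_chain_le xn.
move=> h; split=> [nL|[n nE] /lim1_derivedP [_ /(_ n) [psi Hpsi]]].
  apply: contrapT => none; apply/nL/lim1_derivedP; split; first exact: (proj2_sig h).
  move=> n; have [s [v [Es Hv]]] : exists s, E n s h.
    by apply: contrapT => nE; apply: none; exists n.
  pose psi x := nth 0 v (index x (l n)).
  exists psi => m nm; have [phi [r phiE]] := Hv m nm; exists phi; split=> // x xn.
  have xl : x \in l n by apply/lP.
  by rewrite /psi -phiE (nth_map 0) ?index_mem // nth_index.
apply: nE; exists (pickle (map psi (l n))), (map psi (l n)); rewrite pickleK; split=> //.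
move=> m /Hpsi [phi [r phiE]]; exists phi; split=> //.
by apply/eq_in_map => x /lP; apply: phiE.
Qed.

(** Take f to be phi M minus an extension of phi M - phi l: it vanishes on T_l and approximates c at
    level m as soon as M >= m. So small elements of lim^1 H' are U-limits of coboundaries of
    functions vanishing on T_l. *)
Lemma derived_small_approx l m c : lim1_small H' l c ->
  exists f, [/\ f 0 = 0, forall x, Tn l x -> f x = 0
    & lim1_small (H m) m (vsub c (cobound f))].
Proof.
move=> [phi [r phi0]]; pose M := maxn l m.
have lM : (l <= M)%N by apply: leq_maxl.
have mM : (m <= M)%N by apply: leq_maxr.
have [g [Hg gE]] := H'_ext m lM (lim1_rep_le HP' r lM).
have [r1 r2] := r.
pose f x := if pselect (Tn M x) is left _ then phi M x - g x else 0.
have fM x : Tn M x -> f x = phi M x - g x by rewrite /f; case: pselect.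
have fl x : Tn l x -> f x = 0.
  move=> xl; rewrite fM ?gE ?(phi0 l) //; first by zmodule.
  exact: fin_chain_le xl.
exists f; split=> //; first exact/fl/(fin_chain0 p_prime pT).
have gD := tower_additive (HP m) Hg.
exists (fun n x => if (n <= M)%N then 0 else phi n x - f x); split; last first.
  by move=> n x nm _; rewrite (leq_trans nm mM).
split=> n.
  case: (leqP n M) => nM x y xn yn; last first.
    by rewrite /vsub (r1 n) // /cobound; zmodule.
  have xM := fin_chain_le nM xn; have yM := fin_chain_le nM yn.
  have cf : cobound_on M c f.
    apply: (cobound_on_all (r1 M)) => u v uM vM.
    by rewrite !fM ?gD //; [zmodule|apply: (fin_chainD p_prime pT)].
  by rewrite /vsub cf // subrr /cobound /= subr0 addr0.
case: (ltngtP n M) => [nM|Mn|->].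
- by apply: (tower_ext (HP m)) (tower0 (HP m) n) => x _; rewrite subrr.
- by apply: (tower_ext (HP m)) (H'_sub m (r2 n)) => x _; zmodule.
- have := towerD (HP m) (H'_sub m (r2 M)) Hg.
  by apply: (tower_ext (HP m)) => x xM; rewrite fM //; zmodule.
Qed.

(** Write K as the intersection over n of the unions over j of closed sets [F' n j]. For each n,
    Baire in B, with the topology of the zero tower, makes one [F' n j] dense near some b1; by
    [derived_small_approx] it contains a whole neighbourhood of b1 in lim^1 H'. As B is dense there,
    K contains a comeager set. *)
Lemma Pi03_contains_derived (K : amb T A -> Prop) : subgroup K ->
  (forall c, Bcob c -> K c) -> Pi03_in U K -> forall c, lim1 H' c -> K c.
Proof.
move=> KP BK [tau [ct [F [F3 FK]]]] c Lc.
have [F' F'P] := choice F3.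
have Fcl n j : closed_in tau (F' n j) by have [] := F'P n.
have FE n h : ~ F n h <-> exists j, F' n j h by have [_] := F'P n.
have KE (h : sigH U) : K (proj1_sig h) <-> forall n, exists j, F' n j h.
  split=> [Kh n|Hh]; first by apply/FE => Fh; apply/FK: Kh; exists n.
  by apply: contrapT => /FK [n Fn]; case/FE: (Hh n).
pose GK := sub_of (lim1_inter_subgroup H'cP H'cE).
pose GB := sub_of (lim1_inter_subgroup Z'P Z'E).
pose incK (k : GK) : sub_of UP := exist _ _ (lim1_derived_sub (proj2_sig k)).
pose incB (b : GB) : sub_of UP := exist _ _ (lim1_derived_sub (Bcob_lim1 HP' (proj2_sig b))).
pose incBK (b : GB) : GK := exist _ _ (Bcob_lim1 HP' (proj2_sig b)).
have WK := lim1_filtrationP p_prime pT H'cP H'_decr H'cE.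
have WB := lim1_filtrationP p_prime pT Z'P Z'_decr Z'E.
have zsub n f : Z' 0 n f -> H' n f.
  by move=> f0; apply: (tower_ext HP') (tower0 HP' n) => x /f0.
pose W' := @lim1_filtration _ _ _ H'cP _ H'cE.
(* [D n] is the interior, in lim^1 H', of the union over j of the [F' n j]. *)
pose D n (k : GK) := exists m, forall k', W' m (k' - k) -> exists j, F' n j (incK k').
pose cG : GK := exist _ _ Lc.
suff KG (k : GK) : K (proj1_sig k) by apply: (KG cG).
move: k.
apply: (@comeager_subgroup GK W' WK (fun k => K (proj1_sig k)) D).
- by move=> x y Kx Ky; apply: (proj2 KP).
- move=> n k [m Hm]; exists m => y yk; exists m => z zy; apply: Hm.
  have -> : z - k = (z - y) - (k - y) by zmodule.
  case: WK => /(_ m) [W0 WB'] _ _ _ _; apply: (WB') => //.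
  have -> : k - y = 0 - (y - k) by zmodule.
  by apply: WB'.
- move=> n k m.
  have [_ [phi r]] : lim1 H' (cval k) by exact: (proj2_sig k).
  have r1 := proj1 r.
  have [Zk _] : lim1 H' (cval k) by exact: (proj2_sig k).
  have phi00 : phi m 0 = 0.
    have n0 := fin_chain0 p_prime pT m.
    have := r1 m 0 0 n0 n0; rewrite (proj1 Zk) /cobound addr0 => ->; zmodule.
  have Bb0 : Bcob (cobound (phi m)) by exists (phi m).
  pose b0 : GB := exist _ _ Bb0.
  have cover b : exists j, F' n j (incB b).
    by move: n; apply/(KE (incB b)); apply: BK (proj2_sig b).
  have [j [b1 [l [b10 Hl]]]] := baire_filtration_cover WB b0 m cover.
  exists (incBK b1); split.
    have -> : incBK b1 - k = (incBK b1 - incBK b0) - (k - incBK b0) by zmodule.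
    rewrite /W' /lim1_filtration cvalB; apply: (lim1_smallB HP').
      by rewrite cvalB; move: b10; rewrite /lim1_filtration cvalB; apply: lim1_small_sub.
    rewrite cvalB; apply: (lim1_small_at HP' (lim1_repB HP' r (lim1_rep_cobound HP' (phi m)))).
    by move=> x _; rewrite subrr.
  exists l => k' Wk'; exists j; apply: contrapT => nF.
  (* If k' avoided the closed set, so would a U-neighbourhood of k'. It contains elements b1 + e of
     B with e the coboundary of a function vanishing on T_l, and near these [F' n j] is dense in
     B. *)
  have oF : topU (fun h => ~ F' n j h).
    by apply: (cover_top_lim1 p_prime pT H_decr ct); apply: Fcl.
  have [m2 Hm2] := oF (incK k') nF.
  have [f [f0 fl fsmall]] := derived_small_approx m2 Wk'.
  have Bf : Bcob (cobound f) by exists f.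
  pose e : GB := exist _ _ Bf.
  pose z : GB := b1 + e.
  have [|w [Ww Fw]] := Hl z (maxn m2 l).
    have -> : z - b1 = e by rewrite /z addrAC subrr add0r.
    apply: lim1_small_at (lim1_rep_cobound (Z'P l) f) fl; exact: Z'P.
  case: (Hm2 (incB w)) => //.
  rewrite /lim1_filtration.
  have -> : cval (incB w - incK k') =
      vsub (cval (w - z)) (vsub (cval (k' - incBK b1)) (cobound f)).
    by apply: amb_ext => x y; rewrite !cvalB /vsub /cval /=; zmodule.
  apply: (lim1_smallB (HP m2)) => //.
  have Ww2 := filtration_le WB (leq_maxl m2 l) Ww.
  by apply: lim1_small_sub Ww2 => i g /zsub; apply: H'_sub.
- move=> k Dk; apply/(KE (incK k)) => n.
  have [m Hm] := Dk n; apply: Hm; rewrite subrr.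
  by case: WK => /(_ m) [].
Qed.

Theorem solecki1_lim1 c : solecki1 (@Bcob T A) U c <-> lim1 H' c.
Proof.
split=> [|Lc K BK [KP _] /(Pi03_contains_derived KP BK)]; last exact.
by apply; [exact: Bcob_lim1|exact: lim1_derived_polishable|exact: lim1_derived_Pi03].
Qed.

End SoleckiStep.

(** * Homomorphisms respecting heights *)

Section HomTower.
Variables (p : nat) (T A : countZmodType).
Hypothesis p_prime : prime p.
Hypothesis pT : p_group p T.
Hypothesis pA : p_group p A.
Variables (I : Type) (lt : I -> I -> Prop).
Hypothesis lt_wo : strict_well_order lt.

Local Notation Tn := (@fin_chain T).
Local Notation ulm := (ulm p lt).
Local Notation ulm_pow := (ulm_pow p lt).
Local Notation deep_hom := (deep_hom p lt).

Let lt_trans b a c : lt a b -> lt b c -> lt a c.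
Proof. by case: lt_wo => _ [+ _]; apply. Qed.
Let TnP := fin_chain_subgroup p_prime pT.
Let TnF := fin_chain_finite p_prime pT.
Let upP (G : zmodType) := ulm_pow_subgroup p lt_wo G.

Definition wle a b := lt a b \/ a = b.

Definition hom_tower l n (f : T -> A) := additive_on (Tn n) f /\
  forall d, lt d l -> forall j x, Tn n x -> ulm_pow d j x -> ulm_pow d j (f x).

Lemma hom_towerP l : tower (hom_tower l).
Proof.
split.
- by move=> n f [].
- move=> n; split=> [x y _ _|d _ j x _ _]; first by rewrite addr0.
  exact: (subgroup0 (upP A d j)).
- move=> n f g [fD fu] [gD gu]; split=> [x y xn yn|d dl j x xn ux].
    by rewrite fD // gD //; zmodule.
  by apply: (subgroupB (upP A d j)); [apply: fu|apply: gu].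
- move=> n f g E [fD fu]; split=> [x y xn yn|d dl j x xn ux].
    by rewrite -!E ?fD //; apply: (fin_chainD p_prime pT).
  by rewrite -E //; apply: fu.
- move=> n f [fD fu]; split=> [x y xn yn|d dl j x xn].
    by apply: fD; apply: fin_chain_le (leqnSn n) _.
  by apply: fu => //; apply: fin_chain_le (leqnSn n) _.
Qed.

Lemma hom_tower_le d l n f : wle d l -> hom_tower l n f -> hom_tower d n f.
Proof.
move=> [dl|->] // [fD fu]; split=> // e ed; apply: fu.
exact: lt_trans dl.
Qed.

Lemma hom_tower_ulm c n f z : hom_tower c n f -> Tn n z -> ulm c z -> ulm c (f z).
Proof. by move=> [_ fu] zn /ulmP uz; apply/ulmP => d dc j; apply: fu => //; apply: uz. Qed.

(** If x = p^j z with z in a later T_m, then g n x = p^j g m z - (g m x - g n x). The difference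
    respects heights by assumption, and g m z is deep by well-founded induction on the level. *)
Lemma hom_tower_uniq l (g : nat -> T -> A) :
  (forall n, additive_on (Tn n) (g n)) ->
  (forall n, hom_tower l n (fun x => g n.+1 x - g n x)) -> forall n, hom_tower l n (g n).
Proof.
move=> gD gS.
have gle m n : (m <= n)%N -> hom_tower l m (fun x => g n x - g m x).
  have r : lim1_rep (hom_tower l) (@v0 T A) g.
    split=> // i x y xi yi; rewrite /v0 /cobound gD //; zmodule.
  by move=> mn; apply: (lim1_rep_le (hom_towerP l) r).
have [_ [_ [_ wf]]] := lt_wo.
have uc c : lt c l -> forall n x, Tn n x -> ulm c x -> ulm c (g n x).
  elim/(well_founded_ind wf): c => c IH cl n x xn /ulmP ux; apply/ulmP => d dc j.
  have dl : lt d l by apply: lt_trans dc cl.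
  have [z [uz xE]] := ux d dc j.
  have [m0 zm0] := fin_chain_cover p_prime pT z; pose m := maxn n m0.
  have zm : Tn m z by apply: fin_chain_le zm0; rewrite leq_maxr.
  have -> : g n x = g m z *+ p ^ j - (g m x - g n x).
    by rewrite xE (additive_onMn (TnP m) (gD m)) //; zmodule.
  apply: (subgroupB (upP A d j)); first by exists (g m z); split=> //; apply: IH.
  have [_ gu] := gle n m (leq_maxl n m0); apply: gu => //; exact: ux.
move=> n; split=> // d dl j x xn [z [uz xE]].
have [m0 zm0] := fin_chain_cover p_prime pT z; pose m := maxn n m0.
have zm : Tn m z by apply: fin_chain_le zm0; rewrite leq_maxr.
have -> : g n x = g m z *+ p ^ j - (g m x - g n x).
  by rewrite xE (additive_onMn (TnP m) (gD m)) //; zmodule.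
apply: (subgroupB (upP A d j)); first by exists (g m z); split=> //; apply: uc.
by have [_ gu] := gle n m (leq_maxl n m0); apply: gu => //; exists z.
Qed.

(** The condition of [deep_hom] at the top index l. Membership in [hom_tower l] on T_n does not give
    it, as z may lie outside T_n; it holds once f comes from a T_i containing the finitely many
    witnesses needed. *)
Definition top_good k l n (f : T -> A) := forall j x, Tn n x ->
  (exists z, ulm l z /\ z *+ p ^ k = 0 /\ x = z *+ p ^ j) -> ulm_pow l j (f x).

Lemma hom_tower_deep k l b K n f : lt b l -> hom_tower l n f -> top_good k l n f ->
  deep_hom k l b K (Tn n) f.
Proof.
move=> bl [fD fu] fg; split=> // c j x xn [[lo ux]|[[_ [cl [ux _]]]|[-> top]]].
- by apply: fu => //; case: lo => [cb|[->]//]; apply: lt_trans bl.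
- exact: fu.
- exact: fg.
Qed.

Lemma top_good0 l n f : additive_on (Tn n) f -> top_good 0 l n f.
Proof.
move=> fD j x xn [z [_ [z0 ->]]]; move: z0; rewrite expn0 mulr1n => ->.
rewrite mul0rn (additive_on0 (TnP n) fD); exact: (subgroup0 (upP A l j)).
Qed.

(** Case k = 0 of [deep], where only 0 remains beyond the cut. As d < l, any finite reserve of steps
    at index d is available and can be spent on the extension. *)
Lemma hom_tower_ext l d n m f : lt d l -> (n <= m)%N -> hom_tower l n f ->
  exists g, hom_tower d m g /\ forall x, Tn n x -> g x = f x.
Proof.
move=> dl nm Hf.
have [L HL] := deep_hom_extend lt_wo p_prime pT pA 0 dl (TnF m).
have [g [gE [gD gd]]] := HL 0%N (Tn n) f (TnP n) (TnF n)
  (hom_tower_deep (0 + L) dl Hf (top_good0 (proj1 Hf))).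
exists g; split=> //; split=> // e ed j x xm ux; apply: gd => //.
by left; split=> //; left.
Qed.

Lemma finite_eventually (X : eqType) (s : seq X) (P : X -> nat -> Prop) :
  (forall x, x \in s -> exists m, forall i, (m <= i)%N -> P x i) ->
  exists m, forall i x, (m <= i)%N -> x \in s -> P x i.
Proof.
elim: s => [|x s IH] Hs; first by exists 0%N.
have [m1 H1] := Hs x (mem_head _ _).
have [|m2 H2] := IH; first by move=> y ys; apply: Hs; rewrite inE ys orbT.
exists (maxn m1 m2) => i y; rewrite geq_max => /andP[i1 i2].
by rewrite inE => /orP[/eqP->|]; [apply: H1|apply: H2].
Qed.

Lemma top_good_eventually k l n : exists m, forall i f, (m <= i)%N ->
  hom_tower l i f -> top_good k l n f.
Proof.
have [s Hs] := TnF n.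
have [|m Hm] := @finite_eventually (T * nat)%type [seq (x, j) | x <- s, j <- iota 0 k]
    (fun q i => forall f, hom_tower l i f ->
      (exists z, ulm l z /\ z *+ p ^ k = 0 /\ q.1 = z *+ p ^ q.2) -> ulm_pow l q.2 (f q.1)).
  move=> [x j] _ /=.
  case: (pselect (exists z, ulm l z /\ z *+ p ^ k = 0 /\ x = z *+ p ^ j)); last first.
    by move=> none; exists 0%N.
  move=> [z [uz [z0 xE]]]; have [m zm] := fin_chain_cover p_prime pT z.
  exists m => i mi f Hf _; have zi := fin_chain_le mi zm.
  exists (f z); split; first exact: hom_tower_ulm Hf zi uz.
  by rewrite xE (additive_onMn (TnP i) (proj1 Hf)).
exists m => i f mi Hf j x xn [z [uz [z0 xE]]].
case: (ltnP j k) => jk.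
  apply: (Hm i (x, j) mi _ f Hf); last by exists z.
  by apply: allpairs_f; rewrite ?mem_iota //; apply: Hs.
have -> : x = 0.
  by rewrite xE -(subnKC jk) expnD mulrnA z0 mul0rn.
rewrite (additive_on0 (TnP i) (proj1 Hf)); exact: (subgroup0 (upP A l j)).
Qed.

Section Below.
Variables (l : I) (b : nat -> I).
Hypothesis bl : forall i, lt (b i) l.
Hypothesis b_le : forall i, wle (b i) (b i.+1).
Hypothesis b_cofinal : forall d, lt d l -> exists i, wle d (b i).

Let wle_trans x y z : wle x y -> wle y z -> wle x z.
Proof.
by move=> [xy|->] // [yz|<-]; left => //; apply: lt_trans yz.
Qed.

Let b_mono i j : (i <= j)%N -> wle (b i) (b j).
Proof.
move=> /subnK <-; elim: (j - i)%N => [|k IH]; first by right.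
by rewrite addSn; apply: wle_trans IH _.
Qed.

(** A witness z of x = p^j z lies in some T_m, and an extension g to T_m of high enough level gives
    f x = p^j g z. *)
Lemma hom_tower_int n f :
  (forall m, (n < m)%N -> exists g, hom_tower (b m) m g /\ forall x, Tn n x -> g x = f x) ->
  hom_tower l n f.
Proof.
move=> Hf; split.
  have [g [[gD _] gE]] := Hf n.+1 (ltnSn n) => x y xn yn.
  rewrite -!gE ?gD //; first [exact: (fin_chainD p_prime pT)
    | by apply: fin_chain_le (leqnSn n) _].
move=> c cl j x xn [z [uz xE]].
have [i ci] := b_cofinal cl; have [m0 zm0] := fin_chain_cover p_prime pT z.
pose m := maxn n.+1 (maxn i m0).
have im : (i <= m)%N by rewrite /m !leq_max leqnn orbT.
have zm : Tn m z by apply: fin_chain_le zm0; rewrite /m !leq_max leqnn !orbT.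
have [|g [Hg gE]] := Hf m; first by rewrite /m leq_maxl.
exists (g z); split.
  by apply: hom_tower_ulm zm uz; apply: hom_tower_le Hg; apply: wle_trans (b_mono im).
by rewrite -gE // xE (additive_onMn (TnP m) (proj1 Hg)).
Qed.

Variable U : amb T A -> Prop.
Hypothesis UE : forall c, U c <-> forall i, lim1 (hom_tower (b i)) c.

Let H_decr i n f : hom_tower (b i.+1) n f -> hom_tower (b i) n f.
Proof. exact: hom_tower_le. Qed.

Lemma solecki1_hom_tower c : solecki1 (@Bcob T A) U c <-> lim1 (hom_tower l) c.
Proof.
apply: (@solecki1_lim1 p T A p_prime pT (fun i => hom_tower (b i))) => //.
- by move=> i; apply: hom_towerP.
- exact: hom_towerP.
- by move=> i n f; apply: hom_tower_le; left.
- by move=> i n m f; apply: hom_tower_ext.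
- by move=> n f Hf; apply: hom_tower_int.
- by move=> i g gD gS n; apply: hom_tower_uniq.
Qed.

End Below.
End HomTower.

(** * The Ulm derivative *)

Section Divide.
Variables (p : nat) (T A : countZmodType).
Hypothesis p_prime : prime p.
Hypothesis pT : p_group p T.
Hypothesis pA : p_group p A.
Variables (I : Type) (lt : I -> I -> Prop).
Hypothesis lt_wo : strict_well_order lt.

Local Notation Tn := (@fin_chain T).
Local Notation ulm := (ulm p lt).
Local Notation ulm_pow := (ulm_pow p lt).
Local Notation deep_hom := (deep_hom p lt).
Local Notation hom_tower := (hom_tower p lt).

Let TnP := fin_chain_subgroup p_prime pT.
Let TnF := fin_chain_finite p_prime pT.
Let upP (G : zmodType) := ulm_pow_subgroup p lt_wo G.

Lemma deep_homB k l b K n (f g : T -> A) : deep_hom k l b K (Tn n) f ->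
  deep_hom k l b K (Tn n) g -> deep_hom k l b K (Tn n) (fun x => f x - g x).
Proof.
move=> [fD fu] [gD gu]; split=> [x y xn yn|c j x xn dx].
  by rewrite fD // gD //; zmodule.
by apply: (subgroupB (upP A c j)); [apply: fu|apply: gu].
Qed.

Lemma fin_chain_exponent n : exists N, forall x, Tn n x -> x *+ p ^ N = 0.
Proof.
have [s Hs] := TnF n.
have [|N HN] := @finite_eventually T s (fun x i => x *+ p ^ i = 0).
  move=> x _; have [m xm] := pT x; exists m => i mi.
  by rewrite -(subnKC mi) expnD mulrnA xm mul0rn.
by exists N => x /Hs; apply: HN.
Qed.

Lemma Zcoc_muln n (c : amb T A) : Zcoc c -> Zcoc (vmuln n c).
Proof.
move=> [c0 [cC cc]]; rewrite /vmuln; split; [|split].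
- by move=> x; rewrite c0 mul0rn.
- by move=> x y; rewrite cC.
- by move=> x y z; rewrite -mulrnBl -mulrnDl -mulrnBl cc mul0rn.
Qed.

Lemma cobound_on_muln n k (c : amb T A) f : cobound_on n c f ->
  cobound_on n (vmuln k c) (fun x => f x *+ k).
Proof.
by move=> cf x y xn yn; rewrite /vmuln cf // /cobound mulrnDl mulrnBl.
Qed.

Section Below.
Variables (l : I) (b : nat -> I).
Hypothesis bl : forall i, lt (b i) l.
Hypothesis b_le : forall i, wle lt (b i) (b i.+1).
Hypothesis b_cofinal : forall d, lt d l -> exists i, wle lt d (b i).

Let b_mono i j : (i <= j)%N -> wle lt (b i) (b j).
Proof.
move=> /subnK <-; elim: (j - i)%N => [|k IH]; first by right.
rewrite addSn; have [_ [tr _]] := lt_wo.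
case: IH => [ij|->] //; case: (b_le (k + i)) => [jk|<-]; left => //.
exact: tr ij jk.
Qed.

Lemma lim1_hom_tower_divisible (c : amb T A) n0 : (0 < n0)%N -> lim1 (hom_tower l) c ->
  exists d, (forall i, lim1 (hom_tower (b i)) d) /\ Bcob (vsub c (vmuln n0 d)).
Proof.
move=> n0_gt0 [Zc [phi r]].
have [m0 cop n0E] := pfactor_coprime p_prime n0_gt0; set k := logn p n0 in n0E.
have [mu0 mu0P] := choice (top_good_eventually A p_prime pT lt_wo k l).
(* Along this subsequence each difference [h n] is the restriction of a homomorphism on T_(mu n),
   large enough for [top_good k] on T_n. *)
pose mu n := (n + \sum_(i < n.+1) mu0 i)%N.
have mun n : (n <= mu n)%N by apply: leq_addr.
have mu_mono n : (mu n <= mu n.+1)%N.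
  by rewrite /mu [(\sum_(i < n.+2) _)%N]big_ord_recr /= addnA; apply/leq_trans/leq_addr; rewrite leq_add2r.
have mu0n n : (mu0 n <= mu n)%N.
  by rewrite /mu big_ord_recr /= addnA leq_addl.
pose phi' n := phi (mu n).
pose h n x := phi' n.+1 x - phi' n x.
have h_mu n : hom_tower l (mu n) (h n).
  exact: (lim1_rep_le (hom_towerP A p_prime pT lt_wo l) r).
have h_deep n K : deep_hom k l (b n) K (Tn n) (h n).
  apply: hom_tower_deep => //; last exact: mu0P (h_mu n).
  exact: (tower_restrict_le (hom_towerP A p_prime pT lt_wo l) (mun n)).
have bS n : lt (b n) (b n.+1) \/ b n = b n.+1 by exact: b_le.
pose dp n := deepen lt_wo p_prime pT pA k (TnP n) (TnF n) (bl n) (bl n.+1) (bS n).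
pose Kn n := projT1 (cid (dp n)).
have KnP n := projT2 (cid (dp n)); rewrite -/(Kn _) in KnP.
pose P n (s : T -> A) := deep_hom k l (b n) (Kn n) (Tn n) s.
(* On T_n this reads h n = s n - s (n+1) + p^k e n: up to the corrections [s], the differences
   become multiples of p^k. *)
pose Q n (s s' : T -> A) := exists e : T -> A, [/\ additive_on (Tn n) e,
  forall x, Tn n x -> ulm (b n) (e x)
  & forall x, Tn n x -> s' x = s x - h n x + e x *+ p ^ k].
have [||s [_ sP]] := @dependent_choice_from _ P Q (fun=> 0).
- split=> [x y _ _|c' j x _ _]; first by rewrite addr0.
  exact: (subgroup0 (upP A c' j)).
- move=> n s Ps.
  have [L HL] := deep_hom_extend lt_wo p_prime pT pA k (bl n.+1) (TnF n.+1).
  (* L units are spent on the extension to T_(n+1), and [Kn n.+1] must be left for the next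
     deepening. *)
  have [e [eD eu ed]] := KnP n (Kn n.+1 + L)%N _ (deep_homB Ps (h_deep n _)).
  have [s' [s'E s'd]] := HL (Kn n.+1) (Tn n) _ (TnP n) (TnF n) ed.
  by exists s'; split=> //; exists e.
have [e eP] := choice (fun n => proj2 (sP n)).
have eD n : additive_on (Tn n) (e n) by have [] := eP n.
have eu n x : Tn n x -> ulm (b n) (e n x) by have [_ + _] := eP n; apply.
have eE n x : Tn n x -> s n.+1 x = s n x - h n x + e n x *+ p ^ k.
  by have [_ _] := eP n; apply.
(* The prime-to-p part m0 of n0 is inverted on the values of [e n], which the exponent of T_n
   kills. *)
have inv n : exists u, forall x, Tn n x -> e n x *+ u *+ m0 = e n x.
  have [N HN] := fin_chain_exponent n.
  have [|u [q E]] := coprime_inverse N p_prime (k := m0).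
    by rewrite -prime_coprime.
  exists u => x xn; rewrite -mulrnA mulnC E mulrnDr mulr1n mulnC mulrnA.
  by rewrite -(additive_onMn (TnP n) (eD n)) // HN // (additive_on0 (TnP n) (eD n)) mul0rn addr0.
have [u uP] := choice inv.
pose e' n x := e n x *+ u n.
have e'D n : additive_on (Tn n) (e' n).
  by move=> x y xn yn; rewrite /e' eD // mulrnDl.
have e'E n x : Tn n x -> e' n x *+ n0 = e n x *+ p ^ k.
  by move=> xn; rewrite n0E mulrnA uP.
pose th n x := \sum_(i < n) e' i x.
have thS n x : th n.+1 x = th n x + e' n x by rewrite /th big_ord_recr.
have [||d [Zd dth]] := glue_cocycle p_prime pT (f := th).
- by move=> n; rewrite /th big1 // => i _; apply: (additive_on0 (TnP i)).
- by move=> n x y xn yn; rewrite !thS e'D //; zmodule.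
exists d; split.
  (* The terms [e' n] with n < i may have a level below b i, so the sequence is made constant up to
     i. *)
  move=> i; split=> //; exists (fun n => th (maxn n i)); split=> n.
    by apply: cobound_on_le (dth _); rewrite leq_maxl.
  case: (leqP i n) => ni; last first.
    rewrite (maxn_idPr ni).
    apply: (tower_ext (hom_towerP A p_prime pT lt_wo _))
      (tower0 (hom_towerP A p_prime pT lt_wo _) n) => x _.
    by rewrite subrr.
  rewrite (maxn_idPl (leqW ni)).
  have He : hom_tower (b n) n (e' n).
    split=> // c' cb j x xn _; apply: (subgroupMn (upP A c' j)).
    by have /ulmP := eu n x xn; apply.
  have := hom_tower_le lt_wo (b_mono ni) He.
  by apply: (tower_ext (hom_towerP A p_prime pT lt_wo _)) => x _; rewrite thS; zmodule.
apply/(lim1_zero p_prime pT); split.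
  by apply: (proj2 (Zcoc_subgroup T A)) => //; apply: Zcoc_muln.
(* The increments are h n + (p^k e n - h n) - n0 e' n = 0, so these functions glue to a primitive of
   c - n0 d. *)
exists (fun n x => phi' n x + s n x - th n x *+ n0); split=> n.
  move=> x y xn yn; rewrite /vsub.
  have [r1 _] := r.
  rewrite (cobound_on_le (mun n) (r1 _)) // (cobound_on_muln n0 (dth n)) //.
  have sD := proj1 (proj1 (sP n)).
  by rewrite /cobound sD //; zmodule.
move=> x xn; rewrite thS mulrnDl e'E // eE // /h; zmodule.
Qed.

Variable U : amb T A -> Prop.
Hypothesis UE : forall c, U c <-> forall i, lim1 (hom_tower (b i)) c.

Lemma ulm_step_hom_tower c : ulm_step (@Bcob T A) U c <-> lim1 (hom_tower l) c.
Proof.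
have towP := hom_towerP A p_prime pT lt_wo.
have UP : subgroup U by apply: (lim1_inter_subgroup (H := fun i => hom_tower (b i))).
split=> [Sc|Lc n n0]; last first.
  have [d [Hd Bd]] := lim1_hom_tower_divisible n0 Lc.
  by exists d; split=> //; apply/UE.
have sub i n (f : T -> A) : hom_tower l n f -> hom_tower (b i) n f.
  by apply: hom_tower_le => //; left.
have ext i n m (f : T -> A) : (n <= m)%N -> hom_tower l n f ->
    exists g, hom_tower (b i) m g /\ forall x, Tn n x -> g x = f x.
  by move=> nm Hf; exact: (hom_tower_ext p_prime pT pA lt_wo (bl i) nm Hf).
have int := hom_tower_int p_prime pT lt_wo b_le b_cofinal (A := A).
have uniq i := @hom_tower_uniq p T A p_prime pT _ _ lt_wo (b i).
apply/(lim1_derivedP p_prime pT (fun i => towP (b i)) UE (towP l) sub ext int uniq).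
have BU e : Bcob e -> U e by move=> Be; apply/UE => i; apply: Bcob_lim1.
split.
  have [d [Ud Bd]] := Sc 1%N isT.
  have -> : c = vsub (vsub c (vmuln 1 d)) (vsub (@v0 T A) d).
    by apply: amb_ext => x y; rewrite /vsub /vmuln /v0 mulr1n; zmodule.
  apply: (proj2 UP); first exact: BU.
  by apply: (proj2 UP) => //; apply: (proj1 UP).
move=> n; have [N HN] := fin_chain_exponent n.
have [|d [Ud [f [f0 fE]]]] := Sc (p ^ N)%N; first by rewrite expn_gt0 prime_gt0.
have rep m : exists eta, lim1_rep (hom_tower (b m)) d eta.
  by have [_] := (proj1 (UE d) Ud) m.
have [eta etaP] := choice rep.
have fr m := lim1_rep_cobound (towP (b m)) f.
(* On T_n this is the same for every level m: [eta 0 n] and [eta m n] differ by a homomorphism, and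
   p^N kills T_n. *)
exists (fun x => f x + eta 0%N n x *+ p ^ N) => m nm.
exists (fun i x => f x + eta m i x *+ p ^ N); split.
  have [e1 e2] := etaP m; split=> i.
    move=> x y xi yi; have := fE x y; rewrite /vsub /vmuln (e1 i x y xi yi) => E.
    have -> : c x y = c x y - cobound (eta m i) x y *+ p ^ N +
       cobound (eta m i) x y *+ p ^ N by zmodule.
    by rewrite E /cobound !mulrnDl mulNrn; zmodule.
  have Hm : hom_tower (b m) i (fun x => (eta m i.+1 x - eta m i x) *+ p ^ N).
    have [gD gu] := e2 i; split=> [x y xi yi|d' db j x xi ux].
      by rewrite gD // mulrnDl.
    by apply: (subgroupMn (upP A d' j)); apply: gu.
  by apply: (tower_ext (towP (b m))) Hm => x _; rewrite mulrnBl; zmodule.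
move=> x xn; congr (_ + _).
have eD := cobound_on_additive (proj1 (etaP 0%N) n)
  (cobound_on_le nm (proj1 (etaP m) m)).
have := additive_onMn (TnP n) eD (p ^ N) xn.
rewrite HN // (additive_on0 (TnP n) eD) mulrnBl => /esym/eqP.
by rewrite subr_eq0 => /eqP.
Qed.

End Below.
End Divide.

(** * Ulm subgroups of Ext *)

Section Cocycle.
Variables (T A : zmodType) (S : T -> Prop) (d : T -> T -> A).
Hypothesis SP : subgroup_of S.

Definition cocycle_on := [/\ forall x, S x -> d x 0 = 0,
  forall x y, S x -> S y -> d x y = d y x
  & forall x y z, S x -> S y -> S z -> d x y + d (x + y) z = d y z + d x (y + z)].

Hypothesis dP : cocycle_on.

Let SD x y : S x -> S y -> S (x + y). Proof. exact: (subgroupD SP). Qed.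

Lemma cocycle_swap x y z : S x -> S y -> S z ->
  d x y + d (x + y) z = d x z + d (x + z) y.
Proof.
case: dP => _ dC dA Sx Sy Sz; rewrite (dA x y z) // (dA x z y) //.
by rewrite (dC z y) // [z + y]addrC.
Qed.

Lemma cocycle_rotate x y z : S x -> S y -> S z ->
  d x y + d (x + y) z = d y z + d (y + z) x.
Proof.
case: dP => _ dC dA Sx Sy Sz; rewrite (dA x y z) //; congr (_ + _).
by apply: dC => //; apply: SD.
Qed.

(* Both sides are the value of d on the sum x + y + z + t, computed in two orders. *)
Lemma cocycle_exchange x y z t : S x -> S y -> S z -> S t ->
  d x y + d z t + d (x + y) (z + t) = d x z + d y t + d (x + z) (y + t).
Proof.
move=> Sx Sy Sz St; case: (dP) => _ _ dA.
have E a b : S a -> S b -> d z t + d a (z + t) = d a z + d (a + z) t.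
  by move=> *; rewrite -dA.
have dA' a b c : S a -> S b -> S c -> d b c + d a (b + c) = d a b + d (a + b) c.
  by move=> *; rewrite dA.
rewrite -addrA dA' ?addrA //; last exact: SD.
rewrite cocycle_swap // -[RHS]addrA dA' ?addrA //; last exact: SD.
by rewrite [x + y + z]addrAC.
Qed.

(* [x]^m in the extension defined by d has A-component power_cocycle m x. *)
Definition power_cocycle m x := \sum_(i < m) d x (x *+ i).

(** The class of m d is the pullback of d along multiplication by m; hence m d becomes a coboundary
    on a subgroup killed by m. *)
Lemma power_cocycleP m x y : S x -> S y ->
  d x y *+ m - d (x *+ m) (y *+ m) =
  power_cocycle m y - power_cocycle m (x + y) + power_cocycle m x.
Proof.
move=> Sx Sy; case: (dP) => d0 _ _; have S0 := subgroup0 SP.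
elim: m => [|m IH].
  by rewrite /power_cocycle !big_ord0 !mulr0n d0 //; zmodule.
have Sxm : S (x *+ m) by apply: subgroupMn.
have Sym : S (y *+ m) by apply: subgroupMn.
have := cocycle_exchange Sx Sy Sxm Sym; rewrite -!mulrnDl -!mulrS => E.
rewrite /power_cocycle !big_ord_recr /= -!/(power_cocycle _ _).
have -> : d (x *+ m.+1) (y *+ m.+1) = d x y + d (x *+ m) (y *+ m) +
    d (x + y) ((x + y) *+ m) - (d x (x *+ m) + d y (y *+ m)).
  by rewrite E addrC addKr.
rewrite mulrSr.
have -> : d x y *+ m = d (x *+ m) (y *+ m) + (power_cocycle m y -
    power_cocycle m (x + y) + power_cocycle m x) by rewrite -IH; zmodule.
by zmodule.
Qed.
End Cocycle.

Lemma power_cocycleS (T A : zmodType) (d : T -> T -> A) m x :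
  power_cocycle d m.+1 x = power_cocycle d m x + d x (x *+ m).
Proof. by rewrite /power_cocycle big_ord_recr. Qed.

Lemma power_cocycle_cobound (T A : zmodType) (d : T -> T -> A) (f : T -> A) m x :
  f 0 = 0 -> (forall i, d x (x *+ i) = f (x *+ i) - f (x + x *+ i) + f x) ->
  power_cocycle d m x = f x *+ m - f (x *+ m).
Proof.
move=> f0 dE; elim: m => [|m IH]; first by rewrite /power_cocycle big_ord0 mulr0n f0 subr0.
by rewrite power_cocycleS IH dE -mulrS [f x *+ m.+1]mulrSr; zmodule.
Qed.

Lemma Zcoc_cocycle_on (T A : countZmodType) (c : amb T A) (S : T -> Prop) :
  Zcoc c -> cocycle_on S c.
Proof.
move=> [c0 [cC cc]]; split=> // x y z _ _ _.
apply/eqP; rewrite -subr_eq0 -oppr_eq0 -[X in _ == X](cc x y z); apply/eqP; zmodule.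
Qed.

Definition multiples (A : zmodType) (n : nat) : {pred A} := fun a => `[< exists b, a = b *+ n >].
Arguments multiples : clear implicits.

Lemma multiplesP (A : zmodType) n (a : A) : reflect (exists b, a = b *+ n) (a \in multiples A n).
Proof. exact: asboolP. Qed.

Lemma multiples_zmod_closed (A : zmodType) n : zmod_closed (multiples A n).
Proof.
split; first by apply/multiplesP; exists 0; rewrite mul0rn.
move=> _ _ /multiplesP [a ->] /multiplesP [b ->]; apply/multiplesP.
by exists (a - b); rewrite mulrnBl.
Qed.

HB.instance Definition _ (A : zmodType) n :=
  GRing.isZmodClosed.Build A (multiples A n) (multiples_zmod_closed A n).

Lemma quotient_multiples (A : zmodType) n : exists (Q : zmodType) (pr : A -> Q) (lift : Q -> A),
  [/\ forall a b, pr (a + b) = pr a + pr b, forall a, pr a = 0 <-> exists b, a = b *+ n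
    & forall q, pr (lift q) = q].
Proof.
exists {ideal_quot multiples A n}, (\pi_{ideal_quot multiples A n})%qT, repr; split.
- by move=> a b; rewrite piE.
- move=> a; split=> [E|aM].
    apply/multiplesP; rewrite -[a]subr0 Quotient.idealrBE; apply/eqP.
    by rewrite E; apply/esym; rewrite piE.
  have := Quotient.idealrBE (multiples A n) a 0; rewrite subr0.
  by have /multiplesP -> := aM => /esym/eqP ->; rewrite piE.
- by move=> q; rewrite reprK.
Qed.

(** * Splitting modulo n *)

Section ModCobound.
Variables (p : nat) (T A : countZmodType).
Hypothesis p_prime : prime p.
Hypothesis pT : p_group p T.
Hypothesis pA : p_group p A.
Local Notation Tn := (@fin_chain T).
Let TnP := fin_chain_subgroup p_prime pT.
Let TnF := fin_chain_finite p_prime pT.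

Lemma p_group_divisible n m0 k (a : A) : n = (m0 * p ^ k)%N -> coprime p m0 ->
  exists b, a *+ p ^ k = b *+ n.
Proof.
move=> -> cop; have [N aN] := pA a.
have [|u [q E]] := coprime_inverse N p_prime (k := m0).
  by rewrite -prime_coprime.
exists (a *+ u); rewrite -mulrnA mulnA [(u * m0)%N]mulnC E mulrnA mulrnDr mulr1n.
by rewrite [(q * _)%N]mulnC mulrnA aN mul0rn addr0.
Qed.

Definition pow_hom (Q : zmodType) (S : T -> Prop) (f : T -> Q) := additive_on S f /\
  forall j x, S x -> (exists z, x = z *+ p ^ j) -> exists r, f x = r *+ p ^ j.

(** Divisibility of arguments is measured in T: if p^j divides z, then p^(j+1) divides p z, so no
    height is lost. Elements of infinite height have a best index because p^k Q = 0. *)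
Lemma pow_hom_extend (Q : zmodType) k (S S' : T -> Prop) (f : T -> Q) :
  p_group p Q -> (forall q : Q, q *+ p ^ k = 0) ->
  subgroup_of S -> finite_pred S -> finite_pred S' -> pow_hom S f ->
  exists f', eq_on S f f' /\ pow_hom S' f'.
Proof.
move=> pQ Qk SP Sf [l S'l] fP.
have step (m : nat) S0 f0 x : subgroup_of S0 -> finite_pred S0 -> pow_hom S0 f0 ->
    S0 (x *+ p) -> exists f' : T -> Q, eq_on S0 f0 f' /\ pow_hom (adjoin S0 x) f'.
  move=> SP0 Sf0 [fD fX] Sx.
  have [||||||f' [f'E f'D f'X]] := @extend_to_adjoin p T Q p_prime pT pQ nat
    (fun j x => exists z, x = z *+ p ^ j) (fun j q => exists r, q = r *+ p ^ j)
    _ _ _ _ S0 f0 x SP0 Sf0 fD _ _ Sx.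
  - by move=> j _ _ [u ->] [v ->]; exists (u - v); rewrite mulrnBl.
  - by move=> j _ _ [u ->] [v ->]; exists (u - v); rewrite mulrnBl.
  - have le (V : zmodType) i j (v : V) : (i <= j)%N -> (exists z, v = z *+ p ^ j) ->
        exists z, v = z *+ p ^ i.
      by move=> ij [z ->]; exists (z *+ p ^ (j - i)); rewrite -mulrnA -expnD subnK.
    move=> i j _ _ _ _; case: (leqP i j) => [ij|/ltnW ji]; [right|left];
      by split=> z; apply: le.
  - move=> z _; case: (pselect (forall j, exists y, z = y *+ p ^ j)) => [all|].
      exists k; split=> // j _ _ [r ->]; exists 0; by rewrite Qk mul0rn.
    move=> /existsNP [j0 nj0].
    have ex : exists j, `[< ~ exists y, z = y *+ p ^ j >] by exists j0; apply/asboolP.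
    case: (ex_minnP ex) => -[|i] /asboolP ni imin.
      by case: ni; exists z; rewrite expn0 mulr1n.
    exists i; split.
      apply: contrapT => nz; have /imin : `[< ~ exists y, z = y *+ p ^ i >].
        exact/asboolP.
      by rewrite ltnn.
    move=> j [y zy] _ [r ->]; have ji : (j <= i)%N.
      rewrite leqNgt; apply/negP => ij; apply: ni.
      by exists (y *+ p ^ (j - i.+1)); rewrite -mulrnA -expnD subnK.
    by exists (r *+ p ^ (i - j)); rewrite -mulrnA -expnD subnK.
  - by move=> j s; apply: fX.
  - move=> j _ [y ->] Sy; have [|r rE] := fX j.+1 _ Sy.
      by exists y; rewrite -mulrnA -expnSr.
    by exists (r *+ p ^ j); split; [exists r|rewrite rE -mulrnA -expnSr].
  by exists f'; split=> //; split=> // j w; apply: (f'X j).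
have [L HL] := @extend_list p T (T -> Q) p_prime pT (fun _ => pow_hom (Q := Q)) _
  (@eq_on_refl T Q) (@eq_on_trans T Q) step l.
have [S1 [f1 [_ _ lS1 f1E [f1D f1X]]]] := HL 0%N S f SP Sf fP.
exists f1; split=> //; split=> [x y /S'l/lS1 ? /S'l/lS1 ?|j x /S'l/lS1]; auto.
Qed.

(* T is the union of the finite groups T_n and A/nA is bounded, so the inverse
   system of the groups Hom(T_n, A/nA) satisfies the Mittag-Leffler condition;
   hence an extension that splits over each T_n splits modulo nA. *)
Lemma cobound_mod (c : amb T A) (phi : nat -> T -> A) n0 : (0 < n0)%N -> Zcoc c ->
  (forall n, cobound_on n c (phi n)) ->
  exists chi, chi 0 = 0 /\ forall x y, exists a, c x y - cobound chi x y = a *+ n0.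
Proof.
move=> n0_gt0 Zc cphi.
have [m0 cop n0E] := pfactor_coprime p_prime n0_gt0; set k := logn p n0 in n0E.
have [Q [pr [lift [prD pr0E liftK]]]] := quotient_multiples A n0.
have pr0 : pr 0 = 0 by apply/pr0E; exists 0; rewrite mul0rn.
have prN a : pr (- a) = - pr a.
  by apply: (addrI (pr a)); rewrite -prD !subrr.
have prMn a m : pr (a *+ m) = pr a *+ m.
  by elim: m => [|m IH]; rewrite ?mulr0n // !mulrS prD IH.
have pQ : p_group p Q.
  move=> q; have [N qN] := pA (lift q); exists N.
  by rewrite -[q]liftK -prMn qN.
have Qk (q : Q) : q *+ p ^ k = 0.
  by rewrite -[q]liftK -prMn; apply/pr0E; apply: p_group_divisible n0E cop.
(* For large i the witnesses z lie in T_i, so homomorphisms on T_i respect on T_n divisibility in T.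
   Exponents above k reduce to k, since p^k Q = 0. *)
have good n : exists m, forall i, (m <= i)%N -> forall f : T -> A,
    additive_on (Tn i) f -> forall j x, Tn n x -> (exists z, x = z *+ p ^ j) ->
    exists r, pr (f x) = r *+ p ^ j.
  have [s Hs] := TnF n.
  have [|m Hm] := @finite_eventually (T * nat)%type [seq (x, j) | x <- s, j <- iota 0 k.+1]
    (fun q i => forall f : T -> A, additive_on (Tn i) f ->
      (exists z, q.1 = z *+ p ^ q.2) -> exists r, pr (f q.1) = r *+ p ^ q.2).
    move=> [x j] _ /=; case: (pselect (exists z, x = z *+ p ^ j)); last first.
      by move=> none; exists 0%N.
    move=> [z xE]; have [m zm] := fin_chain_cover p_prime pT z.
    exists m => i mi f fD _; exists (pr (f z)).
    by rewrite xE (additive_onMn (TnP i) fD) ?prMn //; apply: fin_chain_le mi zm.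
  have main i j x f : (m <= i)%N -> (j <= k)%N -> additive_on (Tn i) f -> Tn n x ->
      (exists z, x = z *+ p ^ j) -> exists r, pr (f x) = r *+ p ^ j.
    move=> mi jk fD xn xj; apply: (Hm i (x, j) mi _ f fD xj).
    by apply: allpairs_f; rewrite ?mem_iota //; apply: Hs.
  exists m => i mi f fD j x xn xj; case: (leqP j k) => [jk|/ltnW kj].
    exact: (main i).
  have [|r ->] := main i k x f mi (leqnn k) fD xn; last first.
    by rewrite Qk; exists 0; rewrite mul0rn.
  case: xj => z ->; exists (z *+ p ^ (j - k)).
  by rewrite -mulrnA -expnD subnK.
have [mu0 mu0P] := choice good.
pose mu n := (n + \sum_(i < n.+1) mu0 i)%N.
have mun n : (n <= mu n)%N by apply: leq_addr.
have mu_mono n : (mu n <= mu n.+1)%N.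
  by rewrite /mu [(\sum_(i < n.+2) _)%N]big_ord_recr /= addnA; apply/leq_trans/leq_addr; rewrite leq_add2r.
have mu0n n : (mu0 n <= mu n)%N by rewrite /mu big_ord_recr /= addnA leq_addl.
pose phi' n := phi (mu n); pose h n x := phi' n.+1 x - phi' n x.
have hD n : additive_on (Tn (mu n)) (h n).
  exact: (cobound_on_additive (cphi _) (cobound_on_le (mu_mono n) (cphi _))).
have [||s [_ sP]] := @dependent_choice_from (T -> Q) (fun n => pow_hom (Tn n))
    (fun n s s' => eq_on (Tn n) (fun x => s x - pr (h n x)) s') (fun=> 0).
- split=> [x y _ _|j x _ _]; first by rewrite addr0.
  by exists 0; rewrite mul0rn.
- move=> n s [sD sX].
  have [|s' [s'E s'X]] := @pow_hom_extend Q k (Tn n) (Tn n.+1)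
    (fun x => s x - pr (h n x)) pQ Qk (TnP n) (TnF n) (TnF n.+1); last by exists s'.
  split=> [x y xn yn|j x xn xj].
    have hxy := hD n _ _ (fin_chain_le (mun n) xn) (fin_chain_le (mun n) yn).
    by rewrite sD // hxy prD; zmodule.
  have [r ->] := sX j x xn xj.
  have [r' ->] := mu0P n (mu n) (mu0n n) _ (hD n) j x xn xj.
  by exists (r - r'); rewrite mulrnBl.
(* [s n] has increment - pr (h n) on T_n, which cancels that of [phi']; so the [F n] agree and
   glue. *)
pose F n x := pr (phi' n x) + s n x.
have [|g gE] := @glue_functions p T p_prime pT Q F.
  move=> n x xn; have [_ /(_ x xn) E] := sP n.
  by rewrite /F E /h prD prN; zmodule.
have cphi' n : cobound_on n c (phi' n) by apply: cobound_on_le (cphi _).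
have g0 : g 0 = 0.
  have z0 := fin_chain0 p_prime pT 0.
  rewrite (gE 0%N) // /F (additive_on0 (TnP 0) (proj1 (proj1 (sP 0%N)))) addr0.
  have := cphi' 0%N 0 0 z0 z0; rewrite (proj1 Zc) /cobound addr0 subrr add0r => <-.
  exact: pr0.
(* [lift 0] may be nonzero, while a normalized cochain vanishes at 0. *)
pose chi x := if x == 0 then 0 else lift (g x).
have chiE x : pr (chi x) = g x.
  by rewrite /chi; case: eqP => [->|_]; rewrite ?liftK // pr0 g0.
exists chi; split=> [|x y]; first by rewrite /chi eqxx.
apply/pr0E; have [n [xn yn]] := fin_chain_cover2 p_prime pT x y.
have xyn := fin_chainD p_prime pT xn yn.
rewrite (cphi' n) // /cobound !(prD, prN) !chiE !(gE n) // /F.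
have := proj1 (proj1 (sP n)) x y xn yn => ->; zmodule.
Qed.
End ModCobound.

(** * Cocycles on an extension by a cyclic group of order p *)

Section Digits.
Variables (p : nat) (T A : zmodType) (S : T -> Prop) (x : T).
Hypothesis p_prime : prime p.
Hypothesis pT : p_group p T.
Hypothesis SP : subgroup_of S.
Hypothesis Sxp : S (x *+ p).
Hypothesis nSx : ~ S x.

Definition digits (w : T) : T * nat :=
  if pselect (exists q : T * nat, [/\ S q.1, (q.2 < p)%N & w = q.1 + x *+ q.2])
    is left h then projT1 (cid h) else (0, 0%N).

Lemma digitsE s i : S s -> (i < p)%N -> digits (s + x *+ i) = (s, i).
Proof.
move=> Ss ip; rewrite /digits; case: pselect => [h|[]]; last by exists (s, i).
case: cid => -[t j] /= [St jp E].
have eq k m r q : S r -> S q -> (k < p)%N -> (m <= k)%N -> r + x *+ m = q + x *+ k ->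
    m = k /\ r = q.
  move=> Sr Sq kp mk E'.
  have E2 : x *+ (k - m) = r - q.
    apply: (addIr (x *+ m)); rewrite -mulrnDr subnK //.
    have -> : x *+ k = q + x *+ k - q by zmodule.
    by rewrite -E'; zmodule.
  have /(subgroup_Mn_dvd p_prime pT SP nSx) : S (x *+ (k - m)).
    by rewrite E2; apply: (subgroupB SP).
  have [d0|d1] := posnP (k - m).
    have km : k = m by lia.
    by split=> //; apply: (addIr (x *+ m)); rewrite E' km.
  by move=> /(dvdn_leq d1); lia.
case: (leqP i j) => [ij|/ltnW ji].
  by have [-> ->] := eq j i s t Ss St jp ij E.
by have [-> ->] := eq i j t s St Ss ip ji (esym E).
Qed.

Lemma adjoin_digits w : adjoin S x w -> exists s i, [/\ S s, (i < p)%N & w = s + x *+ i].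
Proof.
move=> [s [i [Ss ->]]]; exists (s + x *+ p *+ (i %/ p)), (i %% p)%N; split.
- by apply: (subgroupD SP) => //; apply: (subgroupMn SP).
- by rewrite ltn_mod prime_gt0.
- by rewrite {1}(divn_eq i p) mulrnDr [(i %/ p * p)%N]mulnC mulrnA addrA.
Qed.

Variables (d : T -> T -> A) (a : A).
Hypothesis dP : cocycle_on S d.

(* The extension of d in which the lift X of x satisfies p X = a + [x *+ p]. *)
Definition digit_cocycle w w' :=
  d (digits w).1 (digits w').1 +
  if (p <= (digits w).2 + (digits w').2)%N
  then d ((digits w).1 + (digits w').1) (x *+ p) + a else 0.

Let SD s t : S s -> S t -> S (s + t). Proof. exact: (subgroupD SP). Qed.

Lemma digit_cocycleE s t i j : S s -> S t -> (i < p)%N -> (j < p)%N ->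
  digit_cocycle (s + x *+ i) (t + x *+ j) =
  d s t + if (p <= i + j)%N then d (s + t) (x *+ p) + a else 0.
Proof. by move=> *; rewrite /digit_cocycle !digitsE. Qed.

Lemma addDigits s t i j :
  s + x *+ i + (t + x *+ j) = if (p <= i + j)%N
    then s + t + x *+ p + x *+ (i + j - p) else s + t + x *+ (i + j).
Proof.
case: leqP => [le|_]; last by rewrite mulrnDr; zmodule.
have -> : s + t + x *+ p + x *+ (i + j - p) = s + t + x *+ (p + (i + j - p)).
  by rewrite mulrnDr; zmodule.
by rewrite subnKC // mulrnDr; zmodule.
Qed.

(** The sum has one carry when i + j + k reaches p and a second one when it reaches 2p, in whatever
    order the additions are made; the right side makes this visible. *)
Lemma digit_cocycle_sum s t r i j k : S s -> S t -> S r ->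
  (i < p)%N -> (j < p)%N -> (k < p)%N ->
  digit_cocycle (s + x *+ i) (t + x *+ j) +
  digit_cocycle (s + x *+ i + (t + x *+ j)) (r + x *+ k) =
  d s t + d (s + t) r +
  (if (p <= i + j + k)%N then d (s + t + r) (x *+ p) + a else 0) +
  (if (p.*2 <= i + j + k)%N then d (s + t + r + x *+ p) (x *+ p) + a else 0).
Proof.
move=> Ss St Sr ip jp kp; rewrite addDigits digit_cocycleE //.
have Sst := SD Ss St; have Sst' := SD Sst Sxp.
case: (leqP p (i + j)) => [le|gt].
  rewrite digit_cocycleE //; last by lia.
  have -> : (p <= i + j + k)%N by lia.
  have -> : (p.*2 <= i + j + k)%N = (p <= i + j - p + k)%N by lia.
  have := cocycle_swap dP Sst Sxp Sr => E.
  have -> : s + t + x *+ p + r = s + t + r + x *+ p by rewrite addrAC.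
  set e := if _ then _ else _.
  have -> : d s t + (d (s + t) (x *+ p) + a) + (d (s + t + x *+ p) r + e) =
    d s t + (d (s + t) (x *+ p) + d (s + t + x *+ p) r) + a + e by zmodule.
  by rewrite E; zmodule.
rewrite digit_cocycleE //.
have -> : (p.*2 <= i + j + k)%N = false by lia.
by zmodule.
Qed.

Lemma digit_cocycleP : cocycle_on (adjoin S x) digit_cocycle.
Proof.
case: (dP) => d0 dC _; have p0 := prime_gt0 p_prime; have S0 := subgroup0 SP.
have C w w' : adjoin S x w -> adjoin S x w' -> digit_cocycle w w' = digit_cocycle w' w.
  move=> /adjoin_digits [s [i [Ss ip ->]]] /adjoin_digits [t [j [St jp ->]]].
  by rewrite !digit_cocycleE // dC // [(j + i)%N]addnC [t + s]addrC.
split=> //.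
  move=> _ /adjoin_digits [s [i [Ss ip ->]]].
  have := digit_cocycleE Ss S0 ip p0; rewrite mulr0n addr0 => ->.
  by rewrite addn0 leqNgt ip d0 // addr0.
(* Given commutativity, associativity is invariance of the triple sum under rotation. *)
move=> u v w Su Sv Sw; rewrite (C u (v + w)) //; last first.
  exact: (subgroupD (adjoin_subgroup p_prime pT x SP)).
case/adjoin_digits: Su => s [i [Ss ip ->]].
case/adjoin_digits: Sv => t [j [St jp ->]].
case/adjoin_digits: Sw => r [k [Sr kp ->]].
rewrite !digit_cocycle_sum // (cocycle_rotate SP dP) //.
have -> : t + r + s = s + t + r by zmodule.
by have -> : (j + k + i = i + j + k)%N by lia.
Qed.

Lemma digit_cocycle_eq s t : S s -> S t -> digit_cocycle s t = d s t.
Proof.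
move=> Ss St; have p0 := prime_gt0 p_prime.
have := digit_cocycleE Ss St p0 p0; rewrite !mulr0n !addr0 => ->.
by rewrite leqNgt p0 addr0.
Qed.

Variables (c : T -> T -> A) (f th : T -> A) (n : nat).
Hypothesis f0 : f 0 = 0.
Hypothesis cf : forall v w, adjoin S x v -> adjoin S x w ->
  c v w = f w - f (v + w) + f v.
Hypothesis cn : forall v w, exists b, c v w = b *+ n.
Hypothesis cd : forall v w, S v -> S w ->
  c v w = d v w *+ n + (th w - th (v + w) + th v).
Hypothesis thn : forall v, S v -> exists b, th v = b *+ n.
Hypothesis a_def : a *+ n = f x *+ p - f (x *+ p) + th (x *+ p).

(** For w = s + i x this is th s - c(s, i x) - P_i(x), with P_i the power cocycle of c; in this form
    its divisibility by n is apparent. *)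
Definition digit_cochain w :=
  f w - f (digits w).1 - f x *+ (digits w).2 + th (digits w).1.

Lemma digit_cochainE s i : S s -> (i < p)%N ->
  digit_cochain (s + x *+ i) = f (s + x *+ i) - f s - f x *+ i + th s.
Proof. by move=> *; rewrite /digit_cochain !digitsE. Qed.

Lemma digit_cochain_eq s : S s -> digit_cochain s = th s.
Proof.
move=> Ss; have := digit_cochainE Ss (prime_gt0 p_prime).
by rewrite !mulr0n addr0 => ->; zmodule.
Qed.

Lemma digit_cochainP v w : adjoin S x v -> adjoin S x w ->
  c v w = digit_cocycle v w *+ n +
    (digit_cochain w - digit_cochain (v + w) + digit_cochain v).
Proof.
move=> Sv Sw; rewrite cf //.
case/adjoin_digits: Sv => s [i [Ss ip ->]]; case/adjoin_digits: Sw => t [j [St jp ->]].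
have Sst := SD Ss St; have Sst' := SD Sst Sxp.
have adj r : S r -> adjoin S x r by apply: adjoin_sub.
have dn v' w' : S v' -> S w' -> d v' w' *+ n =
    f w' - f (v' + w') + f v' - (th w' - th (v' + w') + th v').
  move=> Sv' Sw'; rewrite -cf; [|exact: adj..].
  by rewrite cd //; zmodule.
rewrite digit_cocycleE // addDigits !digit_cochainE //.
case: (leqP p (i + j)) => [le|gt]; last first.
  by rewrite digit_cochainE // addr0 dn // [f x *+ (i + j)]mulrnDr; zmodule.
rewrite digit_cochainE //; last by lia.
rewrite !mulrnDl !dn // a_def.
have -> : f x *+ p = f x *+ i + f x *+ j - f x *+ (i + j - p).
  by rewrite -mulrnDr -mulrnBr; [congr (_ *+ _); lia|lia].
by zmodule.
Qed.

Lemma digit_cochain_multiple w : adjoin S x w -> exists b, digit_cochain w = b *+ n.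
Proof.
move=> /adjoin_digits [s [i [Ss ip ->]]]; rewrite digit_cochainE //.
have adj k : adjoin S x (x *+ k).
  exact: (subgroupMn (adjoin_subgroup p_prime pT x SP) k (adjoin_gen x SP)).
have := cf (adjoin_sub x Ss) (adj i) => cE.
have pE : power_cocycle c i x = f x *+ i - f (x *+ i).
  apply: power_cocycle_cobound => // j.
  by have := cf (adj 1%N) (adj j); rewrite mulr1n.
have [b1 E1] := cn s (x *+ i); have [b2 E2] := thn Ss.
have [b3 E3] : exists b, power_cocycle c i x = b *+ n.
  rewrite /power_cocycle; elim: (i) => [|k [b IH]]; first by exists 0; rewrite big_ord0 mul0rn.
  by have [b' E'] := cn x (x *+ k); exists (b + b'); rewrite big_ord_recr /= IH E' mulrnDl.
exists (b2 - b1 - b3); rewrite !mulrnBl -E1 -E2 -E3 cE pE.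
by zmodule.
Qed.
End Digits.

(** * The first Ulm subgroup of Ext and the divisible part of PExt *)

Section ExtUlm.
Variables (p : nat) (T A : countZmodType).
Hypothesis p_prime : prime p.
Hypothesis pT : p_group p T.
Hypothesis pA : p_group p A.
Local Notation Tn := (@fin_chain T).
Let TnP := fin_chain_subgroup p_prime pT.
Let TnF := fin_chain_finite p_prime pT.

Lemma cobound_on0 n (c : amb T A) f : Zcoc c -> cobound_on n c f -> f 0 = 0.
Proof.
move=> [c0 _] cf; have n0 := fin_chain0 p_prime pT n.
by have := cf 0 0 n0 n0; rewrite c0 /cobound addr0 => ->; zmodule.
Qed.

Section DivideValues.
Variables (c : amb T A) (phi : nat -> T -> A) (n : nat).
Hypothesis Zc : Zcoc c.
Hypothesis cphi : forall i, cobound_on i c (phi i).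
Hypothesis cn : forall x y, exists a, c x y = a *+ n.

(** A quotient of c by n on S, up to the coboundary of the second component. Its values are kept
    divisible by n because the next adjunction must solve an equation for n a in which such a value
    occurs. *)
Definition partial_quotient (S : T -> Prop) (q : amb T A * (T -> A)) :=
  [/\ cocycle_on S q.1,
    forall v w, S v -> S w -> c v w = q.1 v w *+ n + (q.2 w - q.2 (v + w) + q.2 v)
  & forall v, S v -> exists b, q.2 v = b *+ n].

Definition agree (S : T -> Prop) (q q' : amb T A * (T -> A)) :=
  (forall v w, S v -> S w -> q'.1 v w = q.1 v w) /\ eq_on S q.2 q'.2.

Lemma partial_quotient_step (S : T -> Prop) q x : subgroup_of S -> finite_pred S ->
  partial_quotient S q -> S (x *+ p) ->
  exists q', agree S q q' /\ partial_quotient (adjoin S x) q'.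
Proof.
move=> SP Sf [dP cd thn] Sxp.
case: (pselect (S x)) => [Sx|nSx].
  have adjS w : adjoin S x w -> S w.
    by move=> [s [i [Ss ->]]]; apply: (subgroupD SP) => //; apply: (subgroupMn SP).
  exists q; split=> //; case: dP => d0 dC dA; split.
  - by split=> [v /adjS|v w /adjS ? /adjS|u v w /adjS ? /adjS ? /adjS]; auto.
  - by move=> v w /adjS ? /adjS; apply: cd.
  - by move=> v /adjS; apply: thn.
have [l Hl] := adjoin_finite p_prime pT x Sf.
have [N HN] := fin_chain_cover_seq p_prime pT l.
have adjN w : adjoin S x w -> Tn N w by move=> /Hl/HN.
have cf v w : adjoin S x v -> adjoin S x w ->
    c v w = phi N w - phi N (v + w) + phi N v.
  by move=> /adjN vN /adjN wN; rewrite (cphi vN wN).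
have f0 := cobound_on0 Zc (@cphi N).
have adj k : adjoin S x (x *+ k).
  exact: (subgroupMn (adjoin_subgroup p_prime pT x SP) k (adjoin_gen x SP)).
have pE : power_cocycle c p x = phi N x *+ p - phi N (x *+ p).
  apply: power_cocycle_cobound => // j.
  by have := cf _ _ (adj 1%N) (adj j); rewrite mulr1n.
have [b1 E1] : exists b, power_cocycle c p x = b *+ n.
  rewrite /power_cocycle; elim: (p) => [|k [b IH]].
    by exists 0; rewrite big_ord0 mul0rn.
  have [b' E'] := cn x (x *+ k); exists (b + b').
  by rewrite big_ord_recr /= IH E' mulrnDl.
have [b2 E2] := thn _ Sxp.
(* n b1 is the power cocycle of c at p and x, so n a is the value prescribed for p times the lift of
   x. *)
pose a := b1 + b2.
have aE : a *+ n = phi N x *+ p - phi N (x *+ p) + q.2 (x *+ p).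
  by rewrite mulrnDl -E1 -E2 pE.
exists (digit_cocycle p S x q.1 a, digit_cochain p S x (phi N) q.2); split; [split|split].
- by move=> v w Sv Sw /=; apply: digit_cocycle_eq.
- by move=> v Sv /=; apply: (digit_cochain_eq p_prime pT).
- exact: digit_cocycleP.
- by move=> v w Sv Sw /=; apply: digit_cochainP aE _ _ Sv Sw.
- by move=> v Sv /=; apply: (digit_cochain_multiple p_prime pT _ _ _ f0 cf cn thn).
Qed.

Lemma agree_refl S q : agree S q q. Proof. by []. Qed.

Lemma agree_trans (S S' : T -> Prop) q r s : (forall x, S x -> S' x) ->
  agree S q r -> agree S' r s -> agree S q s.
Proof.
move=> sub [qr1 qr2] [rs1 rs2]; split; last exact: eq_on_trans rs2.
by move=> v w Sv Sw; rewrite rs1 ?qr1 //; apply: sub.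
Qed.

(** Dividing the values pointwise need not give a cocycle when A has n-torsion, so d is built along
    the chain T_n, adjoining one p-th root at a time. *)
Lemma divide_values : exists d, Zcoc d /\ Bcob (vsub c (vmuln n d)).
Proof.
have [||q [_ qP]] := @dependent_choice_from _
  (fun i => partial_quotient (Tn i)) (fun i => agree (Tn i)) (fun _ _ => 0, fun=> 0).
- have [c0 _] := Zc; split=> [|v w -> ->|v _] /=.
  + by split=> *; rewrite ?addr0.
  + by rewrite c0 mul0rn addr0 subr0 addr0.
  + by exists 0; rewrite mul0rn.
- move=> i r rP; have [l Hl] := TnF i.+1.
  have [L HL] := @extend_list p T _ p_prime pT (fun _ => partial_quotient) agree
    agree_refl agree_trans (fun _ => @partial_quotient_step) l.
  have [S [r' [_ _ lS rr' [[r0 rC rA] r2 r3]]]] := HL 0%N (Tn i) r (TnP i) (TnF i) rP.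
  have sub v : Tn i.+1 v -> S v by move=> /Hl/lS.
  exists r'; split=> //; split; first split.
  + by move=> v /sub; apply: r0.
  + by move=> v w /sub ? /sub; apply: rC.
  + by move=> u v w /sub ? /sub ? /sub; apply: rA.
  + by move=> v w /sub ? /sub; apply: r2.
  + by move=> v /sub; apply: r3.
have stable i j v w : (i <= j)%N -> Tn i v -> Tn i w -> (q j).1 v w = (q i).1 v w.
  move=> /subnK <- vi wi; elim: (j - i)%N => // k <-; rewrite addSn.
  have [_ [E _]] := qP (k + i)%N; apply: E;
    [apply: fin_chain_le vi|apply: fin_chain_le wi]; exact: leq_addl.
have [th thE] : exists th : T -> A, forall i v, Tn i v -> th v = (q i).2 v.
  apply: (glue_functions p_prime pT) => i v vi.
  by have [_ [_ E]] := qP i; apply: E.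
pose d : amb T A := fun v w => (q (projT1 (cid (fin_chain_cover2 p_prime pT v w)))).1 v w.
have dE i v w : Tn i v -> Tn i w -> d v w = (q i).1 v w.
  move=> vi wi; rewrite /d; case: cid => m /= [vm wm].
  case: (leqP i m) => [im|/ltnW mi]; first by rewrite (stable i m).
  by rewrite (stable m i).
exists d; split.
  split; [|split].
  - move=> v; have [i [vi _]] := fin_chain_cover2 p_prime pT v v.
    have i0 := fin_chain0 p_prime pT i.
    by rewrite (dE i) //; have [[[d0 _ _] _ _] _] := qP i; apply: d0.
  - move=> v w; have [i [vi wi]] := fin_chain_cover2 p_prime pT v w.
    by rewrite !(dE i) //; have [[[_ dC _] _ _] _] := qP i; apply: dC.
  - move=> u v w; have [i Hi] := fin_chain_cover_seq p_prime pT [:: u; v; w].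
    have [ui vi wi] : [/\ Tn i u, Tn i v & Tn i w].
      by split; apply: Hi; rewrite !inE eqxx ?orbT.
    have D := fin_chainD p_prime pT.
    rewrite !(dE i) //; try exact: D.
    have [[[_ _ /(_ u v w ui vi wi) dA] _ _] _] := qP i.
    have -> : (q i).1 u (v + w) = (q i).1 v w + (q i).1 u (v + w) - (q i).1 v w by zmodule.
    by rewrite -dA; zmodule.
exists th; split=> [|v w].
  rewrite (thE 0%N) //.
  have [[[d0 _ _] E _] _] := qP 0%N.
  have := E 0 0 erefl erefl; rewrite (proj1 Zc) d0 // mul0rn add0r addr0 => ->.
  by zmodule.
have [i [vi wi]] := fin_chain_cover2 p_prime pT v w.
have [[_ /(_ v w vi wi) E _] _] := qP i.
rewrite /vsub /vmuln (dE i) // E !(thE i) //; first by zmodule.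
exact: (fin_chainD p_prime pT).
Qed.
End DivideValues.

Lemma Bweak_chain (c : amb T A) : Bweak c <->
  Zcoc c /\ exists phi : nat -> T -> A, forall i, cobound_on i c (phi i).
Proof.
split=> [[Zc Hc]|[Zc [phi cphi]]]; split=> //.
  suff H i : exists f : T -> A, cobound_on i c f.
    by have [phi phiP] := choice H; exists phi.
  have [l Hl] := TnF i.
  pose l' := [seq x <- l | `[< Tn i x >]].
  have l'P x : x \in l' <-> Tn i x.
    rewrite mem_filter; split=> [/andP[/asboolP]//|xi].
    by rewrite Hl // andbT; apply/asboolP.
  have [|f [_ fE]] := Hc l'.
    split=> [|x y /l'P xi /l'P yi]; apply/l'P; first exact: (fin_chain0 p_prime pT).
    exact: (subgroupB (TnP i)).
  by exists f => x y /l'P xi /l'P yi; apply: fE.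
move=> l _; have [N HN] := fin_chain_cover_seq p_prime pT l.
exists (phi N); split; first exact: cobound_on0 (cphi N).
by move=> x y /HN xN /HN yN; apply: cphi.
Qed.

(** If p^N kills T_i, then p^N d is a coboundary on T_i. Conversely a locally trivial c can be
    changed by a coboundary so that its values lie in nA, and then divided by n. *)
Lemma Zcoc_ulm_step (c : amb T A) :
  ulm_step (@Bcob T A) (@Zcoc T A) c <-> Bweak c.
Proof.
have BZ e : @Bcob T A e -> Zcoc e by apply: Bcob_Zcoc.
have [Z0 ZB] := Zcoc_subgroup T A.
split=> [Sc|Bc n n0].
  apply/Bweak_chain; split.
    have [d [Zd Bd]] := Sc 1%N isT.
    have -> : c = vsub (vsub c (vmuln 1 d)) (vsub (@v0 T A) d).
      by apply: amb_ext => x y; rewrite /vsub /vmuln /v0 mulr1n; zmodule.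
    by apply: (ZB); [exact: BZ|exact: (ZB)].
  suff H i : exists f : T -> A, cobound_on i c f.
    by have [phi phiP] := choice H; exists phi.
  have [N HN] := fin_chain_exponent p_prime pT i.
  have [|d [Zd [f [f0 fE]]]] := Sc (p ^ N)%N; first by rewrite expn_gt0 prime_gt0.
  exists (fun x => f x + power_cocycle d (p ^ N) x) => x y xi yi.
  have := power_cocycleP (TnP i) (Zcoc_cocycle_on (Tn i) Zd) (p ^ N) xi yi.
  rewrite HN // HN // (proj1 Zd) subr0 => E.
  have -> : c x y = vsub c (vmuln (p ^ N) d) x y + d x y *+ p ^ N.
    by rewrite /vsub /vmuln; zmodule.
  by rewrite fE E /cobound; zmodule.
have [Zc [phi cphi]] := (proj1 (Bweak_chain c)) Bc.
have [chi [chi0 chiE]] := cobound_mod p_prime pT pA n0 Zc cphi.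
have Bchi : Bcob (cobound chi) by exists chi.
have [||d [Zd Bd]] := @divide_values (vsub c (cobound chi))
    (fun i x => phi i x - chi x) n _ _ chiE.
- by apply: (ZB) => //; apply: BZ.
- by move=> i x y xi yi; rewrite /vsub (cphi i) // /cobound; zmodule.
exists d; split=> //.
have -> : vsub c (vmuln n d) =
    vsub (vsub (vsub c (cobound chi)) (vmuln n d)) (vsub (@v0 T A) (cobound chi)).
  by apply: amb_ext => x y; rewrite /vsub /v0; zmodule.
have [B0 BB] := Bcob_subgroup T A.
by apply: (BB) => //; apply: (BB).
Qed.

(* If c_k = p c_(k+1) + delta phi_k for all k, then on T[p^n] the cocycle c_0 is the
   coboundary of P_(p^n) c_n + sum_(i < n) p^i phi_i, and these are compatible. *)
Lemma divisible_part_trivial (c : amb T A) :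
  divisible_part (@Bweak T A) (@Bcob T A) c -> Bcob c.
Proof.
move=> [D [DP [BD [DG [Ddiv Dc]]]]].
have [|cc [cc0 ccP]] := @dependent_choice_from (amb T A) (fun _ => D)
   (fun _ e e' => Bcob (vsub e (vmuln p e'))) c Dc.
  by move=> _ e De; have [e' [De' Be']] := Ddiv e p De (prime_gt0 p_prime); exists e'.
have ZD i : Zcoc (cc i) by have [/DG []] := ccP i.
have [f fP] := choice (fun i => proj2 (ccP i)).
have f0 i : f i 0 = 0 by have [] := fP i.
have ccE i x y : cc i x y = cc i.+1 x y *+ p + (f i y - f i (x + y) + f i x).
  have [_ /(_ x y) <-] := fP i; rewrite /vsub /vmuln; zmodule.
pose g n x := power_cocycle (cc n) (p ^ n) x + \sum_(i < n) f i x *+ p ^ i.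
have gS n (x : T) : x *+ p ^ n = 0 -> g n.+1 x = g n x.
  move=> x0; rewrite /g big_ord_recr /= addrA addrAC; congr (_ + _).
  have E : power_cocycle (cc n) (p ^ n) x =
      power_cocycle (cc n.+1) (p ^ n) x *+ p + power_cocycle (cobound (f n)) (p ^ n) x.
    rewrite /power_cocycle -sumrMnl -big_split /=; apply: eq_bigr => i _.
    by rewrite ccE.
  rewrite E (@power_cocycle_cobound T A (cobound (f n)) (f n) (p ^ n) x (f0 n)) // x0 f0 subr0; congr (_ + _).
  (* As p^n x = 0, the terms d(x, j x) are periodic in j with period p^n, so summing up to p^(n+1)
     gives p times the sum up to p^n. *)
  have per k m : power_cocycle (cc n.+1) (m + p ^ n * k) x =
      power_cocycle (cc n.+1) m x + power_cocycle (cc n.+1) (p ^ n) x *+ k.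
    elim: k m => [|k IH] m; first by rewrite muln0 addn0 addr0.
    have shift j : power_cocycle (cc n.+1) (p ^ n + j) x =
        power_cocycle (cc n.+1) (p ^ n) x + power_cocycle (cc n.+1) j x.
      elim: j => [|j IHj]; first by rewrite addn0 /power_cocycle big_ord0 addr0.
      by rewrite addnS !power_cocycleS IHj mulrnDr x0 add0r addrA.
    have -> : (m + p ^ n * k.+1 = p ^ n + (m + p ^ n * k))%N by rewrite mulnS addnCA.
    by rewrite shift IH mulrSr; zmodule.
  by rewrite expnSr -[(_ * p)%N]add0n per /power_cocycle big_ord0 add0r.
have E0 n x y : c x y = cc n x y *+ p ^ n +
    \sum_(i < n) (f i y - f i (x + y) + f i x) *+ p ^ i.
  elim: n => [|n IH]; first by rewrite big_ord0 addr0 expn0 mulr1n cc0.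
  by rewrite IH big_ord_recr /= ccE mulrnDl -mulrnA -expnS; zmodule.
have gE n (x y : T) : x *+ p ^ n = 0 -> y *+ p ^ n = 0 -> c x y = g n y - g n (x + y) + g n x.
  move=> x0 y0; pose S z := z *+ p ^ n = 0 :> T.
  have SP : subgroup_of S.
    by split; rewrite /S ?mul0rn // => u v u0 v0; rewrite mulrnBl u0 v0 subr0.
  rewrite (E0 n); have := power_cocycleP SP (Zcoc_cocycle_on S (ZD n)) (p ^ n) x0 y0.
  rewrite x0 y0 (proj1 (ZD n)) subr0 => ->.
  have -> : \sum_(i < n) (f i y - f i (x + y) + f i x) *+ p ^ i =
     \sum_(i < n) f i y *+ p ^ i - \sum_(i < n) f i (x + y) *+ p ^ i +
     \sum_(i < n) f i x *+ p ^ i.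
    rewrite -sumrB -big_split; apply: eq_bigr => i _.
    by rewrite mulrnDl mulrnBl.
  by rewrite /g; zmodule.
have gle n m (x : T) : (n <= m)%N -> x *+ p ^ n = 0 -> g m x = g n x.
  move=> /subnK <- x0; elim: (m - n)%N => // k <-; rewrite addSn gS //.
  by rewrite expnD mulnC mulrnA x0 mul0rn.
pose h x := g (projT1 (cid (pT x))) x.
have hE n (x : T) : x *+ p ^ n = 0 -> h x = g n x.
  rewrite /h; case: cid => m /= xm xn.
  by case: (leqP n m) => [/gle->|/ltnW/gle ->].
have all (x y : T) : exists n, [/\ x *+ p ^ n = 0, y *+ p ^ n = 0 & (x + y) *+ p ^ n = 0].
  have [i xi] := pT x; have [j yj] := pT y; exists (i + j)%N.
  have xz : x *+ p ^ (i + j) = 0 by rewrite expnD mulrnA xi mul0rn.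
  have yz : y *+ p ^ (i + j) = 0 by rewrite expnD mulnC mulrnA yj mul0rn.
  by rewrite mulrnDl xz yz addr0.
exists h; split=> [|x y].
  rewrite (hE 0%N) ?mul0rn // /g expn0 big_ord0 addr0 /power_cocycle big_ord1.
  by rewrite mulr0n (proj1 (ZD 0%N)).
by have [n [x0 y0 xy0]] := all x y; rewrite !(hE n) //; apply: gE.
Qed.
End ExtUlm.

(** * The transfinite induction *)

Section ZTopology.
Variables (p : nat) (T A : countZmodType).
Hypothesis p_prime : prime p.
Hypothesis pT : p_group p T.
Local Notation Tn := (@fin_chain T).
Local Notation G := (sub_of (Zcoc_subgroup T A)).

(** Cocycles in Z need not be coboundaries on the T_n, so smallness is expressed by their values
    rather than by primitives. *)
Definition Zcoc_filtration m (c : G) := forall x y, Tn m x -> Tn m y -> cval c x y = 0.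

Lemma Zcoc_filtrationP : filtration Zcoc_filtration.
Proof.
split.
- move=> m; split=> [//|c d c0 d0 x y xm ym].
  by rewrite cvalB /vsub c0 // d0 // subrr.
- move=> m c c0 x y xm ym; apply: c0; exact: fin_chain_le (leqnSn m) _.
- move=> c c0; apply/cval_inj/amb_ext => x y.
  by have [n [xn yn]] := fin_chain_cover2 p_prime pT x y; apply: (c0 n).
- pose l n := projT1 (cid (fin_chain_list p_prime pT n)).
  have lP n x : Tn n x -> x \in l n by move/(projT2 (cid (fin_chain_list p_prime pT n))).
  pose code m (c : G) := [seq cval c q.1 q.2 | q <- [seq (x, y) | x <- l m, y <- l m]].
  pose pick (q : nat * seq A) : G :=
    if pselect (exists c, code q.1 c = q.2) is left h then projT1 (cid h) else 0.
  have pickP m c : code m (pick (m, code m c)) = code m c.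
    rewrite /pick; case: pselect => [h|[]]; last by exists c.
    exact: (projT2 (cid h)).
  exists (fun n => pick (odflt (0%N, [::]) (unpickle n))) => c m.
  exists (pickle (m, code m c)) => x y xm ym; rewrite cvalB pickleK.
  have /eq_in_map/(_ (x, y)) := pickP m c => /(_ _) E.
  rewrite /vsub -[cval c x y]E /= ?subrr //; apply: allpairs_f; exact: lP.
move=> c Wc.
have stable n i x y : (n <= i)%N -> Tn n x -> Tn n y -> cval (c i) x y = cval (c n) x y.
  move=> /subnK <- xn yn; elim: (i - n)%N => // k <-; rewrite addSn.
  have := Wc (k + n)%N x y; rewrite cvalB => E; apply/subr0_eq/E.
    by apply: fin_chain_le xn; rewrite leq_addl.
  by apply: fin_chain_le yn; rewrite leq_addl.
pose d : amb T A := fun x y =>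
  cval (c (projT1 (cid (fin_chain_cover2 p_prime pT x y)))) x y.
have dE n x y : Tn n x -> Tn n y -> d x y = cval (c n) x y.
  move=> xn yn; rewrite /d; case: cid => m /= [xm ym].
  by case: (leqP m n) => [mn|/ltnW nm]; [rewrite (stable m n)|rewrite (stable n m)].
have Zd : Zcoc d.
  split; [|split].
  - move=> x; have [n [xn _]] := fin_chain_cover2 p_prime pT x x.
    have n0 := fin_chain0 p_prime pT n.
    have [z _] := proj2_sig (c n).
    by rewrite (dE n) //; apply: z.
  - move=> x y; have [n [xn yn]] := fin_chain_cover2 p_prime pT x y.
    have [_ [z _]] := proj2_sig (c n).
    by rewrite !(dE n) //; apply: z.
  - move=> x y z; have [n Hn] := fin_chain_cover_seq p_prime pT [:: x; y; z].
    have [xn yn zn] : [/\ Tn n x, Tn n y & Tn n z].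
      by split; apply: Hn; rewrite !inE eqxx ?orbT.
    have [_ [_ zc]] := proj2_sig (c n).
    by rewrite !(dE n) //; try exact: (fin_chainD p_prime pT); exact: zc.
exists (exist _ _ Zd : G) => m x y xm ym.
by rewrite cvalB /vsub /cval /= (dE m) // subrr.
Qed.

Lemma Zcoc_cover_top : @cover_top T A (@Zcoc T A) (filtration_topology Zcoc_filtration).
Proof.
apply: (@cover_top_filtration T A _ (Zcoc_subgroup T A) Zcoc_filtration Zcoc_filtrationP).
move=> x y; have [n [xn yn]] := fin_chain_cover2 p_prime pT x y.
by exists n => c; apply.
Qed.

(** In every admissible topology, agreement with c on a finite subgroup defines a neighbourhood of
    c. Conversely c is the limit, in the explicit topology, of the coboundaries of the [phi m]. *)
Lemma solecki0_Zcoc c : solecki0 (@Zcoc T A) (@Bcob T A) c <-> Bweak c.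
Proof.
split=> [[tau [[_ [_ fine]] [g [<- gB]]]]|Bc].
  split; first exact: (proj2_sig g).
  move=> l [l0 _].
  pose V (e : amb T A) := forall x y, x \in l -> y \in l -> e x y = proj1_sig g x y.
  have [|//|h [Vh [f [f0 fE]]]] := gB _ (fine V _).
    move=> e Ve; exists [seq (x, y) | x <- l, y <- l] => e' Ee x y xl yl.
    rewrite -Ve //; apply: (Ee (x, y)); exact: allpairs_f.
  by exists f; split=> // x y xl yl; rewrite -Vh.
have [Zc [phi cphi]] := (proj1 (Bweak_chain p_prime pT c)) Bc.
exists (filtration_topology Zcoc_filtration); split; first exact: Zcoc_cover_top.
exists (exist _ _ Zc); split=> // V oV Vc; have [m Hm] := oV _ Vc.
have f0 := cobound_on0 p_prime pT Zc (cphi m).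
pose e : G := exist _ _ (Zcoc_cobound f0).
exists e; split; last by exists (phi m).
by apply: Hm => x y xm ym; rewrite cvalB /vsub /cval /= (cphi m) // subrr.
Qed.
End ZTopology.

Section Final.
Variables (p : nat) (T A : countZmodType).
Hypothesis p_prime : prime p.
Hypothesis pT : p_group p T.
Hypothesis pA : p_group p A.
Variables (O : Type) (lt : O -> O -> Prop).
Hypothesis O_count : countable_type O.
Hypothesis lt_wo : strict_well_order lt.

(* Adding a least element makes room for the shift by 1 in Ext(T, A)^(1 + a): the
   group of level Some a is cut out by the conditions of the levels below. *)
Definition option_lt (u v : option O) : Prop :=
  match u, v with
  | None, Some _ => True
  | Some a, Some b => lt a b
  | _, None => False
  end.

Lemma option_lt_wo : strict_well_order option_lt.
Proof.
have [irr [tr [tot wf]]] := lt_wo; split; [|split; [|split]].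
- by case=> [a|] //=; apply: irr.
- by case=> [a|] [b|] [c|] //=; apply: tr.
- case=> [a|] [b|] /=; [|by right; right|by left|by right; left].
  by case: (tot a b) => [|[->|]]; [left|right; left|right; right].
- have accN : Acc option_lt None by constructor; case.
  have accS : forall a, Acc option_lt (Some a).
    apply: (well_founded_ind wf) => a IH; constructor=> -[b|] ba; last exact: accN.
    exact: IH.
  by move=> [a|]; [exact: accS|exact: accN].
Qed.

Local Notation wle := (wle option_lt).
Local Notation hom_tower := (@hom_tower p T A _ option_lt).

(** Stage i moves past the element of O with code i when it lies below a. The sequence is only
    weakly increasing, as a may have a predecessor. *)
Lemma cofinal_sequence (a : O) : exists b : nat -> option O,
  [/\ forall i, option_lt (b i) (Some a), forall i, wle (b i) (b i.+1)
    & forall d, option_lt d (Some a) -> exists i, wle d (b i)].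
Proof.
have [f f_inj] := O_count; have [irr [tr [tot _]]] := option_lt_wo.
have [||b [_ bP]] := @dependent_choice_from (option O)
  (fun _ u => option_lt u (Some a))
  (fun i u v => wle u v /\ forall d, f d = i -> lt d a -> wle (Some d) v) None.
- by [].
- move=> i u ua; case: (pselect (exists d, f d = i /\ lt d a)) => [[d [di da]]|none].
    have dE e : f e = i -> e = d by move=> ei; apply: f_inj; rewrite ei.
    case: (tot u (Some d)) => [ud|du].
      by exists (Some d); split=> //; split=> [|e /dE -> _]; [left|right].
    exists u; split=> //; split=> [|e /dE -> _]; first by right.
    by case: du => [->|du]; [right|left].
  exists u; split=> //; split=> [|d di da]; first by right.
  by case: none; exists d.
exists b; split=> [i|i|[d|] da].
- by have [] := bP i.
- by have [_ []] := bP i.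
- by have [_ [_ H]] := bP (f d); exists (f d).+1; apply: H.
- by exists 0%N; case: (b 0%N) => [e|]; [left|right].
Qed.

Definition below (l : option O) (c : amb T A) : Prop :=
  forall d, option_lt d l -> lim1 (hom_tower d) c.

Lemma lim1_hom_tower_le d l c : wle d l -> lim1 (hom_tower l) c -> lim1 (hom_tower d) c.
Proof.
move=> dl [Zc [phi [r1 r2]]]; split=> //; exists phi; split=> // n.
by apply: (hom_tower_le option_lt_wo dl).
Qed.

Lemma belowE a (b : nat -> option O) : (forall i, option_lt (b i) (Some a)) ->
  (forall d, option_lt d (Some a) -> exists i, wle d (b i)) ->
  forall c, below (Some a) c <-> forall i, lim1 (hom_tower (b i)) c.
Proof.
move=> ba bcof c; split=> [Hc i|Hc d /bcof [i di]]; first exact: Hc.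
exact: lim1_hom_tower_le di (Hc i).
Qed.

Lemma solecki1_below a : seteq (solecki1 (@Bcob T A) (below (Some a)))
  (lim1 (hom_tower (Some a))).
Proof.
move=> c; have [b [ba ble bcof]] := cofinal_sequence a.
exact: (solecki1_hom_tower p_prime pT pA option_lt_wo ba ble bcof (belowE ba bcof)).
Qed.

Lemma ulm_step_below a : seteq (ulm_step (@Bcob T A) (below (Some a)))
  (lim1 (hom_tower (Some a))).
Proof.
move=> c; have [b [ba ble bcof]] := cofinal_sequence a.
exact: (ulm_step_hom_tower p_prime pT pA option_lt_wo ba ble bcof (belowE ba bcof)).
Qed.

Lemma Bweak_lim1 : seteq (@Bweak T A) (lim1 (hom_tower None)).
Proof.
move=> c; split=> [/(Bweak_chain p_prime pT) [Zc [phi cphi]]|[Zc [phi [cphi _]]]].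
  split=> //; exists phi; split=> // n; split=> [|d]; last by case: d.
  exact: cobound_on_additive (cphi n) (cobound_on_le (leqnSn n) (cphi n.+1)).
by apply/(Bweak_chain p_prime pT); split=> //; exists phi.
Qed.

(** B is dense in B_w for the finer topology too: if c is represented by phi, subtracting the
    coboundary of [phi m] leaves a cocycle with a primitive vanishing on T_m. *)
Lemma solecki0_Bweak : seteq (solecki0 (@Bweak T A) (@Bcob T A)) (@Bweak T A).
Proof.
move=> c; split=> [[tau [_ [g [<- _]]]]|Bc]; first exact: (proj2_sig g).
pose H (i : nat) := hom_tower None.
have HP i : tower (H i) by exact: (hom_towerP A p_prime pT option_lt_wo None).
have UE e : Bweak e <-> forall i, lim1 (H i) e.
  by rewrite (Bweak_lim1 e); split=> [//|/(_ 0%N)].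
exists (lim1_topology HP UE); split; first exact: (lim1_cover_top p_prime pT).
exists (exist _ _ Bc); split=> // V oV Vc; have [m Hm] := oV _ Vc.
have [Zc [phi r]] := (proj1 (Bweak_lim1 c)) Bc.
have f0 := cobound_on0 p_prime pT Zc (proj1 r m).
have Be : Bcob (cobound (phi m)) by exists (phi m).
have We : Bweak (cobound (phi m)) by apply/UE => i; apply: Bcob_lim1 (HP i) _ Be.
exists (exist _ _ We); split=> //; apply: Hm.
pose G := sub_of (lim1_inter_subgroup HP UE).
pose gc : G := exist _ _ Bc; pose ge : G := exist _ _ We.
rewrite -[X in lim1_filtration m X]/(ge - gc) -opprB -sub0r.
have [/(_ m) [W0 WB] _ _ _ _] :
    filtration (@lim1_filtration _ _ _ HP _ UE).
  by apply: (lim1_filtrationP p_prime pT).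
apply: WB => //; rewrite /lim1_filtration cvalB.
apply: (lim1_small_at (HP m) (lim1_repB (HP m) r (lim1_rep_cobound (HP m) (phi m)))).
by move=> x _; rewrite subrr.
Qed.

(** The four sequences differ only in their start and step, so one induction serves them all. At a
    successor of b, the levels below [Some a] end with [Some b], whose lim^1 group is the step of
    the previous one. *)
Lemma transfinite_below start step (S : O -> amb T A -> Prop) :
  seteq start (@Bweak T A) ->
  (forall a, seteq (step (below (Some a))) (lim1 (hom_tower (Some a)))) ->
  transfinite_seq lt start step S -> forall a, seteq (S a) (below (Some a)).
Proof.
move=> startE stepE [Smin [Ssucc Slim]].
have [irr [tr [tot wf]]] := lt_wo.
elim/(well_founded_ind wf) => a IH c.
case: (pselect (exists b, lt b a)) => [[b0 b0a]|none]; last first.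
  rewrite (Smin a _ c) => [|b ba]; last by apply: none; exists b.
  rewrite (startE c) (Bweak_lim1 c); split=> [Lc [b ba|_]|Hc] //.
    by case: none; exists b.
  exact: (Hc None).
case: (pselect (forall b, lt b a -> exists c, lt b c /\ lt c a)) => [lim|].
  rewrite (Slim a _ lim c); last by exists b0.
  split=> [Hc [e|] ea|Hc b ba].
  - by have [e' [ee' e'a]] := lim e ea; have /(IH e' e'a) := Hc e' e'a; apply.
  - by have /(IH b0 b0a) := Hc b0 b0a; apply.
  - apply/(IH b ba) => d db; apply: Hc.
    by case: d db => [d|] //= db; apply: tr db ba.
move=> /existsNP [b /not_implyP [ba nolt]].
have succ c' : ~ (lt b c' /\ lt c' a) by move=> bca; apply: nolt; exists c'.
(* [step] is an arbitrary operator on predicates, so the induction hypothesis has to be turned into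
   an equality. *)
have SbE : S b = below (Some b) by apply/funext => e; apply/propext/(IH b ba).
rewrite (Ssucc a b ba succ c) SbE (stepE b c).
split=> [Lc d da|]; last by apply.
apply: lim1_hom_tower_le Lc; case: d da => [d|] //= da; last by left.
case: (tot d b) => [db|[->|bd]]; [by left|by right|].
by case: (succ d).
Qed.

Lemma divisible_part_Bcob : seteq (divisible_part (@Bweak T A) (@Bcob T A)) (@Bcob T A).
Proof.
move=> c; split; first exact: (divisible_part_trivial p_prime pT).
move=> Bc; exists (@Bcob T A); split; first exact: Bcob_subgroup.
split=> //; split=> [e Be|]; last split=> // e n Be n0.
  apply/Bweak_lim1; apply: Bcob_lim1 Be.
  exact: (hom_towerP A p_prime pT option_lt_wo None).
exists (@v0 T A); split; first exact: (proj1 (Bcob_subgroup T A)).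
have -> // : vsub e (vmuln n (@v0 T A)) = e.
by apply: amb_ext => x y; rewrite /vsub /vmuln /v0 mul0rn subr0.
Qed.
End Final.

Theorem theorem4p19 (p : nat) (T A : countZmodType) :
  prime p -> p_group p T -> p_group p A ->
  forall (O : Type) (lt : O -> O -> Prop),
    countable_type O -> strict_well_order lt ->
  forall SE SP UE UP : O -> amb T A -> Prop,
    (* s_a(Ext(T,A)), Ext = Z/B *)
    solecki_seq lt (@Zcoc T A) (@Bcob T A) SE ->
    (* s_a(PExt(T,A)), PExt = B_w/B *)
    solecki_seq lt (@Bweak T A) (@Bcob T A) SP ->
    (* Ext(T,A)^(1+a) *)
    ulm_seq_from lt (ulm_step (@Bcob T A) (@Zcoc T A)) (@Bcob T A) UE ->
    (* PExt(T,A)^a *)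
    ulm_seq_from lt (@Bweak T A) (@Bcob T A) UP ->
  forall a : O,
    seteq (SE a) (SP a) /\ seteq (SP a) (UP a) /\ seteq (UP a) (UE a) /\
    (seteq (SP a) (@Bcob T A) <->
     seteq (UP a) (divisible_part (@Bweak T A) (@Bcob T A))).
Proof.
move=> p_prime pT pA O lt Oc wo SE SP UE UP hSE hSP hUE hUP a.
have sol := solecki1_below p_prime pT pA Oc wo.
have ulm := ulm_step_below p_prime pT pA Oc wo.
have SEa := transfinite_below p_prime pT wo (solecki0_Zcoc p_prime pT (A := A)) sol hSE a.
have SPa := transfinite_below p_prime pT wo (solecki0_Bweak p_prime pT wo (A := A)) sol hSP a.
have UEa := transfinite_below p_prime pT wo (Zcoc_ulm_step p_prime pT pA) ulm hUE a.
have UPa := transfinite_below p_prime pT wo (fun c => iff_refl _) ulm hUP a.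
have divE := divisible_part_Bcob p_prime pT wo (A := A).
(* In each tuple the first rule that applies is used, so one script covers the three
   equivalences. *)
do 3![split; first by move=> c; rewrite (SEa c, SPa c, UPa c) (SPa c, UPa c, UEa c)].
(* By [divE] both conditions say that the common group equals B. *)
split=> E c.
  by rewrite (UPa c) (divE c) -(E c) (SPa c).
by rewrite (SPa c) -(divE c) -(E c) (UPa c).
Qed.
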